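(* Let $r_n\in(0,1)$ and $t_n\in\mathbb{R}$ for $n\in\mathbb{N}$, and assume that $\{r_ne^{it_n}:n\in\mathbb{N}\}$ (points counted with multiplicity) is a zero set for the Dirichlet space $\mathcal{D}$. Let $s_n\in[r_n,1)$ for each $n$. Then $\{s_ne^{it_n}:n\in\mathbb{N}\}$ (points counted with multiplicity) is also a zero set for $\mathcal{D}$.
   Context: $\mathbb{D}$ is the open unit disc in $\mathbb{C}$. The Dirichlet space $\mathcal{D}$ is the space of analytic functions $f$ on $\mathbb{D}$ with $\int_{\mathbb{D}}|f'|^2\,dA<\infty$, where $A$ is normalized area measure on $\mathbb{D}$. A sequence $S$ of points of $\mathbb{D}$ (finitely many repetitions of each point allowed, repetitions encoding multiplicities) is a zero set for $\mathcal{D}$ if there is $f\in\mathcal{D}$ that vanishes exactly on $S$: $f$ has a zero of multiplicity exactly $k$ at $z$ for each $z$ repeated $k$ times in $S$, and $f(z)\neq0$ for every $z\in\mathbb{D}\setminus S$. *)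

(* Defs.v *)
From HB Require Import structures.
From mathcomp Require Import all_boot all_order all_algebra.
From mathcomp Require Import all_classical all_reals all_analysis.
From mathcomp Require Import complex.

Set Implicit Arguments.
Unset Strict Implicit.
Unset Printing Implicit Defensive.

Import Order.TTheory GRing.Theory Num.Theory.
Import numFieldNormedType.Exports.

Local Open Scope classical_set_scope.
Local Open Scope ring_scope.
Local Open Scope complex_scope.
Local Open Scope card_scope.

(* [R[i]^o] rather than [R[i]]: the norm topology is attached to the regular
   module of a numFieldType. *)
Notation cplx R := (R[i]^o) (only parsing).

Definition unit_disc (R : realType) : set (cplx R) := [set z | `|z| < 1].

Definition expi (R : realType) (t : R) : cplx R := cos t +i* sin t.

Definition analytic_at (R : realType) (f : cplx R -> cplx R) (a : cplx R) :
    Prop :=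
  exists c : nat -> cplx R, \forall z \near a,
    series (fun n => c n * (z - a) ^+ n) @ \oo --> f z.

(* Values of [f] outside [U] are irrelevant when [U] is open. *)
Definition analytic_on (R : realType) (U : set (cplx R))
    (f : cplx R -> cplx R) : Prop :=
  forall a, U a -> analytic_at f a.

(* With k = 0 this says that the analytic function f does not vanish at a. *)
Definition zero_of_multiplicity (R : realType) (f : cplx R -> cplx R)
    (a : cplx R) (k : nat) : Prop :=
  exists g : cplx R -> cplx R,
    [/\ analytic_at g a, g a != 0 &
        \forall z \near a, f z = (z - a) ^+ k * g z].

(* C is identified with R * R through (x, y) |-> x + i y; the factor 1/pi
   makes the area of the unit disc equal to 1. *)
Definition normalized_area (R : realType) :
    {measure set (measurableTypeR R * measurableTypeR R) -> \bar R} :=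
  mscale ((NngNum (pi_ge0 R))%:num^-1)%:nng
    (@lebesgue_measure R \x @lebesgue_measure R)%E.

(* The norm on R[i] takes values in R[i]; complex.Re brings it back to R. *)
Definition dirichlet_integral (R : realType) (f : cplx R -> cplx R) : \bar R :=
  (\int[normalized_area R]_(p in [set p | unit_disc (p.1 +i* p.2)])
     (complex.Re `|derive1 f (p.1 +i* p.2)| ^+ 2)%:E)%E.

Definition dirichlet_space (R : realType) : set (cplx R -> cplx R) :=
  [set f | analytic_on (@unit_disc R) f /\ (dirichlet_integral f < +oo)%E].

(* The multiplicity of z in the sequence a is the number of indices n with
   a n = z; it is required to be a natural number, i.e. finite. *)
Definition dirichlet_zero_set (R : realType) (a : nat -> cplx R) : Prop :=
  (forall n, unit_disc (a n)) /\
  exists2 f, dirichlet_space f &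
    forall z, unit_disc z ->
      exists2 k : nat, [set n | a n = z] #= `I_k & zero_of_multiplicity f z k.

(* Main.v *)
Require Import Defs.
From HB Require Import structures.
From mathcomp Require Import all_boot all_order all_algebra.
From mathcomp Require Import all_classical all_reals all_analysis.
From mathcomp Require Import complex.
From mathcomp Require Import measurable_realfun ring lra.

(* Let f in D have f(0) <> 0 and a zero p = r e^{it}, which is to be moved to q = s e^{it}.
   Write f = (1 - z / p) g and, after a rotation, t = 0. In any seminorm expanded by the shift,
   such as the Dirichlet seminorm, |g - u z g|^2 is nondecreasing in u >= 1, since its
   derivative 2 u |z g|^2 - 2 Re <g, z g> is nonnegative. As 1 / s <= 1 / r, replacing the factor
   1 - z / p by 1 - z / q does not increase the Dirichlet integral, and it preserves f(0).
   In H^2, where the shift is isometric, the same computation gains a factor r / s in the squared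
   norm. Pushing all zeros to the circle (s = 1) thus bounds the product of the r_n away from 0,
   that is, sum (1 - r_n) < oo. Consequently the functions with the first N zeros moved converge
   coefficientwise, with bounded Dirichlet integrals, and no zero is gained or lost in the limit.
   The Dirichlet integral of sum a_n z^n is comparable to sum n |a_n|^2, because averaging
   |f'|^2 over rotations of the plane kills the cross terms. *)

Set Implicit Arguments.
Unset Strict Implicit.
Unset Printing Implicit Defensive.

Import Order.TTheory GRing.Theory Num.Theory.
Import numFieldNormedType.Exports.

Local Open Scope classical_set_scope.
Local Open Scope ring_scope.
Local Open Scope complex_scope.

Import Normc.

(** * Complex sequences and power series *)

Section ComplexModulus.
Variable R : realType.
Implicit Types (z w : R[i]) (x : R).

(** Analyticity is given by local power series only, so a single expansion valid on the whole disc
    has to be produced; Cauchy's estimate for this comes from averages over roots of unity, not from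
    contour integrals. Functions are then handled as coefficient sequences [a], evaluated by [ev a],
    and division by z - w is the shift [bshift w]. All bounds have the form c k^n, which survives
    coefficientwise limits. With b the coefficients of f / (z - p), moving p to p / lam (where lam =
    r / s) replaces b_n - p b_{n+1} by lam b_n - p b_{n+1}. Both norm estimates thus hold
    coefficient by coefficient up to telescoping terms, and the boundary terms vanish because the
    Dirichlet integral is finite. The obstacle in the limit is that a nonzero value might degenerate
    to 0. At a fixed w, once the points still to be moved are close to the circle, each move
    multiplies the leading Taylor coefficient at w by (lam w - p) / (w - p), and the Blaschke sum
    keeps the product of these factors away from 0. *)

Lemma normc_ge0 z : 0 <= normc z.
Proof. by case: z => a b; exact: sqrtr_ge0. Qed.

Lemma normr_normc z : `|z| = (normc z)%:C. Proof. by []. Qed.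

Lemma normc_real x : normc x%:C = `|x|.
Proof. by rewrite /= expr0n /= addr0 sqrtr_sqr. Qed.

Lemma normcD z w : normc (z + w) <= normc z + normc w.
Proof. exact: le_normcD. Qed.

Lemma normcNE z : normc (- z) = normc z.
Proof. exact: normcN. Qed.

Lemma normcX z n : normc (z ^+ n) = normc z ^+ n.
Proof.
elim: n => [|n IH]; first by rewrite !expr0 normc1.
by rewrite !exprS normcM IH.
Qed.

Lemma normcB z w : normc (z - w) = normc (w - z).
Proof. by rewrite -normcNE opprB. Qed.

Lemma normc_sqr z : normc z ^+ 2 = complex.Re z ^+ 2 + complex.Im z ^+ 2.
Proof. by case: z => a b; rewrite /= sqr_sqrtr // addr_ge0 // sqr_ge0. Qed.

Lemma normc_Re z : `|complex.Re z| <= normc z.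
Proof.
by rewrite -ler_sqr ?nnegrE ?normc_ge0 // normc_sqr real_normK ?num_real // lerDl sqr_ge0.
Qed.

Lemma normc_Im z : `|complex.Im z| <= normc z.
Proof.
by rewrite -ler_sqr ?nnegrE ?normc_ge0 // normc_sqr real_normK ?num_real // lerDr sqr_ge0.
Qed.

Lemma normc_le z : normc z <= `|complex.Re z| + `|complex.Im z|.
Proof.
rewrite -ler_sqr ?nnegrE ?normc_ge0 ?addr_ge0 // normc_sqr sqrrD.
by rewrite !real_normK ?num_real // lerD2r lerDl mulrn_wge0 // mulr_ge0.
Qed.

Lemma normc_eq0 z : (normc z == 0) = (z == 0).
Proof.
apply/eqP/eqP => [|->]; [exact: eq0_normc | exact: normc0].
Qed.

Lemma normc_gt0 z : (0 < normc z) = (z != 0).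
Proof. by rewrite lt_neqAle normc_ge0 andbT eq_sym normc_eq0. Qed.

Lemma normc_sum (I : Type) (r : seq I) (P : pred I) (F : I -> R[i]) :
  normc (\sum_(i <- r | P i) F i) <= \sum_(i <- r | P i) normc (F i).
Proof.
elim/big_rec2: _ => [|i y z _ h]; first by rewrite normc0.
by rewrite (le_trans (normcD _ _)) // lerD2l.
Qed.

Lemma lerB_normc z w : normc z - normc w <= normc (z - w).
Proof. by rewrite lerBlDr -{1}(subrK w z) normcD. Qed.

Lemma ReE_sum (I : Type) (r : seq I) (P : pred I) (F : I -> R[i]) :
  complex.Re (\sum_(i <- r | P i) F i) = \sum_(i <- r | P i) complex.Re (F i).
Proof. by elim/big_rec2: _ => [//|i y z _ <-]; case: (F i) z => [? ?] [? ?]. Qed.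

Lemma ImE_sum (I : Type) (r : seq I) (P : pred I) (F : I -> R[i]) :
  complex.Im (\sum_(i <- r | P i) F i) = \sum_(i <- r | P i) complex.Im (F i).
Proof. by elim/big_rec2: _ => [//|i y z _ <-]; case: (F i) z => [? ?] [? ?]. Qed.

End ComplexModulus.

Section ComplexSequences.
Variable R : realType.
Implicit Types (u v : nat -> R[i]) (l m z : R[i]).

(** Stated through the real-valued modulus, since the norm of [R[i]] takes values in [R[i]];
    [cvg_ccvgP] links it with the topology of the definitions. *)
Definition ccvg u l := (fun n => normc (u n - l)) @ \oo --> (0 : R).

Lemma ccvg_Re u l : ccvg u l -> (fun n => complex.Re (u n)) @ \oo --> complex.Re l.
Proof.
move=> h; apply/cvgrPdist_le => e e0.
move/cvgr0_norm_le : h => /(_ _ e0); apply: filterS => n.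
rewrite ger0_norm ?normc_ge0 // => /(le_trans _); apply.
rewrite normcB; apply: le_trans (normc_Re _).
by case: (u n) (l) => ? ? [? ?].
Qed.

Lemma ccvg_Im u l : ccvg u l -> (fun n => complex.Im (u n)) @ \oo --> complex.Im l.
Proof.
move=> h; apply/cvgrPdist_le => e e0.
move/cvgr0_norm_le : h => /(_ _ e0); apply: filterS => n.
rewrite ger0_norm ?normc_ge0 // => /(le_trans _); apply.
rewrite normcB; apply: le_trans (normc_Im _).
by case: (u n) (l) => ? ? [? ?].
Qed.

Lemma ccvg_ReIm u l : (fun n => complex.Re (u n)) @ \oo --> complex.Re l ->
  (fun n => complex.Im (u n)) @ \oo --> complex.Im l -> ccvg u l.
Proof.
move=> hr hi; rewrite /ccvg.
have h0 : (fun n => `|complex.Re (u n) - complex.Re l| +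
    `|complex.Im (u n) - complex.Im l|) @ \oo --> (0 : R).
  have d0 (a : nat -> R) (b : R) : a @ \oo --> b -> (fun n => `|a n - b|) @ \oo --> (0 : R).
    by move=> ab; rewrite -(normr0 R) -(subrr b); apply: cvg_norm; apply: cvgB => //; exact: cvg_cst.
  by rewrite -[0 in X in _ --> X]addr0; apply: cvgD; exact: d0.
apply: (squeeze_cvgr _ (cvg_cst 0) h0).
apply: nearW => n; rewrite normc_ge0 /=.
by apply: le_trans (normc_le _) _; case: (u n) (l) => ? ? [? ?].
Qed.

Lemma ccvg_uniq u l m : ccvg u l -> ccvg u m -> l = m.
Proof.
move=> hl hm.
have h1 := cvg_unique (@Rhausdorff R) (ccvg_Re hl) (ccvg_Re hm).
have h2 := cvg_unique (@Rhausdorff R) (ccvg_Im hl) (ccvg_Im hm).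
by case: l m h1 h2 {hl hm} => ? ? [? ?] /= -> ->.
Qed.

Lemma ccvg_cst l : ccvg (fun=> l) l.
Proof. by rewrite /ccvg subrr normc0; exact: cvg_cst. Qed.

Lemma ccvgP u l : ccvg u l <->
  forall e, 0 < e -> exists N, forall n, (N <= n)%N -> normc (u n - l) <= e.
Proof.
split=> [h e e0|h].
  move/cvgr0_norm_le : h => /(_ _ e0) [N _ hN]; exists N => n Nn.
  by have := hN n Nn; rewrite /= ger0_norm // normc_ge0.
apply/cvgr0Pnorm_le => e e0; have [N hN] := h _ e0.
by exists N => // n /= Nn; rewrite ger0_norm ?normc_ge0 // hN.
Qed.

Lemma ccvgD u v l m : ccvg u l -> ccvg v m -> ccvg (fun n => u n + v n) (l + m).
Proof.
move=> h1 h2; have ReD (a b : R[i]) : complex.Re (a + b) = complex.Re a + complex.Re b.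
  by case: a b => ? ? [].
have ImD (a b : R[i]) : complex.Im (a + b) = complex.Im a + complex.Im b.
  by case: a b => ? ? [].
apply: ccvg_ReIm; rewrite (ReD, ImD).
  under eq_fun do rewrite ReD.
  by apply: cvgD; exact: ccvg_Re.
under eq_fun do rewrite ImD.
by apply: cvgD; exact: ccvg_Im.
Qed.

Lemma ccvgM u v l m : ccvg u l -> ccvg v m -> ccvg (fun n => u n * v n) (l * m).
Proof.
move=> h1 h2.
have ReM (a b : R[i]) :
    complex.Re (a * b) = complex.Re a * complex.Re b - complex.Im a * complex.Im b.
  by case: a b => ? ? [].
have ImM (a b : R[i]) :
    complex.Im (a * b) = complex.Re a * complex.Im b + complex.Im a * complex.Re b.
  by case: a b => ? ? [].
apply: ccvg_ReIm; rewrite (ReM, ImM).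
  under eq_fun do rewrite ReM.
  by apply: cvgB; apply: cvgM; (exact: ccvg_Re || exact: ccvg_Im).
under eq_fun do rewrite ImM.
by apply: cvgD; apply: cvgM; (exact: ccvg_Re || exact: ccvg_Im).
Qed.

Lemma ccvgZ z u l : ccvg u l -> ccvg (fun n => z * u n) (z * l).
Proof. exact/ccvgM/ccvg_cst. Qed.

Lemma ccvgB u v l m : ccvg u l -> ccvg v m -> ccvg (fun n => u n - v n) (l - m).
Proof.
move=> h1 h2; have := ccvgD h1 (ccvgZ (-1) h2); rewrite mulN1r.
by congr ccvg; apply/funext => n; rewrite mulN1r.
Qed.

Lemma ccvg_normc u l : ccvg u l -> (fun n => normc (u n)) @ \oo --> normc l.
Proof.
move=> h; apply/cvgrPdist_le => e e0.
move/cvgr0_norm_le : h => /(_ _ e0); apply: filterS => n.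
rewrite ger0_norm ?normc_ge0 // => /(le_trans _); apply.
rewrite ler_norml lerNl opprB lerB_normc /=.
by rewrite normcB lerB_normc.
Qed.

Lemma ccvg_le u l x : ccvg u l -> (\forall n \near \oo, normc (u n) <= x) -> normc l <= x.
Proof. by move=> /ccvg_normc h hx; exact: (cvgr_to_le h). Qed.

Lemma ccvg_ge u l x : ccvg u l -> (\forall n \near \oo, x <= normc (u n)) -> x <= normc l.
Proof. by move=> /ccvg_normc h hx; exact: (cvgr_to_ge h). Qed.

Lemma ccvg_eq u v l : (\forall n \near \oo, u n = v n) -> ccvg u l -> ccvg v l.
Proof.
by move=> h; rewrite /ccvg; apply: cvg_trans; apply: near_eq_cvg; near=> n; rewrite (near h n).
Unshelve. all: by end_near. Qed.

Lemma ccvgS u l : ccvg u l -> ccvg (fun n => u n.+1) l.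
Proof.
move=> /ccvgP h; apply/ccvgP => e e0; have [N hN] := h _ e0.
by exists N => n Nn; apply: hN; rewrite (leq_trans Nn).
Qed.

(* Junk unless both coordinate series converge. *)
Definition csum u : R[i] :=
  limn (series (fun n => complex.Re (u n))) +i* limn (series (fun n => complex.Im (u n))).

Lemma csum_uniq u l : ccvg (fun n => \sum_(k < n) u k) l -> csum u = l.
Proof.
move=> h; rewrite /csum.
have -> : series (fun n => complex.Re (u n)) = (fun n => complex.Re (\sum_(k < n) u k)).
  by apply/funext => n; rewrite ReE_sum /series /= big_mkord.
have -> : series (fun n => complex.Im (u n)) = (fun n => complex.Im (\sum_(k < n) u k)).
  by apply/funext => n; rewrite ImE_sum /series /= big_mkord.
rewrite (cvg_lim _ (ccvg_Re h)) // (cvg_lim _ (ccvg_Im h)) //.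
by case: (l).
Qed.

(** Stands in for a radius of convergence: for coefficients with rate [k], the series [ev a z]
    converges absolutely when [k * normc z < 1], with constants that can be kept uniform over a
    family. *)
Definition geometric_bound (c x : R) u := forall n, normc (u n) <= c * x ^+ n.

Lemma geometric_bound_ge0 c x u : geometric_bound c x u -> 0 <= c.
Proof. by move=> /(_ 0%N); rewrite expr0 mulr1; apply: le_trans (normc_ge0 _). Qed.

Lemma sum_geometric_le (x : R) (m n : nat) : 0 <= x < 1 ->
  \sum_(m <= k < n) x ^+ k <= x ^+ m / (1 - x).
Proof.
move=> /andP[x0 x1]; have x1' : 0 < 1 - x by rewrite subr_gt0.
have [mn|nm] := leqP m n; last first.
  by rewrite big_geq 1?ltnW // divr_ge0 ?exprn_ge0 // ltW.
rewrite ler_pdivlMr //; elim: n mn => [|n IH]; first by rewrite leqn0 => /eqP ->; rewrite big_geq // mul0r expr0.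
rewrite leq_eqVlt => /predU1P[<-|]; first by rewrite big_geq // mul0r exprn_ge0.
rewrite ltnS => mn; rewrite mulr_suml.
rewrite (@telescope_sumr_eq _ m n.+1 (fun k => - x ^+ k)) ?leqW //.
  by rewrite opprK addrC gerBl exprn_ge0.
by move=> k _; rewrite mulrBr mulr1 -exprSr opprK addrC.
Qed.

Lemma csum_cvg c x u : 0 <= x < 1 -> geometric_bound c x u ->
  ccvg (fun n => \sum_(k < n) u k) (csum u).
Proof.
move=> /andP[x0 x1] hu; have c0 := geometric_bound_ge0 hu.
have hg : cvgn (series (geometric c x)) by apply: is_cvg_geometric_series; rewrite ger0_norm.
have cv (f : R[i] -> R) : (forall z, `|f z| <= normc z) -> cvgn (series (fun n => f (u n))).
  move=> hf; apply: normed_cvg.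
  by apply: (series_le_cvg _ _ _ hg) => n /=; rewrite ?mulr_ge0 ?exprn_ge0 // (le_trans (hf _)) // hu.
have h1 := cv _ (@normc_Re R); have h2 := cv _ (@normc_Im R).
apply: ccvg_ReIm => /=.
  by under eq_fun do rewrite ReE_sum -(big_mkord xpredT (fun k => complex.Re (u k))).
by under eq_fun do rewrite ImE_sum -(big_mkord xpredT (fun k => complex.Im (u k))).
Qed.

Lemma csum_tail c x u n : 0 <= x < 1 -> geometric_bound c x u ->
  normc (csum u - \sum_(k < n) u k) <= c * (x ^+ n / (1 - x)).
Proof.
move=> hx hu; have c0 := geometric_bound_ge0 hu.
apply: (ccvg_le (ccvgB (csum_cvg hx hu) (ccvg_cst (\sum_(k < n) u k)))).
exists n => // m /= nm.
rewrite -!(big_mkord xpredT u) (big_cat_nat (n := n)) //= addrAC subrr add0r.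
apply: le_trans (normc_sum _ _ _) _.
apply: le_trans (ler_sum _ (fun k _ => hu k)) _.
by rewrite -mulr_sumr ler_wpM2l // sum_geometric_le.
Qed.

Lemma csum_bound c x u : 0 <= x < 1 -> geometric_bound c x u ->
  normc (csum u) <= c / (1 - x).
Proof. by move=> hx hu; have := csum_tail 0 hx hu; rewrite big_ord0 subr0 expr0 mul1r. Qed.

End ComplexSequences.

Lemma exprn_cvg0 (R : realType) (x : R) : 0 <= x < 1 -> (fun n => x ^+ n) @ \oo --> (0 : R).
Proof. by move=> /andP[x0 x1]; apply: cvg_expr; rewrite ger0_norm. Qed.

Section PowerSeries.
Variable R : realType.
Implicit Types (a b : nat -> R[i]) (z w : R[i]) (c k : R).

Definition ev a z : R[i] := csum (fun n => a n * z ^+ n).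

Lemma eq_ev a b z : a =1 b -> ev a z = ev b z.
Proof. by move=> /funext ->. Qed.

Lemma geometric_ev c k a z : geometric_bound c k a ->
  geometric_bound c (k * normc z) (fun n => a n * z ^+ n).
Proof.
by move=> ha n; rewrite normcM normcX exprMn mulrA ler_wpM2r // exprn_ge0 // normc_ge0.
Qed.

Section Eval.
Variables (c k : R).
Hypothesis k0 : 0 <= k.

Let kz z : k * normc z < 1 -> 0 <= k * normc z < 1.
Proof. by rewrite mulr_ge0 // normc_ge0. Qed.

Lemma ev_cvg a z : geometric_bound c k a -> k * normc z < 1 ->
  ccvg (fun n => \sum_(j < n) a j * z ^+ j) (ev a z).
Proof. by move=> ha hz; exact: csum_cvg (kz hz) (geometric_ev z ha). Qed.

Lemma ev_tail a z n : geometric_bound c k a -> k * normc z < 1 ->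
  normc (ev a z - \sum_(j < n) a j * z ^+ j) <=
    c * ((k * normc z) ^+ n / (1 - k * normc z)).
Proof. by move=> ha hz; exact: csum_tail (kz hz) (geometric_ev z ha). Qed.

Lemma ev_bound a z : geometric_bound c k a -> k * normc z < 1 ->
  normc (ev a z) <= c / (1 - k * normc z).
Proof. by move=> ha hz; exact: csum_bound (kz hz) (geometric_ev z ha). Qed.

Lemma ev_uniq a z l : ccvg (fun n => \sum_(j < n) a j * z ^+ j) l -> ev a z = l.
Proof. exact: csum_uniq. Qed.

Lemma evS a z : geometric_bound c k a -> k * normc z < 1 ->
  ev a z = a 0%N + z * ev (fun n => a n.+1) z.
Proof.
move=> ha hz; have haS : geometric_bound (c * k) k (fun n => a n.+1).
  by move=> n; rewrite -mulrA -exprS.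
have h := csum_cvg (kz hz) (geometric_ev z haS).
have := ccvgD (ccvg_cst (a 0%N)) (ccvgZ z h).
apply: ccvg_uniq; have := ccvgS (ev_cvg ha hz).
congr ccvg; apply/funext => n; rewrite big_ord_recl expr0 mulr1; congr (_ + _).
by rewrite mulr_sumr; apply: eq_bigr => i _; rewrite exprS mulrCA.
Qed.

Lemma ev0 a : geometric_bound c k a -> ev a 0 = a 0%N.
Proof. by move=> ha; rewrite evS ?mul0r ?addr0 // normc0 mulr0 ltr01. Qed.

(* Tannery's theorem for power series. *)
Lemma ev_lim (A : nat -> nat -> R[i]) a z : (forall N, geometric_bound c k (A N)) ->
  (forall n, ccvg (fun N => A N n) (a n)) -> k * normc z < 1 ->
  geometric_bound c k a /\ ccvg (fun N => ev (A N) z) (ev a z).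
Proof.
move=> hA hl hz.
have ha : geometric_bound c k a.
  by move=> n; apply: (ccvg_le (hl n)); apply: nearW => N; exact: hA.
split=> //; apply/ccvgP => e e0.
have e3 : 0 < e / 3 by rewrite divr_gt0.
have c0 := geometric_bound_ge0 ha.
have [K hK] : exists K, c * ((k * normc z) ^+ K / (1 - k * normc z)) <= e / 3.
  have : (fun n => c * ((k * normc z) ^+ n / (1 - k * normc z))) @ \oo --> (c * (0 / (1 - k * normc z)) : R).
    by apply: cvgMr; apply: cvgMl; exact: exprn_cvg0 (kz hz).
  rewrite mul0r mulr0 => /cvgr0_norm_le /(_ _ e3) [K _ hK]; exists K.
  by have := hK K (leqnn K); apply: le_trans; exact: ler_norm.
have h1 : ccvg (fun N => \sum_(j < K) A N j * z ^+ j) (\sum_(j < K) a j * z ^+ j).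
  elim: (K) => [|n IH].
    by rewrite big_ord0; under eq_fun do rewrite big_ord0; exact: ccvg_cst.
  rewrite big_ord_recr; under eq_fun do rewrite big_ord_recr.
  by apply: ccvgD => //; apply: ccvgM; [exact: hl|exact: ccvg_cst].
have [N0 hN0] := (ccvgP _ _).1 h1 _ e3; exists N0 => N NN.
have hN := hN0 _ NN; have t1 := ev_tail K (hA N) hz; have t2 := ev_tail K ha hz.
set p := \sum_(j < K) A N j * z ^+ j in hN t1 *.
set q := \sum_(j < K) a j * z ^+ j in hN t2 *.
have -> : ev (A N) z - ev a z = (ev (A N) z - p) + ((p - q) - (ev a z - q)) by ring.
apply: le_trans (normcD _ _) _.
have := normcD (p - q) (- (ev a z - q)); rewrite normcNE => h.
have -> : e = e / 3 + (e / 3 + e / 3) by field.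
apply: lerD; first exact: le_trans t1 hK.
apply: le_trans h _; apply: lerD => //; exact: le_trans t2 hK.
Qed.

End Eval.

Lemma evD c1 c2 k a b z : 0 <= k -> geometric_bound c1 k a -> geometric_bound c2 k b ->
  k * normc z < 1 -> ev (fun n => a n + b n) z = ev a z + ev b z.
Proof.
move=> k0 ha hb hz; apply: csum_uniq.
have := ccvgD (ev_cvg k0 ha hz) (ev_cvg k0 hb hz).
congr ccvg; apply/funext => n; rewrite -big_split; apply: eq_bigr => i _.
by rewrite mulrDl.
Qed.

Lemma evZ c k a z l : 0 <= k -> geometric_bound c k a ->
  k * normc z < 1 -> ev (fun n => l * a n) z = l * ev a z.
Proof.
move=> k0 ha hz; apply: csum_uniq.
have := ccvgZ l (ev_cvg k0 ha hz).
congr ccvg; apply/funext => n; rewrite mulr_sumr; apply: eq_bigr => i _.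
by rewrite mulrA.
Qed.

Lemma geometric_boundD c1 c2 k a b : geometric_bound c1 k a -> geometric_bound c2 k b ->
  geometric_bound (c1 + c2) k (fun n => a n + b n).
Proof.
by move=> ha hb n; apply: le_trans (normcD _ _) _; rewrite mulrDl lerD.
Qed.

Lemma geometric_boundZ c k a l : geometric_bound c k a ->
  geometric_bound (normc l * c) k (fun n => l * a n).
Proof.
by move=> ha n; rewrite normcM -mulrA ler_wpM2l ?normc_ge0.
Qed.

End PowerSeries.


Global Opaque ev csum normc.

(** * Recentring power series *)

Lemma add_sub_mulr (V : comPzRingType) (x y z w b : V) :
  x + w * b = y + z * b -> x = y + (z - w) * b.
Proof. by move=> h; rewrite mulrBl addrA -h addrK. Qed.

Section Recentering.
Variable R : realType.
Implicit Types (a b : nat -> R[i]) (z w : R[i]) (c k : R).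

(* The coefficients of (ev a z - ev a w) / (z - w). *)
Definition bshift w a : nat -> R[i] := fun n => ev (fun j => a (n + j).+1) w.

(* The [j]-th Taylor coefficient of [ev a] at [w]. *)
Definition tcoef w a j : R[i] := ev (iter j (bshift w) a) w.

Section Bounds.
Variables (k : R) (w : R[i]).
Hypotheses (k0 : 0 <= k) (kw : k * normc w < 1).

Let kw0 : 0 < 1 - k * normc w. Proof. by rewrite subr_gt0. Qed.

Lemma geometric_bound_shift c a m : geometric_bound c k a ->
  geometric_bound (c * k ^+ m) k (fun j => a (m + j)%N).
Proof. by move=> ha j; rewrite -mulrA -exprD. Qed.

(** The rate [k] is kept and only the constant grows, by k / (1 - k |w|). Under iteration this
    factor becomes the rate of the Taylor coefficients at [w]. *)
Lemma bshift_bound c a : geometric_bound c k a ->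
  geometric_bound (c * (k / (1 - k * normc w))) k (bshift w a).
Proof.
move=> ha n; have := ev_bound k0 (geometric_bound_shift n.+1 ha) kw.
rewrite /bshift exprS => /le_trans; apply.
by rewrite le_eqVlt; apply/orP; left; apply/eqP; field; rewrite gt_eqF.
Qed.

Lemma bshift_rec c a n : geometric_bound c k a ->
  bshift w a n = a n.+1 + w * bshift w a n.+1.
Proof.
move=> ha; rewrite /bshift (evS k0 (geometric_bound_shift n.+1 ha) kw) addn0.
by under [X in ev X w]eq_fun do rewrite addnS.
Qed.

(** Let e_n be the sum over j of a_{n+j} w^j. Then e_n = a_n + w b_n and e_{n+1} = b_n, with b the
    shifted sequence. Evaluating the generating series of e at [z] through each relation gives the
    identity without rearranging a double series. *)
Lemma ev_bshift c a z : geometric_bound c k a -> k * normc z < 1 ->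
  ev a z = ev a w + (z - w) * ev (bshift w a) z.
Proof.
move=> ha kz; have hb := bshift_bound ha.
have [e eE0] : {e : nat -> R[i] | forall n, e n = ev (fun j => a (n + j)%N) w} by exists (fun n => ev (fun j => a (n + j)%N) w).
have eE n : e n = a n + w * bshift w a n.
  rewrite eE0 (evS k0 (geometric_bound_shift n ha) kw) addn0 /bshift.
  by under [X in ev X w]eq_fun do rewrite addnS.
have he : geometric_bound (c + normc w * (c * (k / (1 - k * normc w)))) k e.
  by move=> n; rewrite eE; exact: (geometric_boundD ha (geometric_boundZ w hb)).
have h1 := evS k0 he kz.
have h2 : ev e z = ev a z + w * ev (bshift w a) z.
  rewrite -(evZ _ k0 hb kz) -(evD k0 ha (geometric_boundZ w hb) kz).
  by apply: eq_ev => n; rewrite eE; exact: erefl.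
have e0 : e 0%N = ev a w by rewrite eE0.
have h3 : ev (fun n => e n.+1) z = ev (bshift w a) z by apply: eq_ev => n; rewrite eE0.
by rewrite e0 h3 in h1; apply: add_sub_mulr; exact: etrans (esym h2) h1.
Qed.

Lemma iter_bshift_bound c a j : geometric_bound c k a ->
  geometric_bound (c * (k / (1 - k * normc w)) ^+ j) k (iter j (bshift w) a).
Proof.
move=> ha; elim: j => [|j IH]; first by rewrite expr0 mulr1.
by rewrite iterS exprSr mulrA; exact: bshift_bound.
Qed.

Lemma tcoef_bound c a : geometric_bound c k a ->
  geometric_bound (c / (1 - k * normc w)) (k / (1 - k * normc w)) (tcoef w a).
Proof.
move=> ha j; apply: le_trans (ev_bound k0 (iter_bshift_bound j ha) kw) _.
by rewrite mulrAC.
Qed.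

Lemma ev_taylor c a z n : geometric_bound c k a -> k * normc z < 1 ->
  ev a z = \sum_(j < n) tcoef w a j * (z - w) ^+ j +
    (z - w) ^+ n * ev (iter n (bshift w) a) z.
Proof.
move=> ha kz; elim: n => [|n IH]; first by rewrite big_ord0 add0r expr0 mul1r.
rewrite IH big_ord_recr /= -addrA; congr (_ + _).
rewrite (ev_bshift (iter_bshift_bound n ha) kz) mulrDr exprSr mulrA.
by rewrite /tcoef mulrC.
Qed.

(** The Taylor remainder is (z - w)^n times the n-fold shift, hence at most a constant times q^n
    with q = k |z - w| / (1 - k |w|); the hypothesis says exactly that q < 1. *)
Lemma ev_recenter c a z : geometric_bound c k a -> k * normc (z - w) < 1 - k * normc w ->
  k * normc z < 1 /\ ev a z = ev (tcoef w a) (z - w).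
Proof.
move=> ha kzw.
have kz : k * normc z < 1.
  have := normcD (z - w) w; rewrite subrK => /(ler_wpM2l k0) /le_lt_trans; apply.
  by rewrite mulrDr; lra.
split; first exact: kz.
apply/esym/ev_uniq.
set q := k / (1 - k * normc w) * normc (z - w).
have q01 : 0 <= q < 1.
  apply/andP; split; first by rewrite /q mulr_ge0 ?normc_ge0 // divr_ge0 // ltW.
  by rewrite /q mulrAC ltr_pdivrMr // mul1r.
have c0 := geometric_bound_ge0 ha.
have h : (fun n => q ^+ n * (c / (1 - k * normc z))) @ \oo --> (0 : R).
  by rewrite -(mul0r (c / (1 - k * normc z))); apply: cvgMl; exact: exprn_cvg0.
apply: (squeeze_cvgr _ (cvg_cst 0) h); apply: nearW => n; rewrite normc_ge0 /=.
rewrite (ev_taylor n ha kz) opprD addrA subrr add0r normcNE normcM normcX.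
apply: le_trans (ler_wpM2l _ (ev_bound k0 (iter_bshift_bound n ha) kz)) _.
  by rewrite exprn_ge0 // normc_ge0.
by rewrite /q; move: (k / (1 - _)) => p; rewrite exprMn le_eqVlt; apply/orP; left; apply/eqP; ring.
Qed.

(** Differentiation brings in binomial factors, which a strictly larger rate absorbs. The witness is
    the midpoint of [k] and 1 / |w|. *)
Lemma larger_rate : exists2 k', k < k' & k' * normc w < 1.
Proof.
have [w0|w0] := eqVneq (normc w) 0.
  by exists (k + 1); [rewrite ltrDl | rewrite w0 mulr0].
have nw : 0 < normc w by rewrite lt_neqAle eq_sym w0 normc_ge0.
exists ((k + (normc w)^-1) / 2).
  have : k < (normc w)^-1 by rewrite -(ltr_pM2r nw) mulVf.
  by lra.
suff -> : (k + (normc w)^-1) / 2 * normc w = (k * normc w + 1) / 2.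
  by rewrite ltr_pdivrMr // mul1r (natrD _ 1 1) ltrD2r.
by field.
Qed.

(* The coefficients of the [j]-th derivative divided by [j!]. *)
Definition dcoef j a n : R[i] := 'C(n + j, j)%:R * a (n + j)%N.

(** The product C(n+i, i) k^n (k' - k)^i is a single term of the binomial expansion of ((k' - k) +
    k)^(n+i) = k'^(n+i). *)
Lemma dcoef_bound k' c a i : k < k' -> geometric_bound c k a ->
  geometric_bound (c * (k * k' / (k' - k)) ^+ i) k' (dcoef i a).
Proof.
move=> kk' hb n; have c0 := geometric_bound_ge0 hb.
have k'0 : 0 <= k' by rewrite (le_trans k0) // ltW.
have dk : 0 < k' - k by rewrite subr_gt0.
rewrite normcM -(rmorph_nat (real_complex R)) normc_real ger0_norm //.
apply: le_trans (ler_wpM2l _ (hb _)) _ => //.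
rewrite mulrCA -[leRHS]mulrA ler_wpM2l // expr_div_n mulrAC ler_pdivlMr ?exprn_gt0 //.
have -> : 'C(n + i, i)%:R * k ^+ (n + i) * (k' - k) ^+ i =
    k ^+ i * (k ^+ n * (k' - k) ^+ i *+ 'C(n + i, i)).
  by rewrite -mulr_natl exprD; ring.
rewrite exprMn -[leRHS]mulrA -exprD (addnC i n) ler_wpM2l ?exprn_ge0 //.
have {2}-> : k' = (k' - k) + k by rewrite subrK.
rewrite [leRHS]exprDn (bigD1 (inord n)) //= inordK ?ltnS ?leq_addr // addKn.
have -> : 'C(n + i, i) = 'C(n + i, n) by rewrite -{2}(addKn n i) bin_sub ?leq_addr.
rewrite (mulrC (k ^+ n)) lerDl sumr_ge0 // => l _.
by rewrite mulrn_wge0 // mulr_ge0 ?exprn_ge0 // ltW.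
Qed.

(* Both sides satisfy the recursion [T a j.+1 = T (a \o S) j + w * T (a \o S) j.+1],
   which determines [T] among functionals bounded by a multiple of [c]. *)
Lemma tcoefE c a j : geometric_bound c k a ->
  tcoef w a j = ev (dcoef j a) w.
Proof.
move=> ha.
have [k' kk' kw'] := larger_rate.
have k'0 : 0 <= k' by rewrite (le_trans k0) // ltW.
have hd c' b i : geometric_bound c' k b -> geometric_bound _ k' (dcoef i b) := dcoef_bound i kk'.
elim: j c a ha => [|j IH] c a ha.
  by apply: eq_ev => n; rewrite /dcoef bin0 mul1r addn0.
pose S b : nat -> R[i] := fun n => b n.+1.
pose D b := tcoef w b j.+1 - ev (dcoef j.+1 b) w.
have hS c' b : geometric_bound c' k b -> geometric_bound (c' * k) k (S b).
  by move=> hb n; rewrite -mulrA -exprS; exact: (hb n.+1).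
have Drec c' b : geometric_bound c' k b -> D b = w * D (S b).
  move=> hb; have c'0 := geometric_bound_ge0 hb.
  have h1 : tcoef w b j.+1 = tcoef w (S b) j + w * tcoef w (S b) j.+1.
    have SE i : S (iter i (bshift w) b) = iter i (bshift w) (S b).
      by elim: i => // i IHi; rewrite !iterS -IHi; exact: erefl.
    have hb1 : geometric_bound _ k (iter j (bshift w) (S b)) := iter_bshift_bound j (hS _ _ hb).
    have hb2 : geometric_bound _ k (iter j.+1 (bshift w) (S b)) := iter_bshift_bound j.+1 (hS _ _ hb).
    rewrite /tcoef -(evZ _ k0 hb2 kw) -(evD k0 hb1 (geometric_boundZ w hb2) kw).
    apply: eq_ev => n; rewrite iterS.
    by rewrite (bshift_rec n (iter_bshift_bound j hb)) -!SE.
  have hdb := hd _ _ j.+1 hb; have hdS := hd _ _ j.+1 (hS _ _ hb).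
  have hdj := hd _ _ j (hS _ _ hb).
  (* The coefficients of z times the series of [dcoef j.+1 (S b)]: with them the recursion is
     Pascal's rule, coefficient by coefficient. *)
  pose X n : R[i] := if n is m.+1 then dcoef j.+1 (S b) m else 0.
  have hX : geometric_bound (c' * k * (k * k' / (k' - k)) ^+ j.+1 / k') k' X.
    have k'p : 0 < k' by rewrite (le_lt_trans k0 kk').
    case=> [|n]; last first.
      by have := hdS n; move=> /le_trans; apply; rewrite (exprS k' n) -[leRHS]mulrA mulKf ?gt_eqF.
    by rewrite /X normc0 expr0 mulr1 divr_ge0 // (geometric_bound_ge0 hdS).
  have h2 : ev (dcoef j.+1 b) w = ev (dcoef j (S b)) w + w * ev (dcoef j.+1 (S b)) w.
    have -> : w * ev (dcoef j.+1 (S b)) w = ev X w by rewrite (evS k'0 hX kw') add0r.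
    rewrite -(evD k'0 hdj hX kw'); apply: eq_ev => -[|n].
      by rewrite /X /dcoef addr0 !add0n !binn.
    by rewrite /X /dcoef /S (addSnnS n j) (addSn n j.+1) binS natrD mulrDl addrC; exact: erefl.
  by rewrite /D h1 h2 (IH _ _ (hS _ _ hb)); ring.
have DSm m : D a = w ^+ m * D (iter m S a).
  elim: m => [|m IHm]; first by rewrite expr0 mul1r.
  rewrite IHm exprSr -mulrA; congr (_ * _).
  have hm : geometric_bound (c * k ^+ m) k (iter m S a).
    elim: m {IHm} => [|m IHm]; first by rewrite expr0 mulr1.
    by rewrite iterS exprSr mulrA; exact: hS.
  exact: Drec hm.
pose K := (k / (1 - k * normc w)) ^+ j.+1 / (1 - k * normc w) +
  (k * k' / (k' - k)) ^+ j.+1 / (1 - k' * normc w).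
have bD m : normc (D a) <= (k * normc w) ^+ m * (c * K).
  have hm : geometric_bound (c * k ^+ m) k (iter m S a).
    elim: m => [|m IHm]; first by rewrite expr0 mulr1.
    by rewrite iterS exprSr mulrA; exact: hS.
  rewrite (DSm m) normcM normcX.
  have h : normc (D (iter m S a)) <= c * k ^+ m * K.
    rewrite /D; apply: le_trans (normcD _ _) _; rewrite normcNE /K mulrDr !mulrA.
    apply: lerD; first exact: (ev_bound k0 (iter_bshift_bound j.+1 hm) kw).
    exact: (ev_bound k'0 (hd _ _ j.+1 hm) kw').
  apply: le_trans (ler_wpM2l _ h) _; first by rewrite exprn_ge0 ?normc_ge0.
  by rewrite exprMn le_eqVlt; apply/orP; left; apply/eqP; ring.
apply/eqP; rewrite -subr_eq0 -normc_eq0 -/(D a); apply/eqP/le_anti.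
rewrite normc_ge0 andbT.
have h : (fun m => (k * normc w) ^+ m * (c * K)) @ \oo --> (0 * (c * K) : R).
  by apply: cvgMl; apply: exprn_cvg0; rewrite mulr_ge0 ?normc_ge0.
rewrite mul0r in h; apply: (cvgr_to_ge h); exact: nearW.
Qed.

Lemma bshift_lim c (A : nat -> nat -> R[i]) a : (forall N, geometric_bound c k (A N)) ->
  (forall n, ccvg (fun N => A N n) (a n)) ->
  forall n, ccvg (fun N => bshift w (A N) n) (bshift w a n).
Proof.
move=> hA hl n; apply: (ev_lim k0 _ _ kw).2 => [N|j]; last exact: hl.
exact: (geometric_bound_shift n.+1 (hA N)).
Qed.

Lemma tcoef_lim c (A : nat -> nat -> R[i]) a j : (forall N, geometric_bound c k (A N)) ->
  (forall n, ccvg (fun N => A N n) (a n)) -> ccvg (fun N => tcoef w (A N) j) (tcoef w a j).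
Proof.
move=> hA hl; apply: (ev_lim k0 _ _ kw).2 => [N|].
  exact: iter_bshift_bound j (hA N).
elim: j => [//|j IH] n; rewrite iterS.
exact: (bshift_lim (fun N => iter_bshift_bound j (hA N)) IH).
Qed.

End Bounds.
End Recentering.

(** * Order of vanishing *)

Section Order.
Variable R : realType.
Implicit Types (a b : nat -> R[i]) (z w : R[i]) (c k : R).

Lemma ccvg_near k x w (zs : nat -> R[i]) : ccvg zs w -> k * normc w < x ->
  \forall i \near \oo, k * normc (zs i) < x.
Proof.
move=> hz; have h : (fun i => k * normc (zs i)) @ \oo --> k * normc w.
  by apply: cvgM; [exact: cvg_cst | exact: ccvg_normc].
by move=> hx; move: h => /cvgrPdist_lt /(_ (x - k * normc w)); rewrite subr_gt0 => /(_ hx);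
  apply: filterS => i; rewrite distrC => /(le_lt_trans (ler_norm _)); rewrite ltrD2r.
Qed.

(** The difference of values is z - w times the shifted series, which stays bounded where k |z| < q,
    with q halfway between k |w| and 1. *)
Lemma ev_continuous c k a w (zs : nat -> R[i]) : 0 <= k -> geometric_bound c k a ->
  k * normc w < 1 -> ccvg zs w -> ccvg (fun i => ev a (zs i)) (ev a w).
Proof.
move=> k0 ha kw hz; have hb := bshift_bound k0 kw ha.
pose q := (1 + k * normc w) / 2.
have qkw : k * normc w < q by rewrite /q; lra.
have q1 : q < 1 by rewrite /q; lra.
have near_q := ccvg_near hz qkw.
pose M := c * (k / (1 - k * normc w)) / (1 - q).
have h : (fun i => normc (zs i - w) * M) @ \oo --> (0 : R).
  by rewrite -[X in _ --> X](mul0r M); apply: cvgMl.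
apply: (squeeze_cvgr _ (cvg_cst 0) h).
near=> i.
have kzi : k * normc (zs i) < q by near: i.
have kzi1 := lt_trans kzi q1.
rewrite normc_ge0 /= (ev_bshift k0 kw ha kzi1) [X in normc X]addrAC subrr add0r normcM.
rewrite ler_wpM2l ?normc_ge0 //; apply: le_trans (ev_bound k0 hb kzi1) _.
rewrite /M ler_wpM2l ?(geometric_bound_ge0 hb) // lef_pV2 ?posrE ?subr_gt0 //.
by rewrite lerD2l lerN2 ltW.
Unshelve. all: by end_near. Qed.

(* Identities off [w] are transported to [w] along this punctured sequence. *)
Definition step i : R[i] := (i.+1%:R^-1 : R)%:C.

Lemma stepK w i : w + step i - w = step i.
Proof. by rewrite addrAC subrr add0r. Qed.

Lemma step_neq0 i : step i != 0.
Proof. by rewrite -normc_eq0 normc_real normr_eq0 invr_eq0 pnatr_eq0. Qed.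

Lemma normc_step i : normc (step i) = i.+1%:R^-1.
Proof. by rewrite normc_real ger0_norm // invr_ge0. Qed.

Lemma step_cvg w : ccvg (fun i => w + step i) w.
Proof.
rewrite /ccvg; under eq_fun do rewrite [X in normc X]addrAC subrr add0r normc_step.
exact: (@cvg_harmonic R).
Qed.

(** The order of vanishing of [ev a] at [w], expressed by Taylor coefficients because these pass to
    coefficientwise limits ([tcoef_lim]). *)
Definition ord a w m := (forall j, (j < m)%N -> tcoef w a j = 0) /\ tcoef w a m != 0.

Lemma ev_ord c k a w m z : 0 <= k -> geometric_bound c k a -> k * normc w < 1 ->
  (forall j, (j < m)%N -> tcoef w a j = 0) -> k * normc z < 1 ->
  ev a z = (z - w) ^+ m * ev (iter m (bshift w) a) z.
Proof.
move=> k0 ha kw h kz; rewrite (ev_taylor k0 kw m ha kz) big1 ?add0r // => j _.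
by rewrite h // mul0r.
Qed.

Lemma near_step k w : k * normc w < 1 -> \forall i \near \oo, k * normc (w + step i) < 1.
Proof. exact: ccvg_near (step_cvg w).
Qed.

(** If the Taylor coefficients below j vanish, cancelling [step i ^+ j] and letting i grow
    identifies [tcoef w a j * g] with the limit of [step i ^+ (m - j) * H i], which is 0 for j < m
    and [h] for j = m. Orders can thus be read off from identities that hold only near [w] and off
    [w]. *)
Lemma ord_factor c k a w m (G H : nat -> R[i]) g h : 0 <= k -> geometric_bound c k a ->
  k * normc w < 1 -> ccvg G g -> ccvg H h -> g != 0 -> h != 0 ->
  (\forall i \near \oo, ev a (w + step i) * G i = step i ^+ m * H i) -> ord a w m.
Proof.
move=> k0 ha kw hG hH g0 h0 E.
have key j : (j <= m)%N -> (forall l, (l < j)%N -> tcoef w a l = 0) ->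
    ccvg (fun i => step i ^+ (m - j) * H i) (tcoef w a j * g).
  move=> jm hj.
  have hc : ccvg (fun i => ev (iter j (bshift w) a) (w + step i) * G i) (tcoef w a j * g).
    apply: ccvgM hG; apply: (ev_continuous k0 (iter_bshift_bound k0 kw j ha) kw).
    exact: step_cvg.
  apply: ccvg_eq hc; near=> i.
  have Ei : ev a (w + step i) * G i = step i ^+ m * H i by near: i; exact: E.
  have ki : k * normc (w + step i) < 1 by near: i; exact: near_step.
  move: Ei; rewrite (ev_ord k0 ha kw hj ki) [X in X ^+ j]addrAC subrr add0r.
  rewrite -{1}(subnKC jm) exprD -!mulrA; apply: mulfI.
  by rewrite expf_neq0 // step_neq0.
have step0 : ccvg step 0.
  have := ccvgB (step_cvg w) (ccvg_cst w); rewrite subrr; apply: ccvg_eq.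
  by apply: nearW => i; rewrite addrAC subrr add0r.
have vanish j : (j <= m)%N -> forall l, (l < j)%N -> tcoef w a l = 0.
  elim: j => // j IH jm l; rewrite ltnS leq_eqVlt => /predU1P[->|]; last first.
    by apply: IH; exact: ltnW.
  have h1 := key j (ltnW jm) (IH (ltnW jm)).
  have h2 : ccvg (fun i => step i ^+ (m - j) * H i) 0.
    rewrite -(mul0r h); apply: ccvgM hH.
    rewrite -(subnSK jm); elim: (m - j.+1)%N => [|d IHd].
      by under eq_fun do rewrite expr1.
    rewrite -(mul0r 0); under eq_fun do rewrite exprS.
    exact: ccvgM.
  have /eqP := ccvg_uniq h1 h2.
  by rewrite mulf_eq0 (negPf g0) orbF => /eqP.
split; first exact: vanish.
have h1 := key m (leqnn m) (vanish m (leqnn m)).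
have h2 : ccvg (fun i => step i ^+ (m - m) * H i) h.
  by apply: ccvg_eq hH; apply: nearW => i; rewrite subnn expr0 mul1r.
have e := ccvg_uniq h1 h2.
by apply: contraNneq h0 => t0; rewrite -e t0 mul0r.
Unshelve. all: by end_near. Qed.

End Order.

(** * Moving one zero *)

Section MoveZero.
Variable R : realType.
Implicit Types (a b : nat -> R[i]) (z w p : R[i]) (c lam : R).

(** Partial sums of the Dirichlet and of the H^2 square norms; membership in these spaces is
    expressed by bounds uniform in [M]. *)
Definition dsum a M := \sum_(n < M) n%:R * normc (a n) ^+ 2.
Definition hsum a M := \sum_(n < M) normc (a n) ^+ 2.

Lemma hsum_bound a c : (forall M, hsum a M <= c) -> geometric_bound (Num.sqrt c) 1 a.
Proof.
move=> h n; rewrite expr1n mulr1 -[leLHS]ger0_norm ?normc_ge0 // -sqrtr_sqr.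
apply: ler_wsqrtr; apply: le_trans (h n.+1); rewrite /hsum big_ord_recr /= lerDr.
by apply: sumr_ge0 => i _; exact: sqr_ge0.
Qed.

Lemma dsum_hsum a c : (forall M, dsum a M <= c) -> forall M, hsum a M <= normc (a 0%N) ^+ 2 + c.
Proof.
move=> h [|M]; first by rewrite /hsum big_ord0 addr_ge0 ?sqr_ge0 // (le_trans _ (h 0%N)) // /dsum big_ord0.
rewrite /hsum big_ord_recl lerD2l (le_trans _ (h M.+1)) // /dsum big_ord_recl mul0r add0r.
by apply: ler_sum => i _; rewrite ler_peMl ?sqr_ge0 // ler1n.
Qed.

(* The coefficients of [(lam * z - p) / (z - p)] times [ev a], which moves the zero [p] to [p / lam]. *)
Definition move lam p a n : R[i] :=
  if n is m.+1 then a m.+1 - (1 - lam)%:C * bshift p a m else a 0%N.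

Section OneZero.
Variables (lam c : R) (p : R[i]) (a : nat -> R[i]).
Hypotheses (p0 : 0 < normc p) (p1 : normc p < 1) (plam : normc p <= lam) (lam1 : lam <= 1).
Hypotheses (ha : geometric_bound c 1 a) (ap : ev a p = 0).

Let p1' : 1 * normc p < 1. Proof. by rewrite mul1r. Qed.
Let x n := normc (bshift p a n) ^+ 2.
Let r := normc p.

Lemma coef_bshift n : a n.+1 = bshift p a n - p * bshift p a n.+1.
Proof. by rewrite (bshift_rec ler01 p1' n ha) addrK. Qed.

Lemma coef0_bshift : a 0%N = - (p * bshift p a 0).
Proof.
have : a 0%N + p * bshift p a 0%N = 0.
  rewrite -[RHS]ap (evS ler01 ha p1'); exact: erefl.
by move/eqP; rewrite addr_eq0 => /eqP.
Qed.

Lemma move_bshift n : move lam p a n.+1 = lam%:C * bshift p a n - p * bshift p a n.+1.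
Proof. by rewrite /= coef_bshift rmorphB rmorph1 mulrBl mul1r opprB addrAC addrCA subrr addr0. Qed.

Lemma normcB_sqr (l : R) (u v : R[i]) : normc (l%:C * u - v) ^+ 2 =
  l ^+ 2 * normc u ^+ 2 + normc v ^+ 2 -
  l * (complex.Re u * complex.Re v + complex.Im u * complex.Im v) *+ 2.
Proof. by rewrite !normc_sqr; case: u v => [a1 b1] [a2 b2] /=; ring. Qed.

Let coef_sqr (l : R) n :
  normc (l%:C * bshift p a n - p * bshift p a n.+1) ^+ 2 =
  l ^+ 2 * x n + r ^+ 2 * x n.+1 - l * (complex.Re (bshift p a n) * complex.Re (p * bshift p a n.+1)
   + complex.Im (bshift p a n) * complex.Im (p * bshift p a n.+1)) *+ 2.
Proof. by rewrite normcB_sqr normcM exprMn. Qed.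

(** Write b for [bshift p a] and q for the real part of the inner product of b_n and p b_{n+1}. The
    gap between the two sides is (1 - lam) times the sum of r x_n + r x_{n+1} - 2 q and (1 + lam - 2
    r) x_n. The former is |r b_n - p b_{n+1}|^2 / r, the latter is nonnegative as r <= lam and r <
    1. *)
Lemma move_d_step n : normc (move lam p a n.+1) ^+ 2 <=
  normc (a n.+1) ^+ 2 - (1 - lam) * r * (x n - x n.+1).
Proof.
have xge m : 0 <= x m by exact: sqr_ge0.
rewrite move_bshift (coef_bshift n) -[in leRHS](mul1r (bshift p a n)).
rewrite -(rmorph1 (real_complex R)) !coef_sqr.
have := coef_sqr r n; have := sqr_ge0 (normc (r%:C * bshift p a n - p * bshift p a n.+1)).
set q := (_ * _ + _ * _); move=> h e; rewrite e in h.
have {e} h : 0 <= r * x n + r * x n.+1 - q *+ 2.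
  by rewrite -(pmulr_rge0 _ p0); apply: le_trans h _; rewrite le_eqVlt; apply/orP; left; apply/eqP; rewrite /r; ring.
have xn := xge n; have xn1 := xge n.+1.
rewrite -subr_ge0.
have -> : 1 ^+ 2 * x n + r ^+ 2 * x n.+1 - 1 * q *+ 2 - (1 - lam) * r * (x n - x n.+1) -
  (lam ^+ 2 * x n + r ^+ 2 * x n.+1 - lam * q *+ 2) =
  (1 - lam) * ((r * x n + r * x n.+1 - q *+ 2) + (1 + lam - r *+ 2) * x n) by ring.
rewrite mulr_ge0 ?subr_ge0 // addr_ge0 // mulr_ge0 //.
by move: plam p1 lam1; rewrite /r; lra.
Qed.

(** With the factor [lam] on the right the cross terms cancel exactly. There remains (1 - lam) (lam
    - r^2) x_n, which is nonnegative because r^2 <= r <= lam. *)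
Lemma move_h_step n : normc (move lam p a n.+1) ^+ 2 <=
  lam * normc (a n.+1) ^+ 2 - (1 - lam) * r ^+ 2 * (x n - x n.+1).
Proof.
have xge m : 0 <= x m by exact: sqr_ge0.
rewrite move_bshift (coef_bshift n) -[in leRHS](mul1r (bshift p a n)).
rewrite -(rmorph1 (real_complex R)) !coef_sqr.
set q := (_ * _ + _ * _).
rewrite -subr_ge0.
have -> : lam * (1 ^+ 2 * x n + r ^+ 2 * x n.+1 - 1 * q *+ 2) -
    (1 - lam) * r ^+ 2 * (x n - x n.+1) -
  (lam ^+ 2 * x n + r ^+ 2 * x n.+1 - lam * q *+ 2) =
  (1 - lam) * ((lam - r ^+ 2) * x n) by ring.
rewrite mulr_ge0 ?subr_ge0 // mulr_ge0 // subr_ge0 expr2.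
by apply: le_trans plam; rewrite ger_pMr // ltW.
Qed.

(** Abel summation of [move_d_step]: the sum of (n+1) (x_n - x_{n+1}) over n < M is the sum of the
    x_n minus M x_M. The sum of the x_n has the favourable sign and is carried only through the
    induction; the boundary term is handled by [bshift_tail]. *)
Lemma move_dsum M : dsum (move lam p a) M.+1 <= dsum a M.+1 + (1 - lam) * r * (M%:R * x M).
Proof.
suff : dsum (move lam p a) M.+1 + (1 - lam) * r * \sum_(n < M) x n <=
    dsum a M.+1 + (1 - lam) * r * (M%:R * x M).
  apply: le_trans; rewrite lerDl mulr_ge0 ?sumr_ge0 // => [|i _]; last exact: sqr_ge0.
  by rewrite mulr_ge0 ?subr_ge0 // ltW.
elim: M => [|M IH].
  by rewrite /dsum !big_ord_recr !big_ord0 /= !mul0r !mulr0 !addr0.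
have dS b : dsum b M.+2 = dsum b M.+1 + M.+1%:R * normc (b M.+1) ^+ 2.
  by rewrite /dsum big_ord_recr.
rewrite !dS [\sum_(n < M.+1) x n]big_ord_recr /=.
have /(ler_wpM2l (ler0n R M.+1)) := move_d_step M.
rewrite -[a M.+1 - _]/(move lam p a M.+1); move: (normc _ ^+ 2) => y.
move: IH; move: (dsum _ _) (dsum _ _) (normc _ ^+ 2) (\sum_(i < M) _) => X Y Z S.
by rewrite -natr1; move: (M%:R : R) => m; lra.
Qed.

(** The corrections of [move_h_step] telescope to x_0 - x_M. Since [p] is a zero, |a_0|^2 = r^2 x_0,
    so the term in x_0 is exactly the share (1 - lam) |a_0|^2 that the unchanged coefficient of
    index 0 lacks. *)
Lemma move_hsum M : hsum (move lam p a) M.+1 <=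
  lam * hsum a M.+1 + (1 - lam) * r ^+ 2 * x M.
Proof.
elim: M => [|M IH].
  rewrite /hsum !big_ord_recr !big_ord0 /= !add0r.
  by rewrite coef0_bshift normcNE normcM exprMn -/(x 0) -/r; move: (x 0) (r ^+ 2) => u v; lra.
have hS b : hsum b M.+2 = hsum b M.+1 + normc (b M.+1) ^+ 2 by rewrite /hsum big_ord_recr.
rewrite !hS.
have := move_h_step M; move: IH; rewrite /=.
move: (hsum _ _) (hsum _ _) (normc _ ^+ 2) (normc _ ^+ 2) (r ^+ 2) (x M) (x M.+1) => X Y Z S T U V.
by lra.
Qed.

(** Both [ev a] and [ev (move lam p a)] are multiples of the shifted series, with factors z - p and
    z - p - (1 - lam) z = lam z - p. The identity is cleared of denominators, so it also makes sense
    at z = p. *)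
Lemma ev_move z : normc z < 1 -> geometric_bound (c + normc (1 - lam)%:C * (c * (1 / (1 - 1 * normc p)))) 1 (move lam p a) /\
  ev (move lam p a) z * (z - p) = (lam%:C * z - p) * ev a z.
Proof.
move=> z1; have kz : 1 * normc z < 1 by rewrite mul1r.
have hb := bshift_bound ler01 p1' ha; have hb' := geometric_boundZ (1 - lam)%:C hb.
have hm : geometric_bound (c + normc (1 - lam)%:C * (c * (1 / (1 - 1 * normc p)))) 1 (move lam p a).
  case=> [|n] /=.
    by apply: le_trans (ha 0%N) _; rewrite expr1n !mulr1 lerDl (geometric_bound_ge0 hb').
  apply: le_trans (normcD _ _) _; rewrite normcNE.
  by have h1 := ha n.+1; have h2 := hb' n; move: h1 h2; rewrite !expr1n !mulr1; exact: lerD.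
split; first exact: hm.
have e1 : ev (move lam p a) z = ev a z - (1 - lam)%:C * (z * ev (bshift p a) z).
  rewrite (evS ler01 hm kz) (evS ler01 ha kz) /=.
  have haS : geometric_bound c 1 (fun n => a n.+1).
    by move=> n; have := ha n.+1; rewrite !expr1n.
  have hbN := geometric_boundZ (-1) hb'.
  have -> : ev (fun n => a n.+1 - (1 - lam)%:C * bshift p a n) z =
      ev (fun n => a n.+1) z - (1 - lam)%:C * ev (bshift p a) z.
    have eZ := evZ (1 - lam)%:C ler01 hb kz; have eN := evZ (-1) ler01 hb' kz.
    transitivity (ev (fun n => a n.+1 + -1 * ((1 - lam)%:C * bshift p a n)) z).
      by apply: eq_ev => n; rewrite mulN1r; exact: erefl.
    rewrite (evD ler01 haS hbN kz) eN eZ mulN1r; exact: erefl.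
  by rewrite mulrBr addrA mulrCA; exact: erefl.
have lE : (1 - lam)%:C = 1 - lam%:C by rewrite rmorphB rmorph1; exact: erefl.
rewrite e1 (ev_bshift ler01 p1' ha kz) ap add0r lE.
by move: (lam%:C) (ev _ z) => l b; ring.
Qed.

(* [M |bshift p a M|^2] is dominated by the tail of the summable sequence [n |a n|^2]. *)
Lemma bshift_tail C e : (forall M, dsum a M <= C) -> 0 < e ->
  \forall M \near \oo, M%:R * x M <= e.
Proof.
move=> hC e0.
have t0 : (fun n => n%:R * normc (a n) ^+ 2) @ \oo --> (0 : R).
  apply: cvg_series_cvg_0; apply: nondecreasing_is_cvgn.
    apply: nondecreasing_series => i _ _; exact: mulr_ge0 (ler0n _ _) (sqr_ge0 _).
  by exists C => _ [M _ <-]; rewrite /series /= big_mkord; exact: hC.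
(* Chosen so that the bound (d / sqrt M) / (1 - r) on the shifted series has square e / M. *)
pose d := Num.sqrt e * (1 - r).
have r1 : 0 < 1 - r by rewrite subr_gt0.
have d0 : 0 < d by rewrite mulr_gt0 ?sqrtr_gt0.
have [K _ hK] : \forall n \near \oo, n%:R * normc (a n) ^+ 2 <= d ^+ 2.
  have dd : 0 < d ^+ 2 by rewrite exprn_gt0.
  move/cvgr0_norm_le : t0 => /(_ _ dd); apply: filterS => n.
  by rewrite ger0_norm // mulr_ge0 ?sqr_ge0.
exists K.+1 => // M /= KM.
have M0 : 0 < M%:R :> R by rewrite ltr0n (leq_trans _ KM).
have hb : geometric_bound (d / Num.sqrt M%:R) 1 (fun j => a (M + j).+1).
  move=> j; rewrite expr1n mulr1 ler_pdivlMr ?sqrtr_gt0 //.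
  rewrite -ler_sqr ?nnegrE ?(ltW d0) ?mulr_ge0 ?normc_ge0 ?sqrtr_ge0 //.
  rewrite exprMn sqr_sqrtr ?(ltW M0) // mulrC.
  apply: le_trans (hK (M + j).+1 _); last by rewrite /= leqW // (leq_trans (ltnW KM)) ?leq_addr.
  by rewrite ler_wpM2r ?sqr_ge0 // ler_nat leqW // leq_addr.
have := ev_bound ler01 hb p1'; rewrite -/(bshift p a M) mul1r -/r => h.
have -> : e = M%:R * (d / Num.sqrt M%:R / (1 - r)) ^+ 2.
  rewrite /d -{1}(sqr_sqrtr (ltW e0)) -{1}(sqr_sqrtr (ltW M0)).
  have sM : Num.sqrt M%:R != 0 :> R by rewrite gt_eqF // sqrtr_gt0.
  by field; rewrite sM gt_eqF.
rewrite ler_wpM2l // /x ler_sqr ?nnegrE ?normc_ge0 //.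
by rewrite divr_ge0 ?ltW // divr_gt0 // sqrtr_gt0.
Qed.

Lemma dsum_move C : (forall M, dsum a M <= C) -> forall M, dsum (move lam p a) M <= C.
Proof.
move=> hC M; apply/ler_addgt0Pr => e e0.
have [K _ hK] := bshift_tail hC e0.
have hmono m n : (m <= n)%N -> dsum (move lam p a) m <= dsum (move lam p a) n.
  move=> mn; rewrite /dsum -!(big_mkord xpredT (fun i => i%:R * normc (move lam p a i) ^+ 2)).
  by rewrite [leRHS](big_cat_nat (n := m)) //= lerDl sumr_ge0 // => i _; rewrite mulr_ge0 ?sqr_ge0.
apply: le_trans (hmono _ (maxn M K).+1 _) _; first by rewrite leqW // leq_maxl.
apply: le_trans (move_dsum _) _; apply: lerD; first exact: hC.
apply: le_trans (hK (maxn M K) (leq_maxr _ _)); rewrite ler_piMl //.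
  by rewrite mulr_ge0 ?sqr_ge0.
have lam0 : 0 <= lam by rewrite (le_trans _ plam) // ltW.
by apply: mulr_ile1; rewrite ?subr_ge0 ?normc_ge0 ?gerBl // ltW.
Qed.

Lemma hsum_move C D : (forall M, dsum a M <= C) -> (forall M, hsum a M <= D) ->
  forall M, hsum (move lam p a) M <= lam * D.
Proof.
move=> hC hD M; apply/ler_addgt0Pr => e e0.
have [K _ hK] := bshift_tail hC e0.
have hmono m n : (m <= n)%N -> hsum (move lam p a) m <= hsum (move lam p a) n.
  move=> mn; rewrite /hsum -!(big_mkord xpredT (fun i => normc (move lam p a i) ^+ 2)).
  by rewrite [leRHS](big_cat_nat (n := m)) //= lerDl sumr_ge0 // => i _; rewrite sqr_ge0.
(* Here m >= 1, so that x_m <= m x_m and the tail bound also covers the boundary term, which carries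
   no weight here. *)
pose m := (maxn M K).+1.
have lam0 : 0 < lam by apply: lt_le_trans plam.
apply: le_trans (hmono _ m.+1 _) _; first by rewrite !leqW // leq_maxl.
apply: le_trans (move_hsum _) _; apply: lerD; first by rewrite ler_wpM2l // ltW.
apply: le_trans (hK m _); last by rewrite /= leqW // leq_maxr.
rewrite ler_wpM2r ?sqr_ge0 // (@le_trans _ _ 1) ?ler1n //.
by apply: mulr_ile1; rewrite ?subr_ge0 ?exprn_ge0 ?normc_ge0 ?gerBl ?expr_le1 ?normc_ge0 ?(ltW lam0) // ltW.
Qed.

End OneZero.
End MoveZero.

(** * Moving all zeros *)

Lemma cancel_expr (F : idomainType) (s x o e l y : F) (i j k : nat) : s != 0 -> (i <= k)%N ->
  x * (s ^+ i * o) = s ^+ k * e * (l * (s ^+ j * y)) ->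
  x * o = s ^+ (k - i + j) * (e * (l * y)).
Proof.
move=> s0 ik h; apply: (mulfI (expf_neq0 i s0)).
by rewrite mulrCA h -{1}(subnKC ik) !exprD; ring.
Qed.

Section CountZeros.
Variable R : realType.
Implicit Types (p q : nat -> R[i]) (z w : R[i]).

Definition count_zeros p w N := (\sum_(n < N) (p n == w))%N.

Lemma count_zerosS p w N : count_zeros p w N.+1 = (count_zeros p w N + (p N == w))%N.
Proof. by rewrite /count_zeros big_ord_recr. Qed.

Definition offzero_prod p w N z := \prod_(n < N) (if p n == w then 1 else z - p n).

Lemma prod_offzero p w N z : \prod_(n < N) (z - p n) =
  (z - w) ^+ count_zeros p w N * offzero_prod p w N z.
Proof.
elim: N => [|N IH]; first by rewrite /count_zeros /offzero_prod !big_ord0 expr0 mulr1.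
rewrite /offzero_prod !big_ord_recr /= -/(offzero_prod p w N z) IH count_zerosS.
have [->|_] := eqVneq (p N) w; first by rewrite addn1 exprSr mulr1 mulrAC.
by rewrite addn0 mulrA.
Qed.

Lemma offzero_prod_cvg p w N :
  ccvg (fun i => offzero_prod p w N (w + step R i)) (offzero_prod p w N w).
Proof.
elim: N => [|N IH].
  by rewrite /offzero_prod big_ord0; under eq_fun do rewrite big_ord0; exact: ccvg_cst.
rewrite /offzero_prod big_ord_recr; under eq_fun do rewrite big_ord_recr.
apply: ccvgM; first exact: IH.
case: ifP => _; first exact: ccvg_cst.
by apply: ccvgB; [exact: step_cvg | exact: ccvg_cst].
Qed.

Lemma offzero_prod_neq0 p w N : offzero_prod p w N w != 0.
Proof.
apply/prodf_neq0 => n _; case: ifPn => [_|pw]; first exact: oner_neq0.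
by rewrite subr_eq0 eq_sym.
Qed.

End CountZeros.

Section MoveAll.
Variable R : realType.
Variables (lam : nat -> R) (p : nat -> R[i]).
Hypotheses (p0 : forall n, 0 < normc (p n)) (p1 : forall n, normc (p n) < 1).
Hypotheses (plam : forall n, normc (p n) <= lam n) (lam1 : forall n, lam n <= 1).

Fixpoint moves (a : nat -> R[i]) N :=
  if N is M.+1 then move (lam M) (p M) (moves a M) else a.

Let q n := (lam n)^-1%:C * p n.

Let lam0 n : 0 < lam n. Proof. exact: lt_le_trans (p0 n) (plam n). Qed.

Variables (a : nat -> R[i]) (C : R).
Hypothesis aC : forall M, dsum a M <= C.
Hypothesis hord : forall w, normc w < 1 ->
  exists2 K, ord a w K & forall N, (count_zeros p w N <= K)%N.

Let D := normc (a 0%N) ^+ 2 + C.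

Lemma prod_moved N z : \prod_(n < N) ((lam n)%:C * z - p n) =
  (\prod_(n < N) (lam n)%:C) * \prod_(n < N) (z - q n).
Proof.
rewrite -big_split; apply: eq_bigr => n _ /=.
rewrite mulrBr /q mulrA -rmorphM divff ?gt_eqF // rmorph1 mul1r; exact: erefl.
Qed.

(** The relation to the original function is kept as a polynomial identity without division, valid
    at the points [p n] too; orders of vanishing are extracted from it by [ord_factor]. *)
Let moves_inv b N := [/\ forall M, dsum b M <= C,
  forall M, hsum b M <= \prod_(n < N) lam n * D, b 0%N = a 0%N &
  forall z, normc z < 1 ->
    ev b z * \prod_(n < N) (z - p n) = ev a z * \prod_(n < N) ((lam n)%:C * z - p n)].

Let prod_lam N : 0 <= \prod_(n < N) lam n <= 1.
Proof.
elim: N => [|N /andP[h0 h1]]; first by rewrite big_ord0 ler01 lexx.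
by rewrite big_ord_recr /= mulr_ge0 ?(ltW (lam0 _)) //= mulr_ile1 // ltW.
Qed.

Let D0 : 0 <= D.
Proof. by rewrite /D addr_ge0 ?sqr_ge0 // (le_trans _ (aC 0)) // /dsum big_ord0. Qed.

Let inv_bound b N : moves_inv b N -> geometric_bound (Num.sqrt D) 1 b.
Proof.
move=> [_ h _ _]; apply: hsum_bound => M; apply: le_trans (h M) _.
by rewrite ler_piMl //; case/andP: (prod_lam N).
Qed.

(** Powers of z - w are cancelled on both sides of the identity: each of the first [N] points equal
    to [w] lowers the order by one, each moved point landing on [w] raises it by one. Both occur, as
    a moved point may land on an unmoved one. *)
Let inv_ord b N w K : moves_inv b N -> normc w < 1 -> ord a w K ->
  (count_zeros p w N <= K)%N ->
  ord b w (K - count_zeros p w N + count_zeros q w N).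
Proof.
move=> hb w1 oK le_K; have [_ _ _ hz] := hb.
have kw : 1 * normc w < 1 by rewrite mul1r.
have ga := hsum_bound (dsum_hsum aC).
pose H i := ev (iter K (bshift w) a) (w + step R i) *
  ((\prod_(n < N) (lam n)%:C) * offzero_prod q w N (w + step R i)).
have gaK := iter_bshift_bound ler01 kw K ga.
apply: (ord_factor (G := fun i => offzero_prod p w N (w + step R i)) (H := H)
  ler01 (inv_bound hb) kw (offzero_prod_cvg p w N)).
- apply: ccvgM; first exact: ev_continuous ler01 gaK kw (step_cvg w).
  apply: ccvgM; first exact: ccvg_cst.
  exact: offzero_prod_cvg.
- exact: offzero_prod_neq0.
- rewrite !mulf_neq0 ?offzero_prod_neq0 //; first by case: oK.
  apply/prodf_neq0 => n _; rewrite -normc_eq0 normc_real normr_eq0; exact: lt0r_neq0.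
near=> i.
have zi : 1 * normc (w + step R i) < 1 by near: i; exact: near_step kw.
have zi' : normc (w + step R i) < 1 by rewrite -[X in X < _]mul1r.
have := hz _ zi'; rewrite prod_moved !(prod_offzero _ w).
rewrite (ev_ord ler01 ga kw oK.1 zi) [X in X ^+ K]addrAC subrr add0r.
rewrite [X in X ^+ count_zeros p w N]addrAC subrr add0r.
rewrite [X in X ^+ count_zeros q w N]addrAC subrr add0r.
exact: (cancel_expr (step_neq0 R i) le_K).
Unshelve. all: by end_near. Qed.

(** Counting [p N] itself, the first N + 1 points contain it at most K times, so the first N moves
    leave its order at least 1. This is what allows the next move. *)
Let inv_zero b N : moves_inv b N -> ev b (p N) = 0.
Proof.
move=> IH; have [K oK cK] := hord (p1 N).
have [h _] := inv_ord IH (p1 N) oK (cK N); apply: (h 0%N).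
by rewrite addn_gt0 subn_gt0; have := cK N.+1; rewrite count_zerosS eqxx addn1 => ->.
Qed.

Lemma movesP N : moves_inv (moves a N) N.
Proof.
elim: N => [|N IH].
  split=> [//|M|//|z _]; last by rewrite !big_ord0.
  by rewrite big_ord0 mul1r; exact: dsum_hsum.
have [hC hD h0 hz] := IH; have gb := inv_bound IH.
have b0 := inv_zero IH.
split=> [M|M||z z1].
- exact: (dsum_move (p0 N) (p1 N) (plam N) (lam1 N) gb hC).
- rewrite big_ord_recr /= mulrAC mulrC.
  exact: (hsum_move (p0 N) (p1 N) (plam N) (lam1 N) gb b0 hC hD).
- exact: h0.
have [_ e] := ev_move (lam N) (p1 N) gb b0 z1.
rewrite !big_ord_recr [X in _ * X]mulrC mulrA e -mulrA hz // mulrCA; congr (_ * _).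
exact: mulrC.
Qed.

Lemma moves_bound N : geometric_bound (Num.sqrt D) 1 (moves a N).
Proof. exact: inv_bound (movesP N). Qed.

Lemma moves_ord N w K : normc w < 1 -> ord a w K -> (count_zeros p w N <= K)%N ->
  ord (moves a N) w (K - count_zeros p w N + count_zeros q w N).
Proof. exact: inv_ord (movesP N). Qed.

Lemma moves_zero N : ev (moves a N) (p N) = 0.
Proof. exact: inv_zero (movesP N). Qed.

Lemma moves0 N : moves a N 0%N = a 0%N.
Proof. by have [] := movesP N. Qed.

Lemma moves_dsum N M : dsum (moves a N) M <= C.
Proof. by have [] := movesP N. Qed.

(** The constant coefficient never changes, while the bound on the H^2 norm shrinks by [lam n] at
    every move; the former is at most the latter. *)
Lemma prod_lam_ge N : normc (a 0%N) ^+ 2 <= \prod_(n < N) lam n * D.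
Proof.
have [_ h h0 _] := movesP N.
by have := h 1%N; rewrite /hsum big_ord1 h0.
Qed.

End MoveAll.

(** * Sequences of bounded variation; products and sums *)

Section Variation.
Variable R : realType.

Lemma bounded_variation_cvg (x e : nat -> R) K : (forall n, `|x n.+1 - x n| <= e n) ->
  (forall N, \sum_(n < N) e n <= K) -> cvgn x.
Proof.
move=> hx hK.
have e0 n : 0 <= e n := le_trans (normr_ge0 _) (hx n).
have ce : cvgn (series e).
  apply: nondecreasing_is_cvgn; first by apply: nondecreasing_series => i _ _.
  by exists K => _ [M _ <-]; rewrite /series /= big_mkord.
have cd : cvgn (series (fun n => x n.+1 - x n)).
  by apply: normed_cvg; exact: (series_le_cvg _ e0 hx ce).
have -> : x = (fun n => x 0%N + series (fun n => x n.+1 - x n) n).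
  by apply/funext => n; rewrite /series /= telescope_sumr // addrC subrK.
by apply: is_cvgD => //; exact: is_cvg_cst.
Qed.

Lemma bounded_variation_ccvg (u : nat -> R[i]) (e : nat -> R) K :
  (forall n, normc (u n.+1 - u n) <= e n) -> (forall N, \sum_(n < N) e n <= K) ->
  exists l, ccvg u l.
Proof.
move=> hu hK.
have cr : cvgn (fun n => complex.Re (u n)).
  apply: (bounded_variation_cvg _ hK) => n; apply: le_trans (hu n).
  by apply: le_trans (normc_Re _); case: (u n.+1) (u n) => ? ? [].
have ci : cvgn (fun n => complex.Im (u n)).
  apply: (bounded_variation_cvg _ hK) => n; apply: le_trans (hu n).
  by apply: le_trans (normc_Im _); case: (u n.+1) (u n) => ? ? [].
by exists (limn (fun n => complex.Re (u n)) +i* limn (fun n => complex.Im (u n)));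
  apply: ccvg_ReIm.
Qed.

(** The inequality 1 + sum (1 - r_n) <= prod (1 / r_n), cleared of denominators; it turns a lower
    bound on the Blaschke product into an upper bound on the Blaschke sum. *)
Lemma sum_oneB_le (r : nat -> R) N : (forall n, 0 <= r n <= 1) ->
  (1 + \sum_(n < N) (1 - r n)) * \prod_(n < N) r n <= 1.
Proof.
move=> hr; have hp M : 0 <= \prod_(n < M) r n <= 1.
  elim: M => [|M /andP[h0 h1]]; first by rewrite big_ord0 ler01 lexx.
  by have /andP[r0 r1] := hr M; rewrite big_ord_recr /= mulr_ge0 //= mulr_ile1.
elim: N => [|N IH]; first by rewrite !big_ord0 addr0 mul1r.
have /andP[q0 q1] := hp N.+1; have /andP[r0 r1] := hr N.
have h1 := ler_wpM2r r0 IH.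
have h2 : (1 - r N) * \prod_(n < N.+1) r n <= 1 - r N by rewrite ler_piMr // subr_ge0.
have h3 : (1 + \sum_(n < N) (1 - r n)) * \prod_(n < N.+1) r n <= r N.
  by rewrite big_ord_recr /= mulrA -[leRHS]mul1r.
rewrite big_ord_recr /= addrA mulrDl; apply: le_trans (lerD h3 h2) _.
by rewrite subrKC.
Qed.

End Variation.

(** * The limit function and its zeros *)

Section LimitOfMoves.
Variable R : realType.
Variables (lam : nat -> R) (p : nat -> R[i]).
Hypotheses (p0 : forall n, 0 < normc (p n)) (p1 : forall n, normc (p n) < 1).
Hypotheses (plam : forall n, normc (p n) <= lam n) (lam1 : forall n, lam n <= 1).
Variables (a : nat -> R[i]) (C : R).
Hypotheses (aC : forall M, dsum a M <= C) (a0 : a 0%N != 0).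
Hypothesis hord : forall w, normc w < 1 ->
  exists2 K, ord a w K & exists N0, forall N, (N0 <= N)%N -> count_zeros p w N = K.

Let q n := (lam n)^-1%:C * p n.
Let D := normc (a 0%N) ^+ 2 + C.
Let delta := normc (a 0%N) ^+ 2 / D.

Let hord_le w : normc w < 1 ->
  exists2 K, ord a w K & forall N, (count_zeros p w N <= K)%N.
Proof.
move=> w1; have [K oK [N0 hN0]] := hord w1; exists K => // N.
rewrite -(hN0 (maxn N N0)) ?leq_maxr //; have := leq_maxl N N0.
move: (maxn N N0) => N'; elim: N' => [|N' IH]; first by rewrite leqn0 => /eqP ->.
rewrite leq_eqVlt => /predU1P[->//|]; rewrite ltnS => /IH /leq_trans; apply.
by rewrite count_zerosS leq_addr.
Qed.

Let a2 : 0 < normc (a 0%N) ^+ 2. Proof. by rewrite exprn_gt0 // normc_gt0. Qed.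

Let D0 : 0 < D.
Proof. by rewrite /D ltr_pwDl // (le_trans _ (aC 0)) // /dsum big_ord0. Qed.

Let delta0 : 0 < delta. Proof. by rewrite /delta divr_gt0. Qed.

Let lam0 n : 0 < lam n. Proof. exact: lt_le_trans (p0 n) (plam n). Qed.

(* Pushing all the zeros to the unit circle bounds the Blaschke product from below. *)
Lemma blaschke_prod N : delta <= \prod_(n < N) normc (p n).
Proof.
rewrite /delta ler_pdivrMr //.
exact: (@prod_lam_ge _ (fun n => normc (p n)) p p0 p1 (fun=> lexx _)
  (fun n => ltW (p1 n)) a C aC hord_le N).
Qed.

Lemma blaschke_sum N : \sum_(n < N) (1 - normc (p n)) <= delta^-1.
Proof.
have S0 : 0 <= \sum_(n < N) (1 - normc (p n)).
  by apply: sumr_ge0 => n _; rewrite subr_ge0 ltW.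
have h := @sum_oneB_le R (fun n => normc (p n)) N.
have {h} := h (fun n => introT andP (conj (normc_ge0 _) (ltW (p1 n)))).
have := blaschke_prod N; set P := \prod_(n < N) _; set S := \sum_(n < N) _ => hd hS.
rewrite -(ler_pM2r delta0) mulVf ?gt_eqF //.
apply: le_trans hS; rewrite mulrDl mul1r; apply: le_trans (ler_wpM2l S0 hd) _.
by rewrite lerDr; apply: le_trans hd; exact: ltW.
Qed.

(** A partial product is at most its last factor. The points therefore stay away from 0, which makes
    division by them harmless. *)
Lemma blaschke_min n : delta <= normc (p n).
Proof.
apply: le_trans (blaschke_prod n.+1) _; rewrite big_ord_recr /= ler_piMl ?normc_ge0 //.
by apply: prodr_ile1 => i _; rewrite normc_ge0 ltW.
Qed.

Let A N := moves lam p a N.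
Let c := Num.sqrt D.

Let A_bound N : geometric_bound c 1 (A N).
Proof. exact: (moves_bound p0 p1 plam lam1 aC hord_le). Qed.

Let A_zero N : ev (A N) (p N) = 0.
Proof. exact: (moves_zero p0 p1 plam lam1 aC hord_le). Qed.

Let A_step N z : normc z < 1 ->
  ev (A N.+1) z * (z - p N) = ((lam N)%:C * z - p N) * ev (A N) z.
Proof. by move=> z1; have [] := ev_move (lam N) (p1 N) (A_bound N) (A_zero N) z1. Qed.

(** Solving p b_0 = - a_0 and p b_{k+1} = b_k - a_{k+1} upwards divides by |p| >= delta each time.
    The bound grows with k but does not depend on N, whereas the constant of [bshift_bound]
    degenerates as the points approach the circle. *)
Let B := fix B k := if k is j.+1 then (B j + c) / delta else c / delta.

Let bshift_A N k : normc (bshift (p N) (A N) k) <= B k.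
Proof.
have pp : 0 < normc (p N) by exact: p0.
have le_div x y : 0 <= y -> normc (p N) * x <= y -> x <= y / delta.
  move=> y0 h; rewrite ler_pdivlMr // mulrC.
  have [x0|/ltW x0] := leP 0 x; first by apply: le_trans h; rewrite ler_wpM2r // blaschke_min.
  by apply: le_trans y0; rewrite mulr_ge0_le0 // ltW.
have c0 : 0 <= c by exact: sqrtr_ge0.
elim: k => [|k IH] /=; apply: le_div => //.
- rewrite -normcM -normcNE -(coef0_bshift (p1 N) (A_bound N) (A_zero N)).
  by have := A_bound N 0%N; rewrite expr0 mulr1.
- by rewrite addr_ge0 // (le_trans _ IH) // normc_ge0.
have := coef_bshift (p1 N) (A_bound N) k => /eqP; rewrite eq_sym subr_eq addrC -subr_eq => /eqP e.
rewrite -normcM -e; apply: le_trans (normcD _ _) _; rewrite normcNE; apply: lerD => //.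
by have := A_bound N k.+1; rewrite expr1n mulr1.
Qed.

(** One move changes the coefficient of index k+1 by 1 - lam N times a quantity bounded by B k, and
    1 - lam N <= 1 - |p N| is summable. *)
Let A_cvg k : exists l, ccvg (fun N => A N k) l.
Proof.
case: k => [|k]; first by exists (a 0%N);
  under eq_fun do rewrite /A (moves0 p0 p1 plam lam1 aC hord_le); exact: ccvg_cst.
have Bk : 0 <= B k := le_trans (normc_ge0 _) (bshift_A 0 k).
apply: (@bounded_variation_ccvg _ _ (fun N => (1 - normc (p N)) * B k) (delta^-1 * B k)).
  move=> N; rewrite /A /= addrAC subrr add0r normcNE normcM normc_real.
  rewrite ger0_norm ?subr_ge0 //; apply: ler_pM; rewrite ?subr_ge0 ?normc_ge0 //.
    by rewrite lerD2l lerN2.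
by move=> N; rewrite -mulr_suml ler_wpM2r // blaschke_sum.
Qed.

(** Plays the role of Hurwitz's theorem: no zero is gained at [w]. The leading Taylor coefficient g
    satisfies g_{n+1} (w - p_n) = (lam_n w - p_n) g_n, and |w - p_n| <= |lam_n w - p_n| (1 + (1 -
    lam_n) / eta). Hence |g_n| <= |g_{n+1}| exp((1 - lam_n) / eta), and the exponents have a bounded
    sum. *)
Let moved_order w (N1 m : nat) (eta : R) : normc w < 1 -> 0 < eta ->
  (forall n, (N1 <= n)%N -> normc w + eta <= normc (p n)) ->
  (forall n, (N1 <= n)%N -> ord (A n) w m) ->
  exists2 x, 0 < x & forall n, (N1 <= n)%N -> x <= normc (tcoef w (A n) m).
Proof.
move=> w1 eta0 hp hm; pose g n := tcoef w (A n) m.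
have kw : 1 * normc w < 1 by rewrite mul1r.
have gE n : (N1 <= n)%N -> g n.+1 * (w - p n) = ((lam n)%:C * w - p n) * g n.
  move=> Nn.
  have hc (b : nat -> R[i]) : geometric_bound c 1 b -> ccvg (fun i => ev (iter m (bshift w) b) (w + step R i)) (tcoef w b m).
    by move=> hb; exact: (ev_continuous ler01 (iter_bshift_bound ler01 kw m hb) kw (step_cvg w)).
  have h1 := ccvgM (hc _ (A_bound n.+1)) (ccvgB (step_cvg w) (ccvg_cst (p n))).
  have h2 := ccvgM (ccvgB (ccvgZ (lam n)%:C (step_cvg w)) (ccvg_cst (p n))) (hc _ (A_bound n)).
  apply: ccvg_uniq h1 _; apply: ccvg_eq h2; near=> i.
  have zi : 1 * normc (w + step R i) < 1 by near: i; exact: near_step kw.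
  have zi' : normc (w + step R i) < 1 by rewrite -[X in X < _]mul1r.
  have := A_step n zi'.
  rewrite (ev_ord ler01 (A_bound n.+1) kw (hm n.+1 (leqW Nn)).1 zi).
  rewrite (ev_ord ler01 (A_bound n) kw (hm n Nn).1 zi).
  rewrite !stepK => E.
  have s0 : step R i ^+ m != 0 by rewrite expf_neq0 // step_neq0.
  apply: (mulfI s0); rewrite mulrCA -E mulrA; exact: erefl.
have gle n : (N1 <= n)%N -> normc (g n) <= normc (g n.+1) * expR ((1 - lam n) / eta).
  move=> Nn; pose d := normc ((lam n)%:C * w - p n).
  have l1 : 0 <= 1 - lam n by rewrite subr_ge0.
  have de : eta <= d.
    rewrite /d normcB; apply: le_trans (lerB_normc _ _).
    rewrite normcM normc_real ger0_norm ?(ltW (lam0 _)) //.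
    rewrite lerBrDl; apply: le_trans (hp n Nn); rewrite lerD2r ler_piMl ?normc_ge0 //.
  have d0 : 0 < d by exact: lt_le_trans de.
  rewrite -(ler_pM2l d0) /d -normcM -gE // normcM -/d mulrCA ler_wpM2l ?normc_ge0 //.
  have -> : w - p n = ((lam n)%:C * w - p n) + (1 - lam n)%:C * w.
    rewrite -{1}(mul1r w) -(rmorph1 (real_complex R)) -[in LHS](subrKC (lam n) 1) rmorphD mulrDl addrAC; exact: erefl.
  apply: le_trans (normcD _ _) _; rewrite normcM normc_real ger0_norm // -/d.
  have h := expR_ge1Dx ((1 - lam n) / eta).
  apply: le_trans (ler_wpM2l (ltW d0) h); rewrite mulrDr mulr1 lerD2l mulrCA ler_wpM2l //.
  by rewrite ler_pdivlMr //; apply: le_trans de; rewrite ler_piMl ?(ltW eta0) // ltW.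
pose S n := \sum_(i < n) (1 - lam i) / eta.
have gN n : (N1 <= n)%N -> normc (g N1) <= normc (g n) * expR (S n).
  elim: n => [|n IH].
    by rewrite leqn0 => /eqP ->; rewrite /S big_ord0 expR0 mulr1.
  rewrite leq_eqVlt => /predU1P[->|].
    rewrite ler_peMr ?normc_ge0 // -[leLHS]expR0 ler_expR sumr_ge0 // => i _.
    by rewrite divr_ge0 ?subr_ge0 // ltW.
  rewrite ltnS => Nn; apply: le_trans (IH Nn) _.
  rewrite /S big_ord_recr /= addrC expRD mulrA.
  by rewrite ler_wpM2r ?expR_ge0 // gle.
exists (normc (g N1) / expR (delta^-1 / eta)) => [|n Nn].
  by rewrite divr_gt0 ?expR_gt0 // normc_gt0; have [] := hm N1 (leqnn _).
rewrite ler_pdivrMr ?expR_gt0 //; apply: le_trans (gN n Nn) _.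
rewrite ler_wpM2l ?normc_ge0 // ler_expR /S -mulr_suml ler_wpM2r ?invr_ge0 ?(ltW eta0) //.
apply: le_trans (blaschke_sum n); apply: ler_sum => i _.
by rewrite lerD2l lerN2.
Unshelve. all: by end_near. Qed.

Theorem moved_zeros : exists2 b : nat -> R[i],
  geometric_bound c 1 b /\ (forall M, dsum b M <= C) &
  forall w, normc w < 1 ->
    exists2 m, ord b w m & exists N0, forall N, (N0 <= N)%N -> count_zeros q w N = m.
Proof.
have [b hb] := choice A_cvg.
have b_bound : geometric_bound c 1 b.
  by apply: (ev_lim (z := 0) ler01 A_bound hb _).1; rewrite normc0 mulr0.
exists b; [split=> // M|move=> w w1].
  have : (fun N => dsum (A N) M) @ \oo --> dsum b M.
    rewrite /dsum; elim: M => [|M IH].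
      by rewrite big_ord0; under eq_fun do rewrite big_ord0; exact: cvg_cst.
    rewrite big_ord_recr; under eq_fun do rewrite big_ord_recr.
    apply: cvgD => //; apply: cvgM; first exact: cvg_cst.
    by apply: (@cvgM _ _ _ _ (fun N => normc (A N M)) (fun N => normc (A N M))); exact: ccvg_normc.
  move=> /cvgr_to_le; apply; apply: nearW => N.
  exact: (moves_dsum p0 p1 plam lam1 aC hord_le).
have [K oK [N0 hN0]] := hord w1.
have kw : 1 * normc w < 1 by rewrite mul1r.
(* Half the distance from [w] to the circle. As |p n| tends to 1, for large n the points [p n], and
   also [q n], whose modulus is no smaller, have modulus at least |w| + eta, so neither sequence
   meets [w] again. *)
pose eta := (1 - normc w) / 2.
have eta0 : 0 < eta by rewrite divr_gt0 // subr_gt0.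
have [N1 hN1] : exists N1, forall n, (N1 <= n)%N -> normc w + eta <= normc (p n).
  have t0 : (fun n => 1 - normc (p n)) @ \oo --> (0 : R).
    apply: cvg_series_cvg_0; apply: nondecreasing_is_cvgn.
      by apply: nondecreasing_series => i _ _; rewrite subr_ge0 ltW.
    by exists delta^-1 => _ [M _ <-]; rewrite /series /= big_mkord blaschke_sum.
  move/cvgr0_norm_le : t0 => /(_ _ eta0) [N1 _ h]; exists N1 => n /h /= {}h.
  by have := le_trans (ler_norm _) h; rewrite /eta; lra.
pose N2 := maxn N0 N1.
have cq N : (N2 <= N)%N -> count_zeros q w N = count_zeros q w N2.
  elim: N => [|N IH]; first by rewrite leqn0 => /eqP ->.
  rewrite leq_eqVlt => /predU1P[->//|]; rewrite ltnS => NN.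
  rewrite count_zerosS IH //; suff /negPf -> : q N != w by rewrite addn0.
  apply: contraTneq (hN1 N (leq_trans (leq_maxr _ _) NN)) => <-; rewrite -ltNge.
  rewrite /q normcM normc_real ger0_norm ?invr_ge0 ?(ltW (lam0 _)) //.
  rewrite ltr_pwDr //  -[leLHS]mul1r ler_wpM2r ?normc_ge0 //.
  by rewrite invr_ge1 ?unitfE ?gt_eqF.
have ordA N : (N2 <= N)%N -> ord (A N) w (count_zeros q w N2).
  move=> NN; have N0N : (N0 <= N)%N by rewrite (leq_trans _ NN) // leq_maxl.
  (* By then all K points equal to [w] have been moved, so the order K - K + count reduces to the
     number of moved points at [w]. *)
  have := moves_ord p0 p1 plam lam1 aC hord_le w1 oK; move=> /(_ N).
  by rewrite hN0 // leqnn subnn add0n cq // => /(_ isT).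
set m := count_zeros q w N2 in ordA cq *.
exists m; last by exists N2.
have tl j := tcoef_lim ler01 kw j A_bound hb.
have [x x0 hx] := moved_order w1 eta0
  (fun n (Nn : (N2 <= n)%N) => hN1 n (leq_trans (leq_maxr _ _) Nn)) ordA.
split=> [j jm|].
  apply: ccvg_uniq (tl j) _; apply: ccvg_eq (ccvg_cst 0).
  by exists N2 => // N NN; have [h _] := ordA N NN; rewrite (h j jm); exact: erefl.
rewrite -normc_gt0; apply: lt_le_trans x0 _; apply: (ccvg_ge (tl m)).
by exists N2 => // N /= NN; exact: hx.
Qed.

End LimitOfMoves.

(** * Cauchy's estimate *)

Section RootsOfUnity.
Variable R : realType.
Implicit Types (z w : R[i]) (c : nat -> R[i]) (t : R).

Lemma expiD t1 t2 : expi (t1 + t2) = expi t1 * expi t2 :> R[i].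
Proof. by apply/eqP; rewrite eq_complex /= cosD sinD eqxx /= addrC. Qed.

Lemma expi0 : expi (0 : R) = 1 :> R[i].
Proof. by apply/eqP; rewrite eq_complex /= cos0 sin0 !eqxx. Qed.

Lemma normc_expi t : normc (expi t) = 1.
Proof.
have h : normc (expi t) ^+ 2 = 1 by rewrite normc_sqr /= cos2Dsin2.
by apply/eqP; rewrite -(@eqrXn2 _ 2) ?normc_ge0 // h expr1n.
Qed.

Lemma expiX t n : expi t ^+ n = expi (t *+ n) :> R[i].
Proof. by elim: n => [|n IH]; rewrite ?expr0 ?mulr0n ?expi0 // exprS IH mulrS expiD. Qed.

Lemma normc_sqrE z : (normc z ^+ 2)%:C = z * z^*.
Proof.
rewrite normc_sqr; case: z => x y; apply/eqP; rewrite eq_complex /=.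
by apply/andP; split; apply/eqP; ring.
Qed.

Definition root1 K : R[i] := expi (pi *+ 2 / K%:R).

Lemma root1X K : (0 < K)%N -> root1 K ^+ K = 1.
Proof.
move=> K0; have -> : root1 K ^+ K = expi (pi *+ 2).
  rewrite /root1 expiX; congr expi; rewrite -[LHS]mulr_natr divfK // pnatr_eq0 -lt0n //.
by apply/eqP; rewrite eq_complex /= cos2pi sin2pi !eqxx.
Qed.

Lemma root1_prim K j : (0 < j < K)%N -> root1 K ^+ j != 1.
Proof.
move=> /andP[j0 jK]; rewrite /root1 expiX eq_complex /= negb_and; apply/orP; left.
have K0 : 0 < K%:R :> R by rewrite ltr0n (leq_trans _ jK).
have -> : pi *+ 2 / K%:R *+ j = (pi * (j%:R / K%:R)) *+ 2 :> R.
  by field; rewrite gt_eqF.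
set y := pi * _.
have s0 : 0 < sin y.
  have jK0 : 0 < j%:R / K%:R :> R by rewrite divr_gt0 // ltr0n.
  apply: sin_gt0_pi; rewrite mulr_gt0 ?pi_gt0 //=.
  by rewrite gtr_pMr ?pi_gt0 // ltr_pdivrMr // mul1r ltr_nat.
rewrite cos_mulr2n lt_eqF //; have := cos2Dsin2 y; have := exprn_gt0 2 s0.
by move: (sin y ^+ 2) (cos y ^+ 2) => u v; lra.
Qed.

(** For exponents n and m below [K], the ratio e of the corresponding powers of the root satisfies
    e^K = 1, and e = 1 only if n = m; otherwise its powers sum to 0. For polynomials of degree below
    [K] this finite average replaces the integral over a circle. *)
Lemma parseval c K z : (0 < K)%N ->
  \sum_(i < K) normc (\sum_(n < K) c n * (root1 K ^+ i * z) ^+ n) ^+ 2 =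
  K%:R * \sum_(n < K) normc (c n) ^+ 2 * normc z ^+ n ^+ 2.
Proof.
move=> K0; apply: complexI; set w := root1 K.
pose d (n : 'I_K) := c n * z ^+ n.
have ww : w * w^* = 1 by rewrite -normc_sqrE normc_expi expr1n rmorph1.
have wj (n : nat) : w ^+ n * (w ^+ n)^* = 1 by rewrite rmorphXn -exprMn ww expr1n.
have geo (n m : 'I_K) : \sum_(i < K) (w ^+ n * (w ^+ m)^*) ^+ i = (n == m)%:R * K%:R.
  have [->|nm] := eqVneq n m.
    by under eq_bigr do rewrite wj expr1n; rewrite sumr_const card_ord mul1r.
  rewrite mul0r; set e := w ^+ n * _.
  have eK : e ^+ K = 1.
    rewrite /e exprMn -rmorphXn -!exprM mulnC exprM root1X // expr1n mul1r.
    by rewrite mulnC exprM root1X // expr1n rmorph1.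
  have e1 : e != 1.
    have key (u v : nat) : (u < v < K)%N -> w ^+ v * (w ^+ u)^* != 1.
      move=> /andP[uv vK]; rewrite -(subnK (ltnW uv)) exprD -mulrA wj mulr1.
      by apply: root1_prim; rewrite subn_gt0 uv (leq_ltn_trans (leq_subr _ _) vK).
    have [nlm|mln|/val_inj /eqP] := ltngtP n m; last by rewrite (negPf nm).
      apply: contra (key n m _); rewrite ?nlm ?ltn_ord // => /eqP h.
      by rewrite -[w ^+ m]conjcK mulrC -rmorphM -/e h rmorph1.
    by apply: key; rewrite mln ltn_ord.
  have := subrX1 e K; rewrite eK subrr => /esym/eqP.
  by rewrite mulf_eq0 subr_eq0 (negPf e1) => /eqP.
rewrite rmorph_sum rmorphM rmorph_sum /=.
transitivity (\sum_(i < K) \sum_(n < K) \sum_(m < K) d n * (d m)^* * (w ^+ n * (w ^+ m)^*) ^+ i).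
  apply: eq_bigr => i _; rewrite normc_sqrE rmorph_sum big_distrl; apply: eq_bigr => n _.
  rewrite big_distrr; apply: eq_bigr => m _; rewrite /d !exprMn !rmorphM !rmorphXn /=.
  by rewrite -!exprM ![(i * _)%N]mulnC; move: (w ^+ _) (w^* ^+ _) (z ^+ n) (_^* ^+ m) (c n) (c m)^* => *; ring.
rewrite exchange_big mulr_sumr; apply: eq_bigr => n _.
rewrite exchange_big /=; under eq_bigr do rewrite -mulr_sumr geo.
rewrite (bigD1 n) //= big1 ?addr0 => [|m mn]; last first.
  by rewrite eq_sym (negPf mn) mul0r mulr0.
rewrite eqxx mul1r -normc_sqrE normcM normcX exprMn mulrC.
by rewrite (rmorph_nat (real_complex R)).
Qed.

(* Cauchy's estimate, from Parseval's identity over roots of unity of increasing order. *)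
Lemma cauchy_estimate C k (c : nat -> R[i]) tau M n : 0 <= k -> geometric_bound C k c ->
  0 <= tau -> k * tau < 1 -> (forall w, normc w = tau -> normc (ev c w) <= M) ->
  normc (c n) * tau ^+ n <= M.
Proof.
move=> k0 hc t0 kt hM; apply/ler_addgt0Pr => e e0.
have M0 : 0 <= M.
  by apply: le_trans (hM tau%:C _); rewrite ?normc_ge0 // normc_real ger0_norm.
have Me : 0 <= M + e by rewrite addr_ge0 // ltW.
have kt01 : 0 <= k * tau < 1 by rewrite mulr_ge0.
have : (fun K => C * ((k * tau) ^+ K / (1 - k * tau))) @ \oo --> (C * (0 / (1 - k * tau)) : R).
  by apply: cvgMr; apply: cvgMl; exact: exprn_cvg0 kt01.
rewrite mul0r mulr0 => /cvgr0_norm_le /(_ _ e0) [K1 _ hK1].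
pose K := (maxn K1 n).+1.
have hK : C * ((k * tau) ^+ K / (1 - k * tau)) <= e.
  by apply: le_trans (ler_norm _) (hK1 K _); rewrite /= leqW // leq_maxl.
have P w : normc w = tau -> normc (\sum_(j < K) c j * w ^+ j) <= M + e.
  move=> nw; have kw : k * normc w < 1 by rewrite nw.
  have -> : \sum_(j < K) c j * w ^+ j = ev c w - (ev c w - \sum_(j < K) c j * w ^+ j).
    by rewrite subKr.
  apply: le_trans (normcD _ _) _; rewrite normcNE lerD ?hM //.
  by apply: le_trans (ev_tail k0 K hc kw) _; rewrite nw.
have K0 : (0 < K)%N by [].
have := parseval c tau%:C K0; rewrite normc_real ger0_norm // => e1.
have : K%:R * \sum_(m < K) normc (c m) ^+ 2 * tau ^+ m ^+ 2 <= K%:R * (M + e) ^+ 2.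
  rewrite -e1 mulr_natl -[X in _ *+ X](card_ord K) -sumr_const; apply: ler_sum => i _.
  rewrite ler_sqr ?nnegrE ?normc_ge0 //; apply: P.
  by rewrite normcM normcX normc_expi expr1n mul1r normc_real ger0_norm.
rewrite ler_pM2l ?ltr0n // => h.
rewrite -ler_sqr ?nnegrE ?mulr_ge0 ?normc_ge0 ?exprn_ge0 //; apply: le_trans h.
have nK : (n < K)%N by rewrite ltnS leq_maxr.
rewrite (bigD1 (Ordinal nK)) //= exprMn lerDl sumr_ge0 // => j _.
by rewrite mulr_ge0 ?sqr_ge0.
Qed.

End RootsOfUnity.

(** * Locally analytic functions on the disc are power series *)

Section Continuation.
Variable R : realType.
Implicit Types (z w : R[i]) (d : nat -> R[i]) (r M : R).
Variable f : R[i] -> R[i].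

(** The radius [r] and the constant [M] are explicit so that compactness can make both uniform in
    [w]. *)
Definition power_rep w r M d :=
  geometric_bound M r^-1 d /\ forall z, normc (z - w) < r -> f z = ev d (z - w).

Lemma geometric_bound_rate c k k' d : 0 <= k -> k <= k' -> geometric_bound c k d ->
  geometric_bound c k' d.
Proof.
move=> k0 kk' hd n; apply: le_trans (hd n) _; rewrite ler_wpM2l ?(geometric_bound_ge0 hd) //.
by rewrite lerXn2r ?nnegrE // (le_trans k0).
Qed.

Lemma power_rep_le w r r' M M' d : 0 < r' -> r' <= r -> M <= M' ->
  power_rep w r M d -> power_rep w r' M' d.
Proof.
move=> r'0 rr MM [hd hf]; have r0 := lt_le_trans r'0 rr.
split=> [n|z zr]; last by apply: hf; exact: lt_le_trans zr rr.
have h : geometric_bound M r'^-1 d.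
  by apply: geometric_bound_rate hd; [rewrite invr_ge0 ltW | rewrite lef_pV2 ?posrE].
by apply: le_trans (h n) _; rewrite ler_wpM2r // exprn_ge0 // invr_ge0 ltW.
Qed.

Lemma power_rep_recenter w w' r M d : normc (w' - w) < r -> power_rep w r M d ->
  power_rep w' (r - normc (w' - w)) (M / (1 - r^-1 * normc (w' - w))) (tcoef (w' - w) d).
Proof.
move=> wr [hd hf]; have r0 : 0 < r := le_lt_trans (normc_ge0 _) wr.
have rV0 : 0 <= r^-1 by rewrite invr_ge0 ltW.
have k1 : r^-1 * normc (w' - w) < 1 by rewrite mulrC ltr_pdivrMr // mul1r.
have rE : r^-1 / (1 - r^-1 * normc (w' - w)) = (r - normc (w' - w))^-1.
  have r1 : r != 0 by rewrite gt_eqF.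
  have r2 : r - normc (w' - w) != 0 by rewrite gt_eqF // subr_gt0.
  by field; rewrite r1 r2.
split; first by rewrite -rE; exact: tcoef_bound.
move=> z zr.
have e : z - w - (w' - w) = z - w' by rewrite opprB addrA subrK.
have [] := @ev_recenter R r^-1 (w' - w) rV0 k1 M d (z - w) hd.
  by rewrite e mulrC ltr_pdivrMr // mulrBl mul1r mulrAC mulVf ?gt_eqF // mul1r.
rewrite e => kz <-; apply: hf.
by move: kz; rewrite mulrC ltr_pdivrMr // mul1r.
Qed.

Lemma ev_eq0 c k d : 0 <= k -> geometric_bound c k d ->
  (\forall i \near \oo, ev d (step R i) = 0) -> forall n, d n = 0.
Proof.
move=> k0; have k00 : k * normc (0 : R[i]) < 1 by rewrite normc0 mulr0.
have s0 : ccvg (step R) 0.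
  by apply: ccvg_eq (step_cvg 0); apply: nearW => i; rewrite add0r.
have head c' d' : geometric_bound c' k d' ->
    (\forall i \near \oo, ev d' (step R i) = 0) -> d' 0%N = 0.
  move=> hd h; rewrite -(ev0 k0 hd).
  apply: ccvg_uniq (ev_continuous k0 hd k00 s0) _; apply: ccvg_eq (ccvg_cst 0).
  by apply: filterS h => i ->.
move=> hd h n; elim: n c d hd h => [|n IH] c' d' hd h; first exact: head hd h.
have hdS : geometric_bound (c' * k) k (fun m => d' m.+1).
  by move=> m; rewrite -mulrA -exprS.
apply: (IH _ _ hdS); near=> i.
have ki : k * normc (step R i) < 1 by near: i; exact: ccvg_near s0 k00.
have : ev d' (step R i) = 0 by near: i.
rewrite (evS k0 hd ki) (head _ _ hd h) add0r => /eqP.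
by rewrite mulf_eq0 (negPf (step_neq0 R i)) => /eqP.
Unshelve. all: by end_near. Qed.

Lemma power_rep_uniq w r1 r2 M1 M2 d1 d2 : 0 < r1 -> 0 < r2 ->
  power_rep w r1 M1 d1 -> power_rep w r2 M2 d2 -> d1 = d2.
Proof.
move=> r10 r20 h1 h2; pose r := Num.min r1 r2.
have r0 : 0 < r by rewrite lt_min r10.
have [hd1 hf1] : power_rep w r M1 d1.
  by apply: power_rep_le h1 => //; rewrite ge_min lexx.
have [hd2 hf2] : power_rep w r M2 d2.
  by apply: power_rep_le h2 => //; rewrite ge_min lexx orbT.
have rV0 : 0 <= r^-1 by rewrite invr_ge0 ltW.
have hN := geometric_boundZ (-1) hd2.
apply/funext => n; apply/eqP; rewrite -subr_eq0 -mulN1r; apply/eqP.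
apply: (ev_eq0 rV0 (geometric_boundD hd1 hN)); near=> i.
have si : 1 * normc (w + step R i - w) < r.
  rewrite stepK normc_step mul1r; near: i.
  exact: (near_infty_natSinv_lt (PosNum r0)).
have rs : r^-1 * normc (step R i) < 1.
  by move: si; rewrite stepK mul1r mulrC ltr_pdivrMr // mul1r.
rewrite (evD rV0 hd1 hN rs) (evZ _ rV0 hd2 rs) mulN1r; apply/eqP; rewrite subr_eq0; apply/eqP.
rewrite mul1r in si; have := hf1 _ si; rewrite (hf2 _ si) stepK => ->; exact: erefl.
Unshelve. all: by end_near. Qed.

Definition locally_analytic := forall w, normc w < 1 -> exists r M d, 0 < r /\ power_rep w r M d.

(** Compactness of the circle, covered by two half circles x + i s sqrt(1 - x^2) over the segment
    [-1, 1], with s = 1 or s = -1. Radius 1 / (n+1) and constant n+1 depend on one index, and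
    recentring by less than r / 2 keeps at least the radius r / 2. *)
Lemma uniform_power_rep rho : locally_analytic -> 0 < rho < 1 ->
  exists e M, 0 < e /\ forall w, normc w = rho -> exists d, power_rep w e M d.
Proof.
move=> hf /andP[rho0 rho1].
pose pt (s : R) x : R[i] := rho%:C * (x +i* (s * Num.sqrt (1 - x ^+ 2))).
have pt_norm s x : s ^+ 2 = 1 -> x \in `[-1, 1]%classic -> normc (pt s x) = rho.
  move=> s2; rewrite inE /= in_itv /= => /andP[x1 x2].
  have xx : 0 <= 1 - x ^+ 2.
    have -> : 1 - x ^+ 2 = (1 - x) * (1 + x) by ring.
    by apply: mulr_ge0; lra.
  rewrite /pt normcM normc_real ger0_norm ?ltW //.
  have h : normc (x +i* (s * Num.sqrt (1 - x ^+ 2))) ^+ 2 = 1.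
    by rewrite normc_sqr /= exprMn s2 mul1r sqr_sqrtr // subrKC.
  have -> : normc (x +i* (s * Num.sqrt (1 - x ^+ 2))) = 1.
    by apply/eqP; rewrite -(@eqrXn2 _ 2) ?normc_ge0 // h expr1n.
  by rewrite mulr1.
pose P n s x := exists d, power_rep (pt s x) n.+1%:R^-1 n.+1%:R d.
have cover s : s ^+ 2 = 1 -> exists N, forall n, (N <= n)%N -> forall x, -1 <= x <= 1 -> P n s x.
  move=> s2; have /compact_near_coveringP := @segment_compact R (-1) 1.
  move=> /(_ _ \oo (fun n x => P n s x) _) [] => [x|N _ hN]; last first.
    by exists N => n Nn x x1; apply: (hN n Nn); rewrite /= in_itv.
  move=> x1; have hx : normc (pt s x) < 1 by rewrite pt_norm // inE.
  have [r [M [d [r0 hd]]]] := hf _ hx.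
  have near_pt : \forall x' \near x, normc (pt s x' - pt s x) < r / 2.
    have sqc : (fun x : R => Num.sqrt (1 - x ^+ 2)) @ x --> Num.sqrt (1 - x ^+ 2).
      apply: continuous_comp; last exact: sqrt_continuous.
      by apply: cvgB; [exact: cvg_cst | exact: exprn_continuous].
    have r4 : 0 < r / 4 by lra.
    have s1 : `|s| = 1 by apply/eqP; rewrite -(@eqrXn2 _ 2) // expr1n -normrX s2 normr1.
    near=> x'.
    have d1 : `|x - x'| < r / 4.
      by near: x'; move: (@cvg_id _ (nbhs x)) => /cvgrPdist_lt; apply.
    have d2 : `|Num.sqrt (1 - x ^+ 2) - Num.sqrt (1 - x' ^+ 2)| < r / 4.
      by near: x'; move: sqc => /cvgrPdist_lt; apply.
    rewrite normcB /pt -mulrBr normcM normc_real (gtr0_norm rho0).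
    apply: le_lt_trans (_ : `|x - x'| + `|Num.sqrt (1 - x ^+ 2) - Num.sqrt (1 - x' ^+ 2)| < _); last by lra.
    rewrite -[leRHS]mul1r ler_pM ?normc_ge0 ?(ltW rho0) ?(ltW rho1) //.
    by apply: le_trans (normc_le _) _; rewrite /= -mulrBr normrM s1 mul1r.
  exists ([set x' | normc (pt s x' - pt s x) < r / 2],
     [set n : nat | n.+1%:R^-1 <= r / 2 /\ M / (1 - r^-1 * (r/2)) <= n.+1%:R]).
    have r2 : 0 < r / 2 by lra.
    split=> //=; near=> n; split.
      by apply: ltW; near: n; exact: (near_infty_natSinv_lt (PosNum r2)).
    apply: (@le_trans _ _ n%:R); last by rewrite ler_nat leqnSn.
    by near: n; exact: nbhs_infty_ger.
  move=> [x' n] /= [h1 [h2 h3]].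
  have rr : r / 2 < r by lra.
  exists (tcoef (pt s x' - pt s x) d).
  apply: power_rep_le (power_rep_recenter (lt_trans h1 rr) hd).
  - by rewrite invr_gt0.
  - by apply: le_trans h2 _; lra.
  - apply: le_trans h3; have M0 := geometric_bound_ge0 hd.1.
    rewrite ler_wpM2l // lef_pV2 ?posrE ?subr_gt0.
    + by rewrite lerD2l lerN2 ler_wpM2l ?invr_ge0 ?ltW.
    + by rewrite mulrC ltr_pdivrMr // mul1r (lt_trans h1).
    + by rewrite mulrC ltr_pdivrMr // mul1r.
have [N1 h1] := cover 1 (expr1n _ _); have [N2 h2] : exists N, forall n, (N <= n)%N -> forall x, -1 <= x <= 1 -> P n (-1) x.
  by apply: cover; rewrite sqrrN expr1n.
exists (maxn N1 N2).+1%:R^-1, (maxn N1 N2).+1%:R; split; first by rewrite invr_gt0.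
move=> w nw; pose x := complex.Re w / rho.
have x1 : -1 <= x <= 1.
  rewrite -ler_norml /x normrM normfV (gtr0_norm rho0) ler_pdivrMr // mul1r -nw.
  exact: normc_Re.
have [s s2 ->] : exists2 s, s = 1 \/ s = -1 & w = pt s x.
  have xy : x ^+ 2 + (complex.Im w / rho) ^+ 2 = 1.
    by rewrite /x !expr_div_n -mulrDl -normc_sqr nw divff // expf_neq0 // gt_eqF.
  have yE : Num.sqrt (1 - x ^+ 2) = `|complex.Im w / rho|.
    by rewrite -sqrtr_sqr -xy addrC addKr.
  exists (if 0 <= complex.Im w / rho then 1 else -1); first by case: ifP; [left|right].
  rewrite /pt yE; have -> : (if 0 <= complex.Im w / rho then 1 else -1) * `|complex.Im w / rho| = complex.Im w / rho.
    by case: ifPn => h; [rewrite mul1r ger0_norm | rewrite mulN1r ltr0_norm ?opprK // ltNge].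
  apply/eqP; rewrite eq_complex /= !mul0r subr0 addr0 /x.
  by rewrite !(mulrC rho) !divfK ?(lt0r_neq0 rho0) // !eqxx.
case: s2 => ->; [apply: h1 => //; exact: leq_maxl | apply: h2 => //; exact: leq_maxr].
Unshelve. all: by end_near. Qed.


Variable a : nat -> R[i].

Definition expands_on rho := (exists C, geometric_bound C rho^-1 a) /\
  forall z, normc z < rho -> f z = ev a z.

Lemma expands_on_le rho rho' : 0 < rho' -> rho' <= rho -> expands_on rho -> expands_on rho'.
Proof.
move=> r0 rr [[C ha] h]; have h0 := lt_le_trans r0 rr.
split; last by move=> z zr; apply: h; exact: lt_le_trans zr rr.
exists C; apply: geometric_bound_rate ha; first by rewrite invr_ge0 ltW.
by rewrite lef_pV2 ?posrE.
Qed.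

(** The local expansions on the circle |w| = rho0 bound the Taylor coefficients of [ev a] at every
    point of the slightly smaller circle |w| = tau. Cauchy's estimate there controls all C(n+j, j)
    a_{n+j}, and summing over n + j = m recovers a bound on a_m at a rate better than 1 / rho0. *)
Lemma expands_on_extend rho0 : locally_analytic -> 0 < rho0 < 1 ->
  (forall rho, 0 < rho < rho0 -> expands_on rho) -> exists2 rho, rho0 < rho & expands_on rho.
Proof.
move=> hf hr hg; have /andP[rho00 rho01] := hr.
have [e0 [M [e00 he]]] := uniform_power_rep hf hr.
(* Discs of radius 4e about the circle rho0, recentred at distance e inside it, keep radius 3e about
   the circle tau = rho0 - e. Using only 2e < 3e of it leaves a ratio 2 / 3 and reaches tau + 2e =
   rho0 + e. *)
pose e := Num.min (e0 / 4) (rho0 / 4).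
have e_gt0 : 0 < e by rewrite lt_min; apply/andP; split; lra.
have ee0 : 4 * e <= e0.
  have : e <= e0 / 4 by rewrite ge_min lexx.
  by lra.
have erho : 4 * e <= rho0.
  have : e <= rho0 / 4 by rewrite ge_min lexx orbT.
  by lra.
pose tau := rho0 - e; pose rho1 := rho0 - e / 2.
have tau0 : 0 < tau by rewrite /tau; lra.
have taurho : tau < rho1 by rewrite /tau /rho1; lra.
have rho10 : 0 < rho1 by exact: lt_trans taurho.
have [[C ga] fa] : expands_on rho1 by apply: hg; rewrite rho10 /rho1; lra.
have k0 : 0 <= rho1^-1 by rewrite invr_ge0 ltW.
have ktau : rho1^-1 * tau < 1 by rewrite mulrC ltr_pdivrMr // mul1r.
pose M' := M / (1 - (4 * e)^-1 * e).
have M'E : M' = M * (4 / 3) by rewrite /M'; field; rewrite gt_eqF //=; lra.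
have rep w' : normc w' = tau -> power_rep w' (3 * e) M' (tcoef w' a).
  move=> nw'; pose w := (rho0 / tau)%:C * w'.
  have nw : normc w = rho0.
    by rewrite /w normcM normc_real nw' ger0_norm ?divr_ge0 ?ltW // divfK // gt_eqF.
  have dw : normc (w' - w) = e.
    rewrite normcB /w -[X in _ - X]mul1r -(rmorph1 (real_complex R)) -mulrBl -rmorphB normcM.
    rewrite normc_real nw' ger0_norm; last by rewrite subr_ge0 ler_pdivlMr // mul1r /tau; lra.
    by rewrite mulrBl divfK ?gt_eqF // mul1r /tau; lra.
  have [d0 hd0] := he _ nw.
  have hd : power_rep w (4 * e) M d0 by apply: power_rep_le hd0 => //; lra.
  have := @power_rep_recenter w w' (4 * e) M d0; rewrite dw => /(_ _ hd).
  have -> : 4 * e - e = 3 * e by ring.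
  move=> /(_ _)/[dup] h1 h2.
  have h3 : power_rep w' (3 * e) M' (tcoef (w' - w) d0) by apply: h1; lra.
  have kw' : rho1^-1 * normc w' < 1 by rewrite nw'.
  (* The expansion at 0 recentred at w' is valid only on a small disc; uniqueness of coefficients
     gives it the better radius and constant. *)
  have h4 : power_rep w' (rho1 - tau) (C / (1 - rho1^-1 * tau)) (tcoef w' a).
    have h0 : power_rep 0 rho1 C a by split=> // z; rewrite subr0; exact: fa.
    by have := @power_rep_recenter 0 w' rho1 C a; rewrite !subr0 nw'; apply.
  rewrite -(power_rep_uniq _ _ h3 h4) //; last by rewrite subr_gt0.
  by rewrite mulr_gt0.
(* As a function of its centre w', the j-th Taylor coefficient is itself the power series
   [dcoef j a], bounded on |w'| = tau by the preceding step. *)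
have cauchy n j : 'C(n + j, j)%:R * normc (a (n + j)%N) * tau ^+ n <= M' * (3 * e)^-1 ^+ j.
  have kt' : rho1^-1 * normc (tau%:C) < 1 by rewrite normc_real ger0_norm // ltW.
  have [k' kk' k't] := larger_rate kt'.
  have hd := dcoef_bound k0 j kk' ga.
  have k'0 : 0 <= k' by rewrite (le_trans k0) // ltW.
  have k't' : k' * tau < 1 by move: k't; rewrite normc_real ger0_norm // ltW.
  have h w : normc w = tau -> normc (ev (dcoef j a) w) <= M' * (3 * e)^-1 ^+ j.
    move=> nw; have kw : rho1^-1 * normc w < 1 by rewrite nw.
    by rewrite -(tcoefE k0 kw j ga); exact: (rep w nw).1.
  have := cauchy_estimate n k'0 hd (ltW tau0) k't' h.
  by rewrite /dcoef normcM -(rmorph_nat (real_complex R)) normc_real ger0_norm.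
pose rho2 := tau + 2 * e.
have rho20 : 0 < rho2 by rewrite /rho2; lra.
(* In the binomial expansion of (tau + 2e)^m the j-th term times |a_m| is at most M' (2/3)^j, and
   these sum to at most 3 M'. *)
have ga2 : geometric_bound (3 * M') rho2^-1 a.
  move=> m; rewrite exprVn ler_pdivlMr ?exprn_gt0 // /rho2 exprDn mulr_sumr.
  have term (j : 'I_m.+1) : normc (a m) * (tau ^+ (m - j) * (2 * e) ^+ j *+ 'C(m, j)) <= M' * (2 / 3) ^+ j.
    have jm : (j <= m)%N by rewrite -ltnS.
    have := cauchy (m - j)%N j; rewrite subnK // => h.
    have e2 : 0 <= (2 * e) ^+ j by rewrite exprn_ge0 // mulr_ge0 // ltW.
    have := ler_wpM2r e2 h; rewrite -[X in _ <= X -> _]mulrA -exprMn.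
    have -> : (3 * e)^-1 * (2 * e) = 2 / 3 by field; rewrite gt_eqF.
    apply: le_trans; rewrite -mulr_natl le_eqVlt; apply/orP; left; apply/eqP; ring.
  apply: le_trans (ler_sum _ (fun j _ => term j)) _.
  have M'0 : 0 <= M'.
    by have := cauchy 0%N 0%N; rewrite !expr0 !mulr1 bin0 mul1r; apply: le_trans (normc_ge0 _).
  rewrite -mulr_sumr mulrC ler_wpM2r // -(big_mkord xpredT (fun j => (2 / 3) ^+ j)).
  have h23 : 0 <= (2 / 3 : R) < 1 by apply/andP; split; lra.
  apply: le_trans (sum_geometric_le 0 m.+1 h23) _; rewrite expr0.
  have -> : 1 - 2 / 3 = 3^-1 :> R by field.
  by rewrite invrK mul1r.
exists rho2; first by rewrite /rho2 /tau; lra.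
split; first by exists (3 * M').
move=> z zr; have [zt|tz] := ltP (normc z) rho1; first exact: fa.
have z0 : 0 < normc z by exact: lt_le_trans tz.
(* The radial projection of [z] to the circle tau: it lies within 2e of [z], so both its local
   expansion and the recentred global one apply. *)
pose w' := (tau / normc z)%:C * z.
have nw' : normc w' = tau.
  by rewrite /w' normcM normc_real ger0_norm ?divr_ge0 ?normc_ge0 ?ltW // divfK // gt_eqF.
have dz : normc (z - w') = normc z - tau.
  rewrite /w' -[X in X - _]mul1r -(rmorph1 (real_complex R)) -mulrBl -rmorphB normcM.
  have tz' : tau <= normc z by exact: ltW (lt_le_trans taurho tz).
  rewrite normc_real ger0_norm; last by rewrite subr_ge0 ler_pdivrMr // mul1r.
  by rewrite mulrBl divfK ?gt_eqF // mul1r.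
have [_ hrep] := rep w' nw'.
have k20 : 0 <= rho2^-1 by rewrite invr_ge0 ltW.
have kw2 : rho2^-1 * normc w' < 1.
  by rewrite nw' mulrC ltr_pdivrMr // mul1r /rho2; lra.
rewrite hrep; last by rewrite dz; move: zr; rewrite /rho2; lra.
have [] := @ev_recenter R rho2^-1 w' k20 kw2 (3 * M') a z ga2.
  by rewrite dz nw' mulrC ltr_pdivrMr // mulrBl mul1r mulrAC mulVf ?gt_eqF // mul1r ltrD2r.
by move=> _ ->; exact: erefl.
Qed.

End Continuation.

(** Were the supremum of the radii in ]0, 1] on which the expansion at 0 is valid below 1,
    [expands_on_extend] would exceed it. *)
Lemma analytic_power_series (R : realType) (f : R[i] -> R[i]) : locally_analytic f ->
  exists a, forall rho, 0 < rho < 1 -> expands_on f a rho.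
Proof.
move=> hf; have n0 : normc (0 : R[i]) < 1 by rewrite normc0.
have [r [M [a [r0 [ha fa]]]]] := hf _ n0; exists a.
pose S := [set rho : R | 0 < rho <= 1 /\ expands_on f a rho].
have [rr hr] : S (Num.min r 1).
  have m0 : 0 < Num.min r 1 by rewrite lt_min r0 ltr01.
  split; first by rewrite m0 ge_min lexx orbT.
  apply: (@expands_on_le _ _ _ r) => //; first by rewrite ge_min lexx.
  split; first by exists M.
  by move=> z zr; rewrite fa subr0.
have hS : has_sup S by split; [exists (Num.min r 1) | exists 1 => x [/andP[_ x1] _]].
have sle rho : 0 < rho < sup S -> expands_on f a rho.
  move=> /andP[rho0 rhoS]; have e0 : 0 < sup S - rho by rewrite subr_gt0.
  have [x [_ gx]] := sup_adherent e0 hS; rewrite subKr => rx.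
  exact: expands_on_le rho0 (ltW rx) gx.
have S0 : 0 < sup S.
  have /andP[m0 _] := rr; apply: lt_le_trans m0 _; apply: ub_le_sup => //; exact: hS.2.
suff S1 : 1 <= sup S by move=> rho /andP[rho0 rho1]; apply: sle; rewrite rho0 (lt_le_trans rho1).
rewrite leNgt; apply/negP => S1.
have hs : 0 < sup S < 1 by rewrite S0.
have [rho rhoS grho] := expands_on_extend hf hs sle.
have : Num.min rho 1 <= sup S.
  have m0 : 0 < Num.min rho 1 by rewrite lt_min ltr01 (lt_trans S0).
  apply: ub_le_sup; first exact: hS.2.
  split; first by rewrite m0 ge_min lexx orbT.
  by apply: expands_on_le grho => //; rewrite ge_min lexx.
by rewrite leNgt lt_min rhoS S1.
Qed.

(** * Area integrals over discs *)

Section PlaneTransforms.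
Variable R : realType.
Local Open Scope ereal_scope.
Local Notation mR := (measurableTypeR R).
Local Notation leb := (@lebesgue_measure R).
Local Notation plane := (measurableTypeR R * measurableTypeR R)%type.
Local Notation leb2 := (leb \x leb).

(** Lebesgue measure and [s] times its image under x -> s x + c agree on intervals, hence
    coincide. *)
Lemma ge0_integral_affine (s c : R) (f : mR -> \bar R) : (0 < s)%R ->
  measurable_fun setT f -> (forall x, 0 <= f x) ->
  \int[leb]_x f (s * x + c)%R = (s^-1)%:E * \int[leb]_x f x.
Proof.
move=> s0 mf f0; pose phi (x : mR) : mR := (s * x + c)%R.
have mphi : measurable_fun setT phi.
  apply: measurable_funD; last exact: measurable_cst.
  by apply: measurable_funM; [exact: measurable_cst | exact: measurable_id].
pose g : {mfun mR >-> mR} := HB.pack phi (isMeasurableFun.Build _ _ _ _ _ mphi).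
pose sn : {nonneg R} := NngNum (ltW s0).
have key A : measurable A -> leb A = mscale sn (pushforward leb g) A.
  apply: lebesgue_measure_unique => _ [[a b]] _ <-.
  transitivity (s%:E * leb (phi @^-1` `]a, b]%classic)); last exact: erefl.
  have -> : phi @^-1` `]a, b]%classic = `](s^-1 * (a - c))%R, (s^-1 * (b - c))%R]%classic.
    apply/seteqP; split => x /=; rewrite !in_itv /= !(mulrC s^-1%R) ltr_pdivrMr // ler_pdivlMr //.
      by rewrite /phi ltrBlDr lerBrDr !(mulrC x).
    by rewrite /phi ltrBlDr lerBrDr !(mulrC x).
  rewrite !lebesgue_measure_itv /= !lte_fin ltr_pM2l ?invr_gt0 // ltrD2r.
  case: ifP => _; last by rewrite mule0.
  by rewrite -EFinM; congr EFin; field; rewrite gt_eqF.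
have -> : \int[leb]_x f x = s%:E * \int[leb]_x f (phi x).
  rewrite (eq_measure_integral (mscale sn (pushforward leb g))) => [|A mA _]; last exact: key.
  rewrite ge0_integral_mscale //; congr (_ * _).
  by rewrite (ge0_integral_pushforward (measurable_funP g)).
by rewrite muleA -EFinM mulVf ?gt_eqF // mul1e.
Qed.

(** By Tonelli the inner integral sees only a translation, by an amount depending on the other
    variable. *)
Lemma shear_x (t : R) (F : plane -> \bar R) : measurable_fun setT F -> (forall p, 0 <= F p) ->
  \int[leb2]_p F ((p.1 + t * p.2)%R, p.2) = \int[leb2]_p F p.
Proof.
move=> mF F0.
have mG : measurable_fun setT (fun p : plane => F ((p.1 + t * p.2)%R, p.2)).
  apply: (measurableT_comp mF); apply: measurable_fun_pair; last exact: measurable_snd.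
  apply: measurable_funD; first exact: measurable_fst.
  by apply: measurable_funM; [exact: measurable_cst | exact: measurable_snd].
rewrite (fubini_tonelli2 _ mG (fun p => F0 _)) (fubini_tonelli2 _ mF F0).
apply: eq_integral => y _; rewrite /fubini_G /=.
have mFy : measurable_fun setT (fun x : mR => F (x, y)) by exact: measurable_fun_pair1.
have := @ge0_integral_affine 1 (t * y) _ ltr01 mFy (fun x => F0 _).
by rewrite invr1 mul1e => <-; apply: eq_integral => x _; rewrite mul1r.
Qed.

Lemma shear_y (t : R) (F : plane -> \bar R) : measurable_fun setT F -> (forall p, 0 <= F p) ->
  \int[leb2]_p F (p.1, (p.2 + t * p.1)%R) = \int[leb2]_p F p.
Proof.
move=> mF F0.
have mG : measurable_fun setT (fun p : plane => F (p.1, (p.2 + t * p.1)%R)).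
  apply: (measurableT_comp mF); apply: measurable_fun_pair; first exact: measurable_fst.
  apply: measurable_funD; first exact: measurable_snd.
  by apply: measurable_funM; [exact: measurable_cst | exact: measurable_fst].
rewrite (fubini_tonelli1 _ mG (fun p => F0 _)) (fubini_tonelli1 _ mF F0).
apply: eq_integral => x _; rewrite /fubini_F /=.
have mFx : measurable_fun setT (fun y : mR => F (x, y)) by exact: measurable_fun_pair2.
have := @ge0_integral_affine 1 (t * x) _ ltr01 mFx (fun y => F0 _).
by rewrite invr1 mul1e => <-; apply: eq_integral => y _; rewrite mul1r.
Qed.

Lemma scaling_plane (s : R) (F : plane -> \bar R) : (0 < s)%R -> measurable_fun setT F ->
  (forall p, 0 <= F p) ->
  \int[leb2]_p F ((s * p.1)%R, (s * p.2)%R) = (s ^- 2)%:E * \int[leb2]_p F p.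
Proof.
move=> s0 mF F0.
have mG : measurable_fun setT (fun p : plane => F ((s * p.1)%R, (s * p.2)%R)).
  apply: (measurableT_comp mF); apply: measurable_fun_pair;
    by apply: measurable_funM; [exact: measurable_cst | exact: measurable_fst || exact: measurable_snd].
rewrite (fubini_tonelli1 _ mG (fun p => F0 _)) (fubini_tonelli1 _ mF F0).
have mS : measurable_fun setT (fun x : mR => \int[leb]_y F (x, y)).
  exact: (measurable_fun_fubini_tonelli_F F mF).
have S0 x : 0 <= \int[leb]_y F (x, y) by apply: integral_ge0 => y _.
transitivity (\int[leb]_x ((s^-1)%:E * \int[leb]_y F ((s * x)%R, y))).
  apply: eq_integral => x _; rewrite /fubini_F /=.
  have mFx : measurable_fun setT (fun y : mR => F ((s * x)%R, y)) by exact: measurable_fun_pair2.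
  have := @ge0_integral_affine s 0 _ s0 mFx (fun y => F0 _).
  by move=> <-; apply: eq_integral => y _; rewrite addr0.
have ms : measurable_fun setT (fun x : mR => (s * x)%R : mR).
  by apply: measurable_funM; [exact: measurable_cst | exact: measurable_id].
have mSs : measurable_fun setT (fun x : mR => \int[leb]_y F ((s * x)%R, y)).
  exact: (measurableT_comp mS ms).
have sV0 : 0 <= (s^-1)%:E by rewrite lee_fin invr_ge0 ltW.
rewrite (@ge0_integralZl _ _ _ leb setT measurableT _ mSs _ (fun x _ => S0 _) sV0).
have := @ge0_integral_affine s 0 _ s0 mS S0.
move=> e; rewrite expr2 invfM EFinM -muleA -[in RHS]e; congr (_ * _).
by apply: eq_integral => x _; rewrite addr0.
Qed.

(* A rotation is a product of three shears. *)
Lemma rotation_plane (c s : R) (F : plane -> \bar R) : (c ^+ 2 + s ^+ 2 = 1)%R -> s != 0%R ->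
  measurable_fun setT F -> (forall p, 0 <= F p) ->
  \int[leb2]_p F ((c * p.1 - s * p.2)%R, (s * p.1 + c * p.2)%R) = \int[leb2]_p F p.
Proof.
(* For the rotation by theta, t = - tan (theta / 2): shear by t, then by sin theta in the other
   direction, then by t again. *)
move=> cs s0 mF F0; pose t := ((c - 1) / s)%R.
have mshx (u : R) (G : plane -> \bar R) : measurable_fun setT G ->
    measurable_fun setT (fun p : plane => G ((p.1 + u * p.2)%R, p.2)).
  move=> mG; apply: (measurableT_comp mG); apply: measurable_fun_pair; last exact: measurable_snd.
  apply: measurable_funD; first exact: measurable_fst.
  by apply: measurable_funM; [exact: measurable_cst | exact: measurable_snd].
have mshy (u : R) (G : plane -> \bar R) : measurable_fun setT G ->
    measurable_fun setT (fun p : plane => G (p.1, (p.2 + u * p.1)%R)).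
  move=> mG; apply: (measurableT_comp mG); apply: measurable_fun_pair; first exact: measurable_fst.
  apply: measurable_funD; first exact: measurable_snd.
  by apply: measurable_funM; [exact: measurable_cst | exact: measurable_fst].
rewrite -[RHS](shear_x t mF F0).
rewrite -[RHS](shear_y s (mshx t _ mF)) //=.
rewrite -[RHS](shear_x t (mshy s _ (mshx t _ mF))) //=.
apply: eq_integral => -[x y] _ /=; congr (F (_, _)); rewrite /t.
  have -> : (x + (c - 1) / s * y + (c - 1) / s * (y + s * (x + (c - 1) / s * y)) =
    c * x + (c ^+ 2 - 1) / s * y)%R by field.
  have -> : (c ^+ 2 - 1 = - s ^+ 2)%R by rewrite -cs; ring.
  by field.
by field.
Qed.

End PlaneTransforms.

(** * Square integrals of polynomials over discs *)

Section DiscIntegrals.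
Variable R : realType.
Local Notation leb := (@lebesgue_measure R).
Local Notation plane := (measurableTypeR R * measurableTypeR R)%type.
Local Notation leb2 := (leb \x leb)%E.
Implicit Types (c : nat -> R[i]) (K n : nat) (rho : R).

Definition toC (p : plane) : R[i] := p.1 +i* p.2.

Definition measurable_cplx (g : plane -> R[i]) :=
  measurable_fun setT (fun p => complex.Re (g p) : R) /\
  measurable_fun setT (fun p => complex.Im (g p) : R).

Lemma measurable_toC : measurable_cplx toC.
Proof. by split; [exact: measurable_fst | exact: measurable_snd]. Qed.

Lemma measurable_cplx_cst z : measurable_cplx (fun=> z).
Proof. by split; exact: measurable_cst. Qed.

Lemma measurable_cplxD g h : measurable_cplx g -> measurable_cplx h ->
  measurable_cplx (fun p => g p + h p).
Proof.
move=> [g1 g2] [h1 h2]; split.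
  rewrite (_ : (fun p => complex.Re (g p + h p)) = (fun p => complex.Re (g p) + complex.Re (h p))).
    exact: measurable_funD.
  by apply/funext => p; case: (g p) (h p) => ? ? [].
rewrite (_ : (fun p => complex.Im (g p + h p)) = (fun p => complex.Im (g p) + complex.Im (h p))).
  exact: measurable_funD.
by apply/funext => p; case: (g p) (h p) => ? ? [].
Qed.

Lemma measurable_cplxM g h : measurable_cplx g -> measurable_cplx h ->
  measurable_cplx (fun p => g p * h p).
Proof.
move=> [g1 g2] [h1 h2]; split.
  rewrite (_ : (fun p => complex.Re (g p * h p)) =
      (fun p => complex.Re (g p) * complex.Re (h p) - complex.Im (g p) * complex.Im (h p))).
    by apply: measurable_funB; exact: measurable_funM.
  by apply/funext => p; case: (g p) (h p) => ? ? [].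
rewrite (_ : (fun p => complex.Im (g p * h p)) =
    (fun p => complex.Re (g p) * complex.Im (h p) + complex.Im (g p) * complex.Re (h p))).
  by apply: measurable_funD; exact: measurable_funM.
by apply/funext => p; case: (g p) (h p) => ? ? [].
Qed.

Definition cpoly c K z := \sum_(n < K) c n * z ^+ n.

Lemma measurable_cplxX g n : measurable_cplx g -> measurable_cplx (fun p => g p ^+ n).
Proof.
move=> hg; elim: n => [|n IH]; first by under eq_fun do rewrite expr0; exact: measurable_cplx_cst.
by under eq_fun do rewrite exprS; exact: measurable_cplxM.
Qed.

Lemma measurable_cpoly c K : measurable_cplx (fun p => cpoly c K (toC p)).
Proof.
rewrite /cpoly; elim: K => [|K IH].
  by under eq_fun do rewrite big_ord0; exact: measurable_cplx_cst.
under eq_fun do rewrite big_ord_recr; apply: measurable_cplxD => //.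
apply: measurable_cplxM; first exact: measurable_cplx_cst.
exact: measurable_cplxX measurable_toC.
Qed.

Lemma measurable_normc_sqr g : measurable_cplx g ->
  measurable_fun setT (fun p => normc (g p) ^+ 2 : R).
Proof.
move=> [h1 h2]; under eq_fun do rewrite normc_sqr.
by apply: measurable_funD; exact: measurable_funX.
Qed.

Definition disc rho : set plane := [set p | normc (toC p) < rho].

Lemma measurable_disc rho : measurable (disc rho).
Proof.
have [r0|r0] := leP rho 0.
  rewrite (_ : disc rho = set0) //; apply/seteqP; split => p //=.
  by move=> /lt_le_trans /(_ r0); rewrite ltNge normc_ge0.
rewrite (_ : disc rho = setT `&` (fun p => normc (toC p) ^+ 2) @^-1` `]-oo, rho ^+ 2[%classic).
  apply: (measurable_normc_sqr measurable_toC) => //; exact: measurable_itv.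
apply/seteqP; split => p /=; rewrite in_itv /= /disc /=.
  by move=> h; split=> //; rewrite ltr_sqr ?nnegrE ?normc_ge0 ?ltW.
by move=> [_]; rewrite ltr_sqr ?nnegrE ?normc_ge0 ?ltW.
Qed.

Definition sq_integral rho (G : R[i] -> R) : \bar R := (\int[leb2]_(p in disc rho) (G (toC p))%:E)%E.

Lemma measurable_sq_disc rho g : measurable_cplx g ->
  measurable_fun (disc rho) (fun p => (normc (g p) ^+ 2)%:E).
Proof.
by move=> hg; apply/measurable_EFinP; apply: measurable_funTS; exact: measurable_normc_sqr.
Qed.

Lemma sq_integral_rot rho (e : R[i]) c K : normc e = 1 -> complex.Im e != 0 ->
  sq_integral rho (fun z => normc (cpoly (fun n => c n * e ^+ n) K z) ^+ 2) =
  sq_integral rho (fun z => normc (cpoly c K z) ^+ 2).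
Proof.
move=> e1 e2; rewrite /sq_integral.
pose F := (fun p : plane => (normc (cpoly c K (toC p)) ^+ 2)%:E) \_ (disc rho).
have mF : measurable_fun setT F.
  apply: (measurable_restrictT _ (measurable_disc rho)).1.
  exact: measurable_sq_disc (measurable_cpoly c K).
have F0 p : (0 <= F p)%E by rewrite /F patchE; case: ifP => // _; rewrite lee_fin sqr_ge0.
have ee : complex.Re e ^+ 2 + complex.Im e ^+ 2 = 1 by rewrite -normc_sqr e1 expr1n.
rewrite integral_mkcond [RHS]integral_mkcond -/F -(rotation_plane ee e2 mF F0).
apply: eq_integral => p _; rewrite /F !patchE.
have rotE : toC (complex.Re e * p.1 - complex.Im e * p.2, complex.Im e * p.1 + complex.Re e * p.2) = e * toC p.
  by rewrite /toC /=; case: (e) => x y; apply/eqP; rewrite eq_complex /= eqxx /= addrC.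
have -> : ((complex.Re e * p.1 - complex.Im e * p.2, complex.Im e * p.1 + complex.Re e * p.2) \in disc rho) =
    (p \in disc rho).
  by apply/idP/idP; rewrite !inE /disc /= rotE normcM e1 mul1r.
case: (p \in disc rho); last exact: erefl.
rewrite rotE /cpoly.
by congr (normc _ ^+ 2)%:E; apply: eq_bigr => n _; rewrite exprMn mulrA.
Qed.

Definition monomial_integral rho n : \bar R := sq_integral rho (fun z => (normc z ^+ n) ^+ 2).

Lemma measurable_monomial rho n :
  measurable_fun (disc rho) (fun p => ((normc (toC p) ^+ n) ^+ 2)%:E).
Proof.
under eq_fun do rewrite -normcX.
exact: measurable_sq_disc (measurable_cplxX n measurable_toC).
Qed.

Lemma sume_cst_ord K (x : \bar R) : (K%:R%:E * x = \sum_(i < K) x)%E.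
Proof.
elim: K => [|K IH]; first by rewrite big_ord0 mul0e.
by rewrite big_ord_recr /= -IH -natr1 EFinD ge0_muleDl ?lee_fin // mul1e.
Qed.

(** The average is over the K rotations by powers of [root1 R K], and [parseval] cancels the cross
    terms pointwise. The condition 2 < K makes this root non-real, as the decomposition into shears
    requires. *)
Lemma sq_integral_cpoly rho c K : (2 < K)%N ->
  sq_integral rho (fun z => normc (cpoly c K z) ^+ 2) =
  (\sum_(n < K) (normc (c n) ^+ 2)%:E * monomial_integral rho n)%E.
Proof.
move=> K2; have K0 : (0 < K)%N by exact: leq_trans K2.
have e2 : complex.Im (root1 R K) != 0.
  have K0' : 0 < K%:R :> R by rewrite ltr0n.
  have pi2 : 0 < pi *+ 2 :> R by rewrite mulr2n addr_gt0 ?pi_gt0.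
  rewrite /= gt_eqF // sin_gt0_pi // (divr_gt0 pi2 K0') /=.
  by rewrite ltr_pdivrMr // -(mulr_natr pi 2) ltr_pM2l ?pi_gt0 // ltr_nat.
have e1 := normc_expi (pi *+ 2 / K%:R : R).
set w := root1 R K in e1 e2 *.
pose ci i n := c n * (w ^+ i) ^+ n.
(* Rotation by the i-th power is done as i rotations by the root, because a power may be real. *)
have rot i : sq_integral rho (fun z => normc (cpoly (ci i) K z) ^+ 2) =
    sq_integral rho (fun z => normc (cpoly c K z) ^+ 2).
  elim: i => [|i IH].
    apply: eq_integral => p _; congr (normc _ ^+ 2)%:E; apply: eq_bigr => n _.
    by rewrite /ci expr0 expr1n mulr1.
  rewrite -IH -(sq_integral_rot rho (ci i) K e1 e2).
  apply: eq_integral => p _; congr (normc _ ^+ 2)%:E; apply: eq_bigr => n _.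
  by rewrite /ci exprSr exprMn mulrA.
have mK c' : measurable_fun (disc rho) (fun p => (normc (cpoly c' K (toC p)) ^+ 2)%:E).
  exact: measurable_sq_disc (measurable_cpoly c' K).
have h : (K%:R%:E * sq_integral rho (fun z => normc (cpoly c K z) ^+ 2)%R =
    K%:R%:E * \sum_(n < K) (normc (c n) ^+ 2)%R%:E * monomial_integral rho n)%E.
  transitivity (\sum_(i < K) sq_integral rho (fun z => normc (cpoly (ci i) K z) ^+ 2)%R)%E.
    under eq_bigr do rewrite rot.
    exact: sume_cst_ord.
  rewrite /sq_integral -ge0_integral_sum; [|exact: measurable_disc | by move=> i; exact: (mK (ci i)) |
    by move=> i p _; rewrite lee_fin sqr_ge0].
  transitivity (\int[leb2]_(p in disc rho) (K%:R%:E * \sum_(n < K) (normc (c n) ^+ 2)%R%:E * ((normc (toC p) ^+ n) ^+ 2)%R%:E))%E.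
    apply: eq_integral => p _; rewrite sumEFin.
    under [in RHS]eq_bigr do rewrite -EFinM.
    rewrite sumEFin -EFinM -(parseval c (toC p) K0); congr EFin; apply: eq_bigr => i _.
    by congr (normc _ ^+ 2); apply: eq_bigr => n _; rewrite /ci exprMn mulrA.
  have mm n : measurable_fun (disc rho) (fun p => ((normc (c n) ^+ 2)%R%:E * ((normc (toC p) ^+ n) ^+ 2)%R%:E)%E).
    by apply: measurable_funeM; exact: measurable_monomial.
  have p0 n p : (0 <= (normc (c n) ^+ 2)%R%:E * ((normc (toC p) ^+ n) ^+ 2)%R%:E)%E.
    by rewrite mule_ge0 // lee_fin sqr_ge0.
  rewrite ge0_integralZl; [|exact: measurable_disc | by apply: emeasurable_sum => n; exact: mm |
    by move=> p _; apply: sume_ge0 => n _; exact: p0 | by rewrite lee_fin].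
  congr (_ * _)%E; rewrite ge0_integral_sum; [|exact: measurable_disc | exact: mm |
    by move=> n p _; exact: p0].
  apply: eq_bigr => n _; rewrite ge0_integralZl; [exact: erefl|exact: measurable_disc |
    exact: measurable_monomial | by move=> p _; rewrite lee_fin sqr_ge0 |
    by rewrite lee_fin sqr_ge0].
have K1 : (K%:R^-1%:E * K%:R%:E = 1 :> \bar R)%E.
  by rewrite -EFinM mulVf // pnatr_eq0 -lt0n.
by rewrite -[LHS]mul1e -K1 -muleA h muleA K1 mul1e.
Qed.

End DiscIntegrals.

(** * Integrals of monomials *)

Section MonomialIntegrals.
Variable R : realType.
Local Notation leb := (@lebesgue_measure R).
Local Notation plane := (measurableTypeR R * measurableTypeR R)%type.
Local Notation leb2 := (leb \x leb)%E.
Local Notation disc := (@disc R).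
Local Notation J := (@monomial_integral R).

Lemma monomial_ge0 rho n : (0 <= J rho n)%E.
Proof. by apply: integral_ge0 => p _; rewrite lee_fin sqr_ge0. Qed.

Lemma monomial0 rho : J rho 0 = leb2 (disc rho).
Proof.
rewrite /monomial_integral /sq_integral.
under eq_integral do rewrite expr0 expr1n.
by rewrite integral_cst ?mul1e //; exact: measurable_disc.
Qed.

Lemma disc1_lty : (leb2 (disc 1) < +oo)%E.
Proof.
have sub : disc 1 `<=` `[-1, 1]%classic `*` `[-1, 1]%classic.
  move=> [x y] h /=; rewrite !in_itv /= -!ler_norml; move: h; rewrite /disc /= => h.
  by split; apply: ltW; apply: le_lt_trans h; [exact: (normc_Re (x +i* y)) | exact: (normc_Im (x +i* y))].
apply: le_lt_trans (le_measure _ _ _ sub) _; rewrite ?inE.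
- exact: measurable_disc.
- by apply: measurableX; exact: measurable_itv.
have h : leb2 (`[-1, 1]%classic `*` `[-1, 1]%classic) = (leb `[(-1)%R, 1%R] * leb `[(-1)%R, 1%R])%E.
  by apply: product_measure1E; exact: measurable_itv.
suff : (leb `[(-1)%R, 1%R] * leb `[(-1)%R, 1%R] < +oo)%E by rewrite -h; exact.
by rewrite !lebesgue_measure_itv /= lte_fin gtrN // -!EFinD -EFinM ltry.
Qed.

Lemma disc1_gt0 : (0 < leb2 (disc 1))%E.
Proof.
have sub : `]0, 2^-1[%classic `*` `]0, 2^-1[%classic `<=` disc 1.
  move=> [x y] /=; rewrite !in_itv /= => -[/andP[x0 x1] /andP[y0 y1]].
  rewrite /disc /=; apply: le_lt_trans (normc_le _) _ => /=.
  by rewrite !gtr0_norm //; lra.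
have h : leb2 (`]0, 2^-1[%classic `*` `]0, 2^-1[%classic) = (leb `]0%R, 2^-1%R[ * leb `]0%R, 2^-1%R[)%E.
  by apply: product_measure1E; exact: measurable_itv.
have pos : (0 < leb `]0%R, 2^-1%R[ * leb `]0%R, 2^-1%R[)%E.
  by rewrite !lebesgue_measure_itv /= lte_fin invr_gt0 ltr0n /= -!EFinD -EFinM lte_fin mulr_gt0 // subr0 invr_gt0.
rewrite -h in pos; have mI : measurable (`]0, 2^-1[%classic `*` `]0, 2^-1[%classic : set plane).
  by apply: measurableX; exact: measurable_itv.
apply: lt_le_trans pos _.
exact: (@le_measure _ _ _ leb2 _ _ (mem_set mI) (mem_set (measurable_disc 1)) sub).
Qed.

Lemma monomial_le rho n : rho <= 1 -> (J rho n <= J rho 0)%E.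
Proof.
move=> r1; apply: ge0_le_integral.
- exact: measurable_disc.
- by move=> p _; rewrite lee_fin sqr_ge0.
- exact: measurable_monomial.
- exact: measurable_monomial.
move=> p hp; rewrite lee_fin -!exprM expr0 exprn_ile1 ?normc_ge0 //.
by rewrite ltW // (lt_le_trans hp).
Qed.

Lemma monomial_scale rho n : 0 < rho -> J rho n = (((rho ^+ 2) ^+ n.+1)%:E * J 1 n)%E.
Proof.
move=> r0; rewrite /monomial_integral /sq_integral integral_mkcond [in RHS]integral_mkcond.
pose F := (fun p : plane => ((normc (toC p) ^+ n) ^+ 2)%:E) \_ (disc 1).
pose G := (fun p : plane => ((normc (toC p) ^+ n) ^+ 2)%:E) \_ (disc rho).
have mG : measurable_fun setT G.
  by apply: (measurable_restrictT _ (measurable_disc rho)).1; exact: measurable_monomial.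
have G0 p : (0 <= G p)%E by rewrite /G patchE; case: (p \in disc rho); rewrite // lee_fin sqr_ge0.
have mF : measurable_fun setT F.
  by apply: (measurable_restrictT _ (measurable_disc 1)).1; exact: measurable_monomial.
have F0 p : (0 <= F p)%E by rewrite /F patchE; case: (p \in disc 1); rewrite // lee_fin sqr_ge0.
have r20 : (0 <= ((rho ^+ n) ^+ 2)%:E)%E by rewrite lee_fin sqr_ge0.
have e := scaling_plane r0 mG G0.
have e2 : (\int[leb2]_p G ((rho * p.1)%R, (rho * p.2)%R) = (((rho ^+ n) ^+ 2)%R%:E * \int[leb2]_p F p))%E.
  rewrite -(@ge0_integralZl _ _ _ leb2 setT measurableT _ mF _ (fun p _ => F0 p) r20).
  apply: eq_integral => p _; rewrite /F /G !patchE.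
  have tE : toC (rho * p.1, rho * p.2) = rho%:C * toC p.
    by apply/eqP; rewrite eq_complex /= !mul0r subr0 addr0 !eqxx.
  have nE : normc (toC (rho * p.1, rho * p.2)) = rho * normc (toC p).
    by rewrite tE normcM normc_real gtr0_norm.
  have -> : ((rho * p.1, rho * p.2) \in disc rho) = (p \in disc 1).
    by apply/idP/idP; rewrite !inE /disc /= nE gtr_pMr.
  case: (p \in disc 1); last by rewrite mule0.
  by rewrite nE -EFinM !exprMn.
rewrite e2 in e; rewrite -/G -/F.
have r2 : ((rho ^+ 2)%:E * (rho ^- 2)%:E = 1 :> \bar R)%E.
  by rewrite -EFinM mulfV // expf_neq0 // gt_eqF.
rewrite -[LHS]mul1e -r2 -muleA -e muleA -EFinM; congr (_%:E * _)%E.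
by rewrite [RHS]exprS -!exprM (mulnC n).
Qed.

(** The exact value is pi / (n + 1); below it is compared with 1 / (n + 1) by scaling and
    monotonicity. *)
Definition jmono n : R := fine (J 1 n).

Lemma jmonoE n : J 1 n = (jmono n)%:E.
Proof.
rewrite /jmono fineK // ge0_fin_numE ?monomial_ge0 //.
by apply: le_lt_trans (monomial_le n (lexx 1)) _; rewrite monomial0 disc1_lty.
Qed.

Lemma jmono0_gt0 : 0 < jmono 0.
Proof. by rewrite -lte_fin -jmonoE monomial0 disc1_gt0. Qed.

Lemma monomialE rho n : 0 < rho -> J rho n = ((rho ^+ 2) ^+ n.+1 * jmono n)%:E.
Proof. by move=> r0; rewrite monomial_scale // jmonoE EFinM. Qed.

Lemma jmono_ge0 n : 0 <= jmono n.
Proof. by rewrite -lee_fin -jmonoE monomial_ge0. Qed.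

(** With q = rho^2, scaling shows that the annulus rho <= |z| < 1 contributes 1 - q^(n+1) times the
    whole integral, and on it |z|^(2n) lies between q^n and 1. *)
Lemma jmono_annulus rho n : 0 < rho < 1 ->
  (rho ^+ 2) ^+ n * ((1 - rho ^+ 2) * jmono 0) <= (1 - (rho ^+ 2) ^+ n.+1) * jmono n <=
    (1 - rho ^+ 2) * jmono 0.
Proof.
move=> /andP[r0 r1]; pose Q := disc 1 `\` disc rho.
have mQ : measurable Q by apply: measurableD; exact: measurable_disc.
have QU : disc 1 = disc rho `|` Q.
  rewrite /Q setDUK // => p; rewrite /disc /= => /lt_trans; exact.
have dQ : [disjoint disc rho & Q] by apply/disj_setPS => p [hp [_ h]]; exact: h hp.
pose g m (p : plane) := ((normc (toC p) ^+ m) ^+ 2)%:E.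
have g0 m p : (0 <= g m p)%E by rewrite lee_fin sqr_ge0.
have split m : J 1 m = (J rho m + \int[leb2]_(p in Q) g m p)%E.
  rewrite /monomial_integral /sq_integral [in LHS]QU ge0_integral_setU; [exact: erefl |
    exact: measurable_disc | exact: mQ | by rewrite -QU; exact: measurable_monomial |
    by move=> p _; exact: (g0 m) | exact: dQ].
have mg m : measurable_fun Q (g m).
  by apply: (measurable_funS (measurable_disc 1)) (@measurable_monomial R 1 m) => p [].
have QE m : (\int[leb2]_(p in Q) g m p)%E = ((1 - (rho ^+ 2) ^+ m.+1) * jmono m)%:E.
  have := split m; rewrite jmonoE (monomialE _ r0) => h.
  have Qf : (\int[leb2]_(p in Q) g m p)%E \is a fin_num.
    rewrite ge0_fin_numE ?integral_ge0 //.
    apply: (@le_lt_trans _ _ (jmono m)%:E); last exact: ltry.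
    by rewrite h leeDr // lee_fin -lee_fin -monomialE // monomial_ge0.
  rewrite -(fineK Qf) in h *; congr EFin; case: h => h.
  by apply/eqP; rewrite mulrBl mul1r eq_sym subr_eq addrC; apply/eqP.
have q0 : 0 <= (rho ^+ 2) ^+ n by rewrite exprn_ge0 // sqr_ge0.
have Q0 := QE 0; rewrite expr1 in Q0.
rewrite -!lee_fin EFinM -Q0 -QE; apply/andP; split.
  rewrite -ge0_integralZl //; apply: ge0_le_integral => //.
  - by move=> p _; rewrite mule_ge0 // lee_fin.
  - by apply: measurable_funeM; exact: mg.
  move=> p [_ hp]; rewrite /g -EFinM lee_fin expr0 expr1n mulr1 -!exprM mulnC.
  by rewrite lerXn2r ?nnegrE ?normc_ge0 ?(ltW r0) // leNgt; apply/negP.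
apply: ge0_le_integral => // p [hp _]; rewrite /g lee_fin -!exprM expr0.
by rewrite exprn_ile1 ?normc_ge0 // ltW.
Qed.

Lemma bernoulli_inequality (x : R) n : 0 <= x <= 1 -> 1 - n%:R * x <= (1 - x) ^+ n.
Proof.
move=> /andP[x0 x1]; elim: n => [|n IH]; first by rewrite mul0r subr0 expr0.
have x1' : 0 <= 1 - x by rewrite subr_ge0.
rewrite exprSr; apply: le_trans (ler_wpM2r x1' IH).
rewrite -natr1; have := mulr_ge0 (ler0n R n) (sqr_ge0 x); move: (n%:R : R) => m; lra.
Qed.

Lemma jmono_bounds n : jmono 0 <= 2 * (n.+1%:R * jmono n) /\ n.+1%:R * jmono n <= 2 * jmono 0.
Proof.
(* With q = 1 - 1 / (2 (n+1)), Bernoulli's inequality gives q^n >= 1/2. The sum of q^i over i <= n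
   then lies between (n+1) / 2 and n+1. *)
pose x : R := (2 * n.+1%:R)^-1; pose q := 1 - x.
have n1 : 1 <= n.+1%:R :> R by rewrite ler1n.
have x0 : 0 < x by rewrite invr_gt0 mulr_gt0.
have x2 : x <= 2^-1 by rewrite lef_pV2 ?posrE ?mulr_gt0 // ler_peMr.
have q01 : 0 < q < 1 by rewrite /q; apply/andP; split; lra.
have /andP[q0 q1] := q01.
have qn : 2^-1 <= q ^+ n.
  apply: le_trans (bernoulli_inequality n _); last by apply/andP; split; lra.
  suff : n%:R * x <= 2^-1 by lra.
  rewrite /x ler_pdivrMr ?mulr_gt0 // mulrA mulVf ?pnatr_eq0 // mul1r ler_nat //.
pose rho := Num.sqrt q.
have rq : rho ^+ 2 = q by rewrite sqr_sqrtr // ltW.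
have r01 : 0 < rho < 1.
  by rewrite sqrtr_gt0 q0 /= -(@ltr_pXn2r _ 2) ?nnegrE ?sqrtr_ge0 // rq expr1n.
have := jmono_annulus n r01; rewrite rq.
have -> : 1 - q ^+ n.+1 = (1 - q) * \sum_(i < n.+1) q ^+ i.
  by rewrite -opprB subrX1 -mulNr opprB.
have q1' : 0 < 1 - q by lra.
rewrite mulrCA -mulrA !ler_pM2l // => /andP[h1 h2].
set S := \sum_(i < n.+1) q ^+ i in h1 h2.
have S1 : S <= n.+1%:R.
  rewrite -[n.+1]card_ord -sum1_card natr_sum; apply: ler_sum => i _.
  by rewrite exprn_ile1 // ltW.
have S2 : n.+1%:R <= 2 * S.
  rewrite -[n.+1]card_ord -sum1_card natr_sum mulr_sumr; apply: ler_sum => i _.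
  have h : q ^+ n <= q ^+ i by rewrite ler_wiXn2l ?ltW // -ltnS.
  lra.
have j0 := jmono_ge0 n.
have a0 := jmono0_gt0.
split.
  have : S * jmono n <= n.+1%:R * jmono n by rewrite ler_wpM2r.
  have : 2^-1 * jmono 0 <= q ^+ n * jmono 0 by rewrite ler_wpM2r // ltW.
  lra.
have : n.+1%:R * jmono n <= 2 * S * jmono n by rewrite ler_wpM2r.
rewrite -mulrA; lra.
Qed.

End MonomialIntegrals.

(** * Square integrals compared with coefficient sums *)

Section SquareIntegrals.
Variable R : realType.
Local Notation leb := (@lebesgue_measure R).
Local Notation plane := (measurableTypeR R * measurableTypeR R)%type.
Local Notation leb2 := (leb \x leb)%E.
Variable c : nat -> R[i].
Hypothesis hc : forall rho, 0 < rho < 1 -> exists C, geometric_bound C rho^-1 c.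

Let between (x : R) : 0 <= x < 1 -> exists2 rho, 0 < rho < 1 & rho^-1 * x < 1.
Proof.
move=> /andP[x0 x1]; exists ((1 + x) / 2); first by apply/andP; split; lra.
by rewrite mulrC ltr_pdivrMr; lra.
Qed.

Lemma cpoly_cvg z : normc z < 1 -> ccvg (fun K => cpoly c K z) (ev c z).
Proof.
move=> z1; have [|rho r01 kz] := between (x := normc z); first by rewrite normc_ge0.
have [C hC] := hc r01; have /andP[r0 _] := r01.
by apply: (ev_cvg _ hC kz); rewrite invr_ge0 ltW.
Qed.

Let cvg_sq p : disc 1 p ->
  (fun K => (normc (cpoly c K (toC p)) ^+ 2)%:E) @ \oo --> (normc (ev c (toC p)) ^+ 2)%:E.
Proof.
move=> hp; apply: cvg_EFin; first exact: nearW.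
by apply: cvgM; exact: ccvg_normc (cpoly_cvg hp).
Qed.

Let meas_sq K : measurable_fun (disc 1) (fun p : plane => (normc (cpoly c K (toC p)) ^+ 2)%:E).
Proof. exact: measurable_sq_disc (measurable_cpoly c K). Qed.

Lemma measurable_sq_ev :
  measurable_fun (disc 1) (fun p : plane => (normc (ev c (toC p)) ^+ 2)%:E).
Proof.
by apply: (emeasurable_fun_cvg (fun K (p : plane) => (normc (cpoly c K (toC p)) ^+ 2)%:E)).
Qed.

Lemma sq_integral_cpolyE rho K : (2 < K)%N -> 0 < rho ->
  sq_integral rho (fun z => normc (cpoly c K z) ^+ 2) =
  (\sum_(n < K) normc (c n) ^+ 2 * ((rho ^+ 2) ^+ n.+1 * jmono R n))%:E.
Proof.
move=> K2 r0; rewrite sq_integral_cpoly // -sumEFin; apply: eq_bigr => n _.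
by rewrite monomialE // EFinM.
Qed.

Lemma sq_integral_lt_pinfty C : (forall M, \sum_(n < M) normc (c n) ^+ 2 / n.+1%:R <= C) ->
  (sq_integral 1 (fun z => normc (ev c z) ^+ 2)%R < +oo)%E.
Proof.
move=> hC; pose B := 2 * jmono R 0 * C.
apply: (@le_lt_trans _ _ B%:E); last exact: ltry.
(* The index is shifted by 3 because the formula for polynomials requires more than two terms;
   Fatou's lemma is applied to this sequence. *)
pose F K (p : plane) := (normc (cpoly c (K + 3) (toC p)) ^+ 2)%:E.
have FE : sq_integral 1 (fun z => normc (ev c z) ^+ 2)%R =
    (\int[leb2]_(p in disc 1) limn_einf (F^~ p))%E.
  apply: eq_integral => p; rewrite inE => hp; apply/esym.
  by apply: (cvg_limn_einf_sup _).1; exact: (cvg_comp _ _ (cvg_addnr 3) (cvg_sq hp)).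
rewrite FE; apply: le_trans (fatou _ _ _ _) _.
- exact: measurable_disc.
- by move=> K; exact: meas_sq.
- by move=> K p _; rewrite lee_fin sqr_ge0.
have hK K : (\int[leb2]_(p in disc 1) F K p <= B%:E)%E.
  have -> : (\int[leb2]_(p in disc 1) F K p)%E = sq_integral 1 (fun z => normc (cpoly c (K + 3) z) ^+ 2)%R by [].
  have K3 : (2 < K + 3)%N by rewrite addn3.
  rewrite (sq_integral_cpolyE K3 ltr01) lee_fin.
  apply: (@le_trans _ _ (\sum_(n < K + 3) 2 * jmono R 0 * (normc (c n) ^+ 2 / n.+1%:R))).
    apply: ler_sum => n _; rewrite !expr1n mul1r mulrCA ler_wpM2l ?sqr_ge0 //.
    by rewrite ler_pdivlMr ?ltr0n // mulrC; exact: (jmono_bounds R n).2.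
  rewrite -mulr_sumr /B ler_wpM2l ?hC // mulr_ge0 //; exact: ltW (jmono0_gt0 R).
rewrite limn_einf_lim; apply: lime_le; first exact: is_cvg_einfs.
apply: nearW => n; apply: le_trans (hK n); apply: ereal_inf_lbound; exists n => //=.
Qed.

(** On a smaller disc the partial sums converge uniformly, so a long one P satisfies |P|^2 <= (|f| +
    1)^2 <= 2 |f|^2 + 2. Integration gives a bound [B] independent of the disc, which may then grow
    with the number of coefficients considered. *)
Lemma sum_sq_bounded : (sq_integral 1 (fun z => normc (ev c z) ^+ 2)%R < +oo)%E ->
  exists C, forall M, \sum_(n < M) normc (c n) ^+ 2 / n.+1%:R <= C.
Proof.
set T := sq_integral 1 _ => Tlt.
have T0 : (0 <= T)%E by apply: integral_ge0 => p _; rewrite lee_fin sqr_ge0.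
have Tfin : T \is a fin_num by rewrite ge0_fin_numE.
have a0 := jmono0_gt0 R; set al := jmono R 0 in a0.
pose B := 2 * fine T + 2 * al.
have step1 rho M : 0 < rho < 1 ->
    \sum_(n < M) normc (c n) ^+ 2 * ((rho ^+ 2) ^+ n.+1 * jmono R n) <= B.
  move=> r01; have /andP[r0 r1] := r01.
  have [|rho' r01' kr] := between (x := rho); first by rewrite ltW.
  have [C hC] := hc r01'; have /andP[r0' _] := r01'.
  have k0 : 0 <= rho'^-1 by rewrite invr_ge0 ltW.
  have kr0 : 0 <= rho'^-1 * rho < 1 by rewrite kr mulr_ge0 // ltW.
  have C0 := geometric_bound_ge0 hC.
  have : (fun K => C * ((rho'^-1 * rho) ^+ K / (1 - rho'^-1 * rho))) @ \oo --> (C * (0 / (1 - rho'^-1 * rho)) : R).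
    by apply: cvgMr; apply: cvgMl; exact: exprn_cvg0 kr0.
  rewrite mul0r mulr0 => /cvgr0_norm_le /(_ _ ltr01) [K1 _ hK1].
  pose K := maxn M (maxn K1 3).
  have hK : C * ((rho'^-1 * rho) ^+ K / (1 - rho'^-1 * rho)) <= 1.
    by apply: le_trans (ler_norm _) (hK1 K _); rewrite /= /K !leq_max leqnn orbT.
  have K2 : (2 < K)%N by rewrite /K !leq_max leqnn !orbT.
  have MK : (M <= K)%N by exact: leq_maxl.
  apply: (@le_trans _ _ (\sum_(n < K) normc (c n) ^+ 2 * ((rho ^+ 2) ^+ n.+1 * jmono R n))).
    rewrite -!(big_mkord xpredT (fun n => normc (c n) ^+ 2 * ((rho ^+ 2) ^+ n.+1 * jmono R n))).
    rewrite [leRHS](big_cat_nat (n := M)) //= lerDl sumr_ge0 // => n _.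
    apply: mulr_ge0; first exact: sqr_ge0.
    by apply: mulr_ge0; [exact/exprn_ge0/sqr_ge0 | exact: jmono_ge0].
  rewrite -lee_fin -sq_integral_cpolyE //.
  have sub : disc rho `<=` @disc R 1 by move=> p; rewrite /disc /= => /lt_trans; apply.
  have mE : measurable_fun (disc rho) (fun p : plane => (normc (ev c (toC p)) ^+ 2)%:E).
    exact: measurable_funS (measurable_disc 1) sub measurable_sq_ev.
  have m2 : measurable_fun (disc rho) (fun p : plane => (2%:E * (normc (ev c (toC p)) ^+ 2)%:E)%E).
    exact: measurable_funeM.
  have c2 : measurable_fun (disc rho) (fun p : plane => (2 : R)%:E) by exact: measurable_cst.
  apply: (@le_trans _ _ (\int[leb2]_(p in disc rho) (2%:E * (normc (ev c (toC p)) ^+ 2)%R%:E + (2 : R)%:E))%E).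
    apply: ge0_le_integral.
    - exact: measurable_disc.
    - by move=> p _; rewrite lee_fin sqr_ge0.
    - exact: measurable_sq_disc (measurable_cpoly c K).
    - exact: emeasurable_funD.
    move=> p hp; rewrite -EFinM -EFinD lee_fin; set z := toC p.
    have kz : rho'^-1 * normc z < 1.
      by apply: le_lt_trans kr; rewrite ler_wpM2l // ltW.
    have t1 : normc (ev c z - cpoly c K z) <= 1.
      apply: le_trans (ev_tail k0 K hC kz) _; apply: le_trans hK; rewrite ler_wpM2l //.
      have z0 : 0 <= rho'^-1 * normc z by rewrite mulr_ge0 ?normc_ge0.
      have zr : rho'^-1 * normc z <= rho'^-1 * rho by rewrite ler_wpM2l // ltW.
      apply: ler_pM; rewrite ?exprn_ge0 ?invr_ge0 ?subr_ge0 ?(ltW kz) //.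
        by rewrite lerXn2r ?nnegrE // (le_trans z0).
      by rewrite lef_pV2 ?posrE ?subr_gt0 // lerD2l lerN2.
    have t2 : normc (cpoly c K z) <= normc (ev c z) + 1.
      have -> : cpoly c K z = ev c z - (ev c z - cpoly c K z) by rewrite subKr.
      by apply: le_trans (normcD _ _) _; rewrite normcNE lerD2l.
    have t3 : normc (cpoly c K z) ^+ 2 <= (normc (ev c z) + 1) ^+ 2.
      by rewrite lerXn2r ?nnegrE ?normc_ge0 // addr_ge0 // normc_ge0.
    apply: le_trans t3 _; have := sqr_ge0 (normc (ev c z) - 1).
    by move: (normc (ev c z)) => u; lra.
  rewrite ge0_integralD; [|exact: measurable_disc|by move=> p _; rewrite mule_ge0 // lee_fin sqr_ge0|exact: m2|by move=> p _; rewrite lee_fin|exact: c2].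
  rewrite ge0_integralZl; [|exact: measurable_disc|exact: mE|by move=> p _; rewrite lee_fin sqr_ge0|by rewrite lee_fin].
  rewrite integral_cst; last exact: measurable_disc.
  have -> : B%:E = (2%:E * T + 2%:E * al%:E)%E by rewrite -[in RHS](fineK Tfin) -!EFinM -EFinD.
  apply: leeD.
    apply: lee_wpmul2l; first by rewrite lee_fin.
    have p0 p : @disc R 1 p -> (0 <= (normc (ev c (toC p)) ^+ 2)%:E)%E.
      by move=> _; rewrite lee_fin sqr_ge0.
    exact: (@ge0_subset_integral _ _ _ leb2 _ _ (measurable_disc rho) (measurable_disc 1)
      _ measurable_sq_ev p0 sub).
  apply: lee_wpmul2l; first by rewrite lee_fin.
  have -> : al%:E = leb2 (@disc R 1) by rewrite -jmonoE monomial0.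
  exact: (@le_measure _ _ _ leb2 _ _ (mem_set (measurable_disc rho)) (mem_set (measurable_disc 1)) sub).
exists (4 * B / al) => M.
(* Bernoulli's inequality makes rho^(2(n+1)) >= 1/2 for n < M; together with the factor 2 in
   [jmono_bounds] this yields the constant 4. *)
pose x : R := (4 * M.+1%:R)^-1; pose rho := 1 - x.
have M1 : 1 <= M.+1%:R :> R by rewrite ler1n.
have x0 : 0 < x by rewrite invr_gt0 mulr_gt0.
have x4 : x <= 4^-1 by rewrite lef_pV2 ?posrE ?mulr_gt0 // ler_peMr.
have r01 : 0 < rho < 1 by rewrite /rho; apply/andP; split; lra.
have h := step1 rho M r01.
have rp n : (n < M)%N -> 2^-1 <= (rho ^+ 2) ^+ n.+1.
  move=> nM; rewrite -exprM.
  apply: le_trans (bernoulli_inequality (2 * n.+1) _); last by apply/andP; split; lra.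
  suff : (2 * n.+1)%:R * x <= 2^-1 by lra.
  rewrite /x ler_pdivrMr ?mulr_gt0 // natrM mulrA.
  have : n.+1%:R <= M.+1%:R :> R by rewrite ler_nat ltnW.
  lra.
rewrite ler_pdivlMr // mulr_suml.
apply: le_trans (_ : 4 * (\sum_(n < M) normc (c n) ^+ 2 * ((rho ^+ 2) ^+ n.+1 * jmono R n)) <= _); last by rewrite ler_pM2l.
rewrite mulr_sumr; apply: ler_sum => n _.
rewrite mulrCA -mulrA ler_wpM2l ?sqr_ge0 //.
have n0 : 0 < n.+1%:R :> R by rewrite ltr0n.
rewrite mulrC ler_pdivrMr //.
apply: le_trans (jmono_bounds R n).1 _.
have j0 := jmono_ge0 R n.
have := ler_wpM2r (mulr_ge0 (ltW n0) j0) (rp n (ltn_ord n)).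
move: (_ ^+ n.+1) (n.+1%:R) (jmono R n) => u v w; lra.
Qed.

End SquareIntegrals.

(** * The Dirichlet integral and zero sets *)

Section Topology.
Variable R : realType.
Implicit Types (z w : R[i]).

Lemma normc_lt z (e : R) : ((`|z| : R[i]) < e%:C) = (normc z < e).
Proof. by rewrite normr_normc ltcR. Qed.

Lemma cvg_ccvgP (u : nat -> cplx R) (l : cplx R) : u @ \oo --> l <-> ccvg u l.
Proof.
split=> [h|/ccvgP h].
  apply/ccvgP => e e0; have e0' : (0 : R[i]) < e%:C by rewrite ltcR.
  move/cvgrPdist_lt : h => /(_ _ e0') [N _ hN]; exists N => n Nn; apply: ltW.
  by rewrite normcB -normc_lt; exact: hN.
apply/cvgrPdist_lt => e e0.
(* In the order of [R[i]], a positive number is real. *)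
have eE : e = (complex.Re e)%:C.
  by case: e e0 => x y; rewrite ltcE /= => /andP[/eqP -> _].
have e2 : 0 < complex.Re e / 2.
  by rewrite divr_gt0 //; move: e0; rewrite eE ltcR.
have [N hN] := h _ e2; exists N => // n /= Nn; rewrite eE.
have hn : normc (l - u n) < complex.Re e.
  by rewrite normcB; apply: le_lt_trans (hN n Nn) _; lra.
by rewrite -normc_lt in hn.
Qed.

Lemma near_cplxP (P : cplx R -> Prop) (a : cplx R) :
  (\forall z \near a, P z) <-> exists2 d : R, 0 < d & forall z, normc (z - a) < d -> P z.
Proof.
split=> [|[d d0 hd]].
  move=> /nbhs_normP[e /= e0 he].
  have eE : e = (complex.Re e)%:C.
    by case: e e0 {he} => x y; rewrite ltcE /= => /andP[/eqP -> _].
  exists (complex.Re e); first by move: e0; rewrite eE ltcR.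
  move=> z hz; apply: he => /=; rewrite eE.
  by rewrite normcB -normc_lt in hz.
have d0' : (0 : R[i]) < d%:C by rewrite ltcR.
apply/nbhs_normP; exists d%:C => // z /= hz; apply: hd.
by rewrite normcB -normc_lt.
Qed.

End Topology.

(** * Analyticity, multiplicity and derivative through power series *)

Section AnalyticFunctions.
Variable R : realType.
Implicit Types (z w : R[i]) (f : cplx R -> cplx R).

Lemma unit_discE z : @unit_disc R z = (normc z < 1) :> Prop.
Proof. by rewrite /unit_disc /= -normc_lt. Qed.

Lemma series_cvgP (d : nat -> cplx R) z w l :
  (series (fun n => d n * (z - w) ^+ n) : nat -> cplx R) @ \oo --> (l : cplx R) <->
  ccvg (fun n => \sum_(j < n) d j * (z - w) ^+ j) l.
Proof.
rewrite cvg_ccvgP; suff -> : series (fun n => d n * (z - w) ^+ n) =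
  (fun n => \sum_(j < n) d j * (z - w) ^+ j) :> (nat -> cplx R) by [].
by apply/funext => n; rewrite /series /= big_mkord.
Qed.

(** Convergence at distance e / 2 from [w] bounds the terms of the series there: late ones are
    differences of partial sums within 1 of the limit, hence at most 2, and the finitely many others
    are added to [M]. *)
Lemma analytic_at_power_rep f w : analytic_at f w ->
  exists r M d, 0 < r /\ power_rep f w r M d.
Proof.
move=> [d /near_cplxP[e e0 he]].
have e2 : 0 < e / 2 by lra.
pose r := e / 2; have r0 : 0 < r by [].
have hr : normc (w + r%:C - w) < e.
  by rewrite addrAC subrr add0r normc_real ger0_norm ?ltW // /r; lra.
have /series_cvgP := he _ hr; rewrite addrAC subrr add0r => hs.
have [N hN] := (ccvgP _ _).1 hs 1 ltr01.
have tail n : (N <= n)%N -> normc (d n) * r ^+ n <= 2.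
  move=> Nn.
  have -> : normc (d n) * r ^+ n = normc (d n * r%:C ^+ n).
    by rewrite normcM normcX normc_real ger0_norm ?ltW.
  have -> : d n * r%:C ^+ n =
      (\sum_(j < n.+1) d j * r%:C ^+ j - f (w + r%:C)) - (\sum_(j < n) d j * r%:C ^+ j - f (w + r%:C)).
    by rewrite big_ord_recr /= opprB addrA subrK addrAC subrr add0r.
  apply: le_trans (normcD _ _) _; rewrite normcNE.
  by have := hN n Nn; have := hN n.+1 (leqW Nn); lra.
pose M := 2 + \sum_(j < N) normc (d j) * r ^+ j.
have S0 : 0 <= \sum_(j < N) normc (d j) * r ^+ j.
  by apply: sumr_ge0 => j _; rewrite mulr_ge0 ?normc_ge0 // exprn_ge0 // ltW.
have hd : geometric_bound M r^-1 d.
  move=> n; rewrite exprVn ler_pdivlMr ?exprn_gt0 //.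
  have [Nn|nN] := leqP N n; first by apply: le_trans (tail n Nn) _; rewrite /M lerDl.
  rewrite /M (bigD1 (Ordinal nN)) //= addrCA lerDl addr_ge0 // sumr_ge0 // => j _.
  by rewrite mulr_ge0 ?normc_ge0 // exprn_ge0 // ltW.
exists r, M, d; split=> //; split=> // z zr.
have ze : normc (z - w) < e by apply: lt_trans zr _; rewrite /r; lra.
by have /series_cvgP/ev_uniq := he _ ze.
Qed.

Lemma analytic_on_locally f : analytic_on (@unit_disc R) f -> locally_analytic f.
Proof. by move=> hf w w1; apply: analytic_at_power_rep; apply: hf; rewrite unit_discE. Qed.

Lemma analytic_at_ev c (b : nat -> R[i]) w : geometric_bound c 1 b -> normc w < 1 ->
  analytic_at (ev b : cplx R -> cplx R) w.
Proof.
move=> hb w1; have kw : 1 * normc w < 1 by rewrite mul1r.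
exists (tcoef w b); apply/near_cplxP; exists (1 - normc w); first by rewrite subr_gt0.
move=> z hz; apply/series_cvgP.
have h1 : 1 * normc (z - w) < 1 - 1 * normc w by rewrite !mul1r.
have [_ ->] := ev_recenter ler01 kw hb h1.
have w1' : 0 < 1 - 1 * normc w by rewrite subr_gt0.
apply: (ev_cvg _ (tcoef_bound ler01 kw hb)); first by rewrite divr_ge0 // ltW.
by rewrite mulrAC ltr_pdivrMr // [X in _ < X]mul1r.
Qed.

Lemma zero_of_multiplicity_ord f c (a : nat -> R[i]) w m : geometric_bound c 1 a ->
  (forall z, normc z < 1 -> f z = ev a z) -> normc w < 1 ->
  zero_of_multiplicity f w m -> ord a w m.
Proof.
move=> ha fE w1 [g [hg g0 hfg]].
have kw : 1 * normc w < 1 by rewrite mul1r.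
have [r [M [d [r0 [hd gE]]]]] := analytic_at_power_rep hg.
have k0 : 0 <= r^-1 by rewrite invr_ge0 ltW.
have k00 : r^-1 * normc (0 : R[i]) < 1 by rewrite normc0 mulr0.
have s0 : ccvg (step R) 0.
  by apply: ccvg_eq (step_cvg 0); apply: nearW => i; rewrite add0r.
have gw : g w = ev d 0 by rewrite gE subrr // normc0.
have near_w (e : R) : 0 < e -> \forall i \near \oo, normc (step R i) < e.
  move=> e0; near=> i; rewrite normc_step; near: i.
  exact: (near_infty_natSinv_lt (PosNum e0)).
have hG : ccvg (fun i => g (w + step R i)) (g w).
  rewrite gw; apply: ccvg_eq (ev_continuous k0 hd k00 s0); near=> i.
  rewrite gE ?stepK; first exact: erefl.
  by near: i; exact: near_w.
move: hfg => /near_cplxP[e e0 he].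
apply: (ord_factor ler01 ha kw (ccvg_cst 1) hG (oner_neq0 _) g0); near=> i.
rewrite mulr1 -fE; last first.
  by rewrite -[X in X < _]mul1r; near: i; exact: near_step kw.
rewrite he ?stepK; first exact: erefl.
by near: i; exact: near_w.
Unshelve. all: by end_near. Qed.

Lemma ord_zero_of_multiplicity c (b : nat -> R[i]) w m : geometric_bound c 1 b ->
  normc w < 1 -> ord b w m -> zero_of_multiplicity (ev b : cplx R -> cplx R) w m.
Proof.
move=> hb w1 [h0 hm]; have kw : 1 * normc w < 1 by rewrite mul1r.
exists (ev (iter m (bshift w) b)); split.
- exact: analytic_at_ev (iter_bshift_bound ler01 kw m hb) w1.
- exact: hm.
apply/near_cplxP; exists (1 - normc w); first by rewrite subr_gt0.
move=> z hz; apply: (ev_ord ler01 hb kw h0).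
have := normcD (z - w) w; rewrite subrK mul1r => /le_lt_trans; apply.
by rewrite -ltrBrDr.
Qed.

Lemma derive1_ev f c k (a : nat -> R[i]) w : 0 <= k -> geometric_bound c k a -> k * normc w < 1 ->
  (forall z, k * normc z < 1 -> f z = ev a z) ->
  derive1 f w = ev (dcoef 1 a) w.
Proof.
move=> k0 ha kw fE; rewrite -(tcoefE k0 kw 1 ha) /tcoef /=.
have hb := bshift_bound k0 kw ha; have hb2 := bshift_bound k0 kw hb.
apply: cvg_lim; first exact: norm_hausdorff.
pose t := (1 + k * normc w) / 2.
have t1 : t < 1 by rewrite /t; lra.
have tkw : k * normc w < t by rewrite /t; lra.
pose L := c * (k / (1 - k * normc w)) * (k / (1 - k * normc w)) / (1 - t).
have L0 : 0 <= L.
  by rewrite /L divr_ge0 ?(geometric_bound_ge0 hb2) // subr_ge0 ltW.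
apply/cvgrPdist_lt => e e0.
have eE : e = (complex.Re e)%:C.
  by case: e e0 => x y; rewrite ltcE /= => /andP[/eqP -> _].
have er : 0 < complex.Re e by move: e0; rewrite eE ltcR.
(* The first bound keeps k |h + w| below t; the second makes L |h| smaller than e, with L a
   Lipschitz constant of the quotient at [w]. *)
pose d := Num.min ((t - k * normc w) / (k + 1)) (complex.Re e / (L + 1)).
have k1 : 0 < k + 1 by lra.
have L1 : 0 < L + 1 by lra.
have d0 : 0 < d by rewrite lt_min !divr_gt0 // subr_gt0.
have : \forall h \near (0 : cplx R), h != 0 ->
    `|ev (bshift w a) w - (h^-1 *: (f (h + w) - f w) : cplx R)| < e.
  apply/near_cplxP; exists d => // h; rewrite subr0 => hd h0.
  have hd1 : (k + 1) * normc h < t - k * normc w.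
    by rewrite mulrC -ltr_pdivlMr //; apply: lt_le_trans hd _; rewrite ge_min lexx.
  have hd2 : (L + 1) * normc h < complex.Re e.
    by rewrite mulrC -ltr_pdivlMr //; apply: lt_le_trans hd _; rewrite ge_min lexx orbT.
  have kz : k * normc (h + w) < t.
    apply: le_lt_trans (ler_wpM2l k0 (normcD _ _)) _; rewrite mulrDr.
    have := normc_ge0 h; move: hd1; lra.
  have kz1 := lt_trans kz t1.
  have E : h^-1 *: (f (h + w) - f w) = ev (bshift w a) (h + w).
    rewrite (fE _ kz1) (fE _ kw) (ev_bshift k0 kw ha kz1) addrAC subrr add0r addrK.
    by rewrite -[LHS]/(h^-1 * (h * ev (bshift w a) (h + w))) mulKf.
  rewrite E eE normc_lt normcB (ev_bshift k0 kw hb kz1) addrK addrAC subrr add0r normcM.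
  apply: le_lt_trans hd2; rewrite mulrC.
  apply: le_trans (ler_wpM2r (normc_ge0 _) (_ : _ <= L)) _; last by rewrite ler_wpM2r ?normc_ge0 // lerDl.
  apply: le_trans (ev_bound k0 hb2 kz1) _.
  rewrite /L ler_wpM2l ?(geometric_bound_ge0 hb2) // lef_pV2 ?posrE ?subr_gt0 //.
  by rewrite lerD2l lerN2 ltW.
exact.
Qed.

End AnalyticFunctions.

Section DirichletIntegral.
Variable R : realType.
Local Notation leb := (@lebesgue_measure R).
Local Notation plane := (measurableTypeR R * measurableTypeR R)%type.
Local Notation leb2 := (leb \x leb)%E.
Variables (f : cplx R -> cplx R) (a : nat -> R[i]).
Hypothesis ha : forall rho, 0 < rho < 1 -> exists C, geometric_bound C rho^-1 a.
Hypothesis fE : forall z, normc z < 1 -> f z = ev a z.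

Lemma dcoef1_bound rho : 0 < rho < 1 -> exists C, geometric_bound C rho^-1 (dcoef 1 a).
Proof.
move=> /andP[r0 r1]; have [C hC] : exists C, geometric_bound C ((1 + rho) / 2)^-1 a.
  by apply: ha; apply/andP; split; lra.
have k0 : 0 <= ((1 + rho) / 2)^-1 by rewrite invr_ge0; lra.
have kk : ((1 + rho) / 2)^-1 < rho^-1 by rewrite ltf_pV2 ?posrE //; lra.
by eexists; exact: (dcoef_bound k0 1 kk hC).
Qed.

Lemma derive1_disc z : normc z < 1 -> derive1 f z = ev (dcoef 1 a) z.
Proof.
move=> z1; pose rho := (1 + normc z) / 2.
have z0 := normc_ge0 z.
have r01 : 0 < rho < 1 by rewrite /rho; apply/andP; split; lra.
have [C hC] := ha r01; have /andP[r0 r1] := r01.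
have k0 : 0 <= rho^-1 by rewrite invr_ge0 ltW.
apply: (derive1_ev k0 hC).
  by rewrite mulrC ltr_pdivrMr // mul1r /rho; lra.
move=> y; rewrite mulrC ltr_pdivrMr // mul1r => yr; apply: fE.
exact: lt_trans r1.
Qed.

Lemma dirichlet_integralE : dirichlet_integral f =
  ((pi^-1)%:E * sq_integral 1 (fun z => normc (ev (dcoef 1 a) z) ^+ 2)%R)%E.
Proof.
rewrite /dirichlet_integral.
have -> : [set p : plane | unit_disc (p.1 +i* p.2)] = @disc R 1.
  by apply/seteqP; split => p /=; rewrite unit_discE.
have m := measurable_sq_ev dcoef1_bound.
rewrite /normalized_area /sq_integral.
rewrite (eq_integral (fun p : plane => (normc (ev (dcoef 1 a) (toC p)) ^+ 2)%:E)); last first.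
  by move=> p; rewrite inE => hp; rewrite (derive1_disc hp).
rewrite ge0_integral_mscale; [exact: erefl | exact: measurable_disc | exact: m |].
by move=> p _; rewrite lee_fin sqr_ge0.
Qed.

(** The n-th coefficient of the derivative is (n+1) a_{n+1}, and the weight 1 / (n+1) of its square
    integral leaves (n+1) |a_{n+1}|^2. *)
Lemma dirichlet_integral_lty : (dirichlet_integral f < +oo)%E <->
  exists C, forall M, dsum a M <= C.
Proof.
have sumE M : \sum_(n < M) normc (dcoef 1 a n) ^+ 2 / n.+1%:R = dsum a M.+1.
  rewrite /dsum big_ord_recl mul0r add0r; apply: eq_bigr => n _.
  rewrite /dcoef addn1 bin1 normcM -(rmorph_nat (real_complex R)) normc_real ger0_norm //.
  have : n.+1%:R != 0 :> R by rewrite pnatr_eq0.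
  by rewrite lift0 exprMn; move: (n.+1%:R : R) => u u0; field.
have p0 : 0 < pi^-1 :> R by rewrite invr_gt0 pi_gt0.
rewrite dirichlet_integralE; set S := sq_integral _ _.
split=> [h|[C hC]].
  have [|C hC] := sum_sq_bounded dcoef1_bound.
    have -> : sq_integral 1 (fun z => normc (ev (dcoef 1 a) z) ^+ 2)%R = (pi%:E * (pi^-1%:E * S))%E.
      by rewrite muleA -EFinM mulfV ?mul1e // gt_eqF // pi_gt0.
    by apply: lte_mul_pinfty; rewrite ?lee_fin // ltW // pi_gt0.
  exists C => -[|M]; last by rewrite -sumE.
  by rewrite /dsum big_ord0; apply: le_trans (hC 0%N); rewrite big_ord0.
apply: lte_mul_pinfty; rewrite ?lee_fin ?(ltW p0) //.
by apply: (sq_integral_lt_pinfty dcoef1_bound) => M; rewrite sumE; exact: hC.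
Qed.

End DirichletIntegral.

(** * Multiplicities as eventually constant counts *)

Section Counting.
Variables (R : realType) (s : nat -> cplx R) (z : R[i]).

Lemma count_zeros_card N : ([set n | s n = z] `&` `I_N #= `I_(count_zeros s z N))%card.
Proof.
elim: N => [|N IH].
  by rewrite /count_zeros big_ord0 II0 setI0.
rewrite count_zerosS; have [sN|sN] := eqVneq (s N) z.
  rewrite addn1; apply/eq_cardSP; exists N; first by split => //=.
  apply: card_eq_trans IH; rewrite (_ : _ `\ N = [set n | s n = z] `&` `I_N) //.
  apply/seteqP; split => n /=.
    by move=> [[h nN] nN']; split=> //; rewrite ltn_neqAle -ltnS nN andbT; apply/eqP.
  by move=> [h nN]; split; [split=> //; exact: ltnW|move=> e; rewrite e ltnn in nN].
rewrite addn0; apply: card_eq_trans IH; rewrite (_ : _ `&` `I_N.+1 = [set n | s n = z] `&` `I_N) //.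
apply/seteqP; split => n /= [h nN]; split=> //; last exact: ltnW.
rewrite ltn_neqAle -ltnS nN andbT; apply/eqP => e.
by rewrite e in h; rewrite h eqxx in sN.
Qed.

Lemma card_II_bounded (A : set nat) k : (A #= `I_k)%card -> exists N, A `<=` `I_N.
Proof.
elim: k A => [|k IH] A.
  by rewrite II0 card_eq0 => /eqP ->; exists 0%N.
move=> /eq_cardSP[x Ax /IH[N hN]]; exists (maxn N x.+1) => n An /=.
have [->|nx] := eqVneq n x; first by rewrite leq_max ltnSn orbT.
by rewrite leq_max hN //; split=> //; apply/eqP.
Qed.

Lemma multiplicity_countP k : ([set n | s n = z] #= `I_k)%card <->
  exists N0, forall N, (N0 <= N)%N -> count_zeros s z N = k.
Proof.
split=> [h|[N0 hN0]].
  have [N0 hN0] := card_II_bounded h; exists N0 => N NN.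
  have E : [set n | s n = z] `&` `I_N = [set n | s n = z].
    by apply/setIidPl => n /hN0 /= h'; exact: leq_trans h' NN.
  have := count_zeros_card N; rewrite E => h2.
  by apply/card_eq_II; apply: card_eq_trans h; exact: card_esym.
have E : [set n | s n = z] = [set n | s n = z] `&` `I_N0.
  apply/seteqP; split => n /= => [h|[]//]; split=> //.
  rewrite ltnNge; apply/negP => Nn.
  have := hN0 n.+1 (leqW Nn); rewrite count_zerosS hN0 // h eqxx => /eqP.
  by rewrite -[X in _ == X]addn0 eqn_add2l.
by rewrite E -(hN0 N0 (leqnn _)); exact: count_zeros_card.
Qed.

End Counting.

Lemma geometric_bound1_rate (R : realType) c (a : nat -> R[i]) rho : geometric_bound c 1 a ->
  0 < rho < 1 -> geometric_bound c rho^-1 a.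
Proof.
move=> ha /andP[r0 r1]; apply: geometric_bound_rate ha => //.
by rewrite invf_ge1 // ltW.
Qed.

Theorem theorem1p3 (R : realType) (r t s : nat -> R)
    (hr : forall n, 0 < r n < 1)
    (hs : forall n, r n <= s n < 1)
    (hzero : dirichlet_zero_set (fun n => (r n)%:C * expi (t n))) :
  dirichlet_zero_set (fun n => (s n)%:C * expi (t n)).
Proof.
have r0 n : 0 < r n by case/andP: (hr n).
have r1 n : r n < 1 by case/andP: (hr n).
have rs n : r n <= s n by case/andP: (hs n).
have s1 n : s n < 1 by case/andP: (hs n).
have s0 n : 0 < s n by exact: lt_le_trans (r0 n) (rs n).
pose p n : R[i] := (r n)%:C * expi (t n).
have pE n : normc (p n) = r n by rewrite normcM normc_real normc_expi mulr1 gtr0_norm.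
(* With this ratio p / lam is the prescribed point s e^{it}, and |p| = r <= lam because s < 1. *)
pose lam n := r n / s n.
have lam1 n : lam n <= 1 by rewrite ler_pdivrMr // mul1r.
have plam n : normc (p n) <= lam n by rewrite pE ler_pdivlMr // ler_piMr // ltW.
have qE n : (lam n)^-1%:C * p n = (s n)%:C * expi (t n).
  rewrite /p mulrA; suff -> : (lam n)^-1%:C * (r n)%:C = (s n)%:C by exact: erefl.
  have lrs : (lam n)^-1 * r n = s n by rewrite /lam invf_div mulrVK // unitfE gt_eqF.
  by apply/eqP; rewrite eq_complex /= !mul0r !mulr0 subr0 addr0 lrs !eqxx.
have [_ [f [fan fD] fz]] := hzero.
have [a ga] := analytic_power_series (analytic_on_locally fan).
have ha rho : 0 < rho < 1 -> exists C, geometric_bound C rho^-1 a by move=> /ga[].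
have fE z : normc z < 1 -> f z = ev a z.
  move=> z1; have z0 := normc_ge0 z.
  have [|_ h] := ga ((1 + normc z) / 2); first by apply/andP; split; lra.
  by apply: h; lra.
have [C aC] := (dirichlet_integral_lty ha fE).1 fD.
have ga1 := hsum_bound (dsum_hsum aC).
have hord w : normc w < 1 ->
    exists2 K, ord a w K & exists N0, forall N, (N0 <= N)%N -> count_zeros p w N = K.
  move=> w1; have [|K /multiplicity_countP hK hz] := fz w; first by rewrite unit_discE.
  by exists K => //; exact: zero_of_multiplicity_ord ga1 fE w1 hz.
(* All r_n are positive, so the origin is not among the prescribed zeros. *)
have a0 : a 0%N != 0.
  have [|K [h0 hK] [N0 /(_ _ (leqnn _)) cK]] := hord 0; first by rewrite normc0.
  have c0 N : count_zeros p 0 N = 0%N.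
    elim: N => [|N IH]; first by rewrite /count_zeros big_ord0.
    by rewrite count_zerosS IH -normc_eq0 pE gt_eqF.
  by move: hK; rewrite -cK c0 /tcoef /= (ev0 ler01 ga1).
have pp0 n : 0 < normc (p n) by rewrite pE.
have pp1 n : normc (p n) < 1 by rewrite pE.
have [b [gb bC] hb] := moved_zeros pp0 pp1 plam lam1 aC a0 hord.
have gb' rho (h : 0 < rho < 1) : exists C, geometric_bound C rho^-1 b.
  by exists (Num.sqrt (normc (a 0%N) ^+ 2 + C)); exact: geometric_bound1_rate gb h.
split=> [n|]; first by rewrite unit_discE normcM normc_real normc_expi mulr1 gtr0_norm.
exists (ev b : cplx R -> cplx R).
  split; last by apply/(dirichlet_integral_lty gb' (fun z _ => erefl)); exists C.
  by move=> w; rewrite unit_discE => w1; exact: analytic_at_ev gb w1.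
move=> z; rewrite unit_discE => z1; have [m om hm] := hb z z1.
exists m; last exact: ord_zero_of_multiplicity gb z1 om.
apply/multiplicity_countP; have [N0 hN0] := hm; exists N0 => N NN.
rewrite -(hN0 N NN) /count_zeros; apply: eq_bigr => n _; rewrite -qE; exact: erefl.
Qed.
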